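(* For each $n\ge1$ let $\boldsymbol w=(w_i)_{i\in[n]}$ (depending on $n$) be nonnegative weights with $L_n=\sum_{i\in[n]}w_i=\omega(\log n)$. Let $\rho_n=\frac1{\sqrt{L_n}}\sum_{i\in[n]}\delta_{w_i/\sqrt{L_n}}$. Suppose that (i) $\rho_n$ converges vaguely to some measure $\rho_w$; (ii) $\lim_{\varepsilon\to0}\limsup_{n\to\infty}\int_0^\varepsilon x\rho_n(dx)=\lim_{\varepsilon\to0}\liminf_{n\to\infty}\int_0^\varepsilon x\rho_n(dx)=a$; (iii) $\lim_{n\to\infty}\int_0^\infty\int_0^\infty\frac{xy}{1+xy}\rho_n(dx)\rho_n(dy)=c>0$. If $a=0$, then $\mathrm{GRG}_n(\boldsymbol w)$ converges to $W^c_{\mathrm{GRG}}$ in the stretched cut metric a.s. $\mathbb P_{\mathrm{GRG}}$, where $$W^c_{\mathrm{GRG}}(x,y)=\frac{\bar\rho_w^{-1}(\sqrt c\,x)\bar\rho_w^{-1}(\sqrt c\,y)}{1+\bar\rho_w^{-1}(\sqrt c\,x)\bar\rho_w^{-1}(\sqrt c\,y)}\ \text{ for }x\ne y,\qquad W^c_{\mathrm{GRG}}(x,x)=0.$$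
   Context: $\mathrm{GRG}_n(\boldsymbol w)$ is the random simple graph on $[n]$ in which each pair $i\ne j$ is connected independently with probability $p_{ij}=\frac{w_iw_j}{L_n+w_iw_j}$. $\mathbb P_{\mathrm{GRG}}$ is the joint law of the sequence, the graphs being independent for different $n$. $\rho_n,\rho_w$ are measures on $(0,\infty)$, vague convergence is on $(0,\infty)$. For a measure $\rho$ on $(0,\infty)$: $\bar\rho(x)=\int_x^\infty\rho(dy)$, $\bar\rho^{-1}(y)=\inf\{x\in\mathbb R_+:\bar\rho(x)\le y\}$ for $y>0$, $\bar\rho^{-1}(0)=0$. Stretched cut metric: for integrable symmetric measurable $W_1,W_2:\mathbb R_+^2\to[0,1]$, $$\delta_\square(W_1,W_2)=\inf_\gamma\sup_{U,V}\Big|\int_U\int_V\big(W_1(x,y)-W_2(x',y')\big)\gamma(dx,dx')\gamma(dy,dy')\Big|,$$ with infimum over measures $\gamma$ on $\mathbb R_+^2$ both of whose marginals are Lebesgue measure and supremum over measurable $U,V\subset\mathbb R_+^2$. The stretched version of $W$ is $W^s(x,y)=W(\|W\|_1^{1/2}x,\|W\|_1^{1/2}y)$ and the stretched cut distance is $\delta^s_\square(W_1,W_2)=\delta_\square(W_1^s,W_2^s)$. A graph $G$ with $m$ vertices is identified with its canonical graphon: the function equal to $1$ on $[\frac{i-1}m,\frac im)\times[\frac{j-1}m,\frac jm)$ if $i,j$ are adjacent, and $0$ elsewhere in $\mathbb R_+^2$; $G_n$ converges to $W$ in the stretched cut metric if the stretched cut distance between the canonical graphon of $G_n$ and $W$ tends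 to $0$. *)

(* Defs.v *)
From HB Require Import structures.
From mathcomp Require Import all_boot all_order all_algebra finmap.
From mathcomp Require Import all_classical all_reals all_analysis.

Set Implicit Arguments.
Unset Strict Implicit.
Unset Printing Implicit Defensive.

Import Order.TTheory GRing.Theory Num.Theory numFieldNormedType.Exports.
Local Open Scope classical_set_scope.
Local Open Scope ring_scope.

(* Measures on (0, oo) and on R_+^2 are encoded as measures on R and on R^2,
   and functions on R_+^2 as functions of two reals; everything below uses only
   their restrictions to (0, oo) or to R_+^2, so their behaviour elsewhere is
   irrelevant. *)
Definition pos_reals (R : realType) : set R := `]0, +oo[.
Definition nneg_reals (R : realType) : set R := `[0, +oo[.
Arguments pos_reals R _ : clear implicits.
Arguments nneg_reals R _ : clear implicits.

Definition total_weight (R : realType) (n : nat) (w : nat -> R) : R :=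
  \sum_(i < n) w i.

(* The vertex set [n] is {0, ..., n.-1}. *)
Definition edge_prob (R : realType) (n : nat) (w : nat -> R) (i j : nat) : R :=
  w i * w j / (total_weight n w + w i * w j).

(* Vertices of weight 0 give atoms at 0, outside of (0, oo). *)
Definition weight_measure (R : realType) (n : nat) (w : nat -> R) :
    {measure set (measurableTypeR R) -> \bar R} :=
  mscale ((Num.sqrt (total_weight n w))^-1)%:nng
    (msum (fun i => @dirac _ (measurableTypeR R)
                      (w i / Num.sqrt (total_weight n w)) R) n).

Definition vague_cvg (R : realType)
    (mu : nat -> {measure set (measurableTypeR R) -> \bar R})
    (nu : {measure set (measurableTypeR R) -> \bar R}) : Prop :=
  forall f : R -> R, continuous f ->
    compact (closure [set x | f x != 0]) ->
    closure [set x | f x != 0] `<=` pos_reals R ->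
    (\int[mu n]_(x in pos_reals R) (f x)%:E)%E @[n --> \oo] -->
    (\int[nu]_(x in pos_reals R) (f x)%:E)%E.

Definition tail (R : realType)
    (rho : {measure set (measurableTypeR R) -> \bar R}) (x : R) : \bar R :=
  rho `]x, +oo[%classic.

(* [inf] is the real-valued infimum, with value 0 on the empty set. The set
   below is nonempty as soon as tail rho tends to 0 at infinity, which holds for
   vague limits of weight measures since these satisfy tail x <= 1 / x. *)
Definition tail_inv (R : realType)
    (rho : {measure set (measurableTypeR R) -> \bar R}) (y : R) : R :=
  if 0 < y then inf [set x : R | 0 <= x /\ (tail rho x <= y%:E)%E] else 0.

Definition GRG_graphon (R : realType)
    (rho : {measure set (measurableTypeR R) -> \bar R}) (c x y : R) : R :=
  if x == y then 0 else
  let u := tail_inv rho (Num.sqrt c * x) in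
  let v := tail_inv rho (Num.sqrt c * y) in
  u * v / (1 + u * v).

Definition mutually_independent d (T : measurableType d) (R : realType)
    (P : probability T R) (I : choiceType) (D : set I) (E : I -> set T) : Prop :=
  forall J : {fset I}, [set` J] `<=` D ->
    P (\bigcap_(i in [set` J]) E i) = (\prod_(i <- J) P (E i))%E.

Record is_GRG d (T : measurableType d) (R : realType) (P : probability T R)
    (n : nat) (w : nat -> R) (G : T -> rel 'I_n) : Prop := {
  GRG_sym : forall t, symmetric (G t);
  GRG_irr : forall t, irreflexive (G t);
  GRG_measurable : forall i j, measurable [set t | G t i j];
  GRG_prob : forall i j, i != j ->
    P [set t | G t i j] = (edge_prob n w i j)%:E;
  GRG_indep : mutually_independent P
    [set ij : 'I_n * 'I_n | (ij.1 < ij.2)%N] (fun ij => [set t | G t ij.1 ij.2])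
}.

(* Each graph takes finitely many values, so that every event
   [set t | A n (G n t)] below is measurable as soon as the edge events are. *)
Definition independent_graphs d (T : measurableType d) (R : realType)
    (P : probability T R) (G : forall n, T -> rel 'I_n) : Prop :=
  forall A : forall n, set (rel 'I_n),
    mutually_independent P [set: nat] (fun n => [set t | A n (G n t)]).

(* [G] is a realization of the joint law of the sequence of graphs. *)
Definition is_GRG_sequence d (T : measurableType d) (R : realType)
    (P : probability T R) (w : nat -> nat -> R)
    (G : forall n, T -> rel 'I_n) : Prop :=
  (forall n, is_GRG P (w n) (G n)) /\ independent_graphs P G.

Definition lebesgue_coupling (R : realType)
    (gamma : {measure set (measurableTypeR R * measurableTypeR R) -> \bar R}) :
    Prop :=
  forall A : set (measurableTypeR R), measurable A -> A `<=` nneg_reals R ->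
    gamma (A `*` nneg_reals R) = lebesgue_measure A /\
    gamma (nneg_reals R `*` A) = lebesgue_measure A.

Definition coupling_cut_norm (R : realType)
    (gamma : {measure set (measurableTypeR R * measurableTypeR R) -> \bar R})
    (W1 W2 : R -> R -> R) : \bar R :=
  ereal_sup [set r : \bar R |
    exists U V : set (measurableTypeR R * measurableTypeR R),
    [/\ measurable U, measurable V,
        U `<=` nneg_reals R `*` nneg_reals R,
        V `<=` nneg_reals R `*` nneg_reals R &
        r = `| \int[gamma]_(p in U) \int[gamma]_(q in V)
                 (W1 p.1 q.1 - W2 p.2 q.2)%:E |%E]].

Definition cut_distance (R : realType) (W1 W2 : R -> R -> R) : \bar R :=
  ereal_inf [set coupling_cut_norm gamma W1 W2 |
             gamma in [set gamma | lebesgue_coupling gamma]].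

Definition L1_norm (R : realType) (W : R -> R -> R) : R :=
  \int[(@lebesgue_measure R \x @lebesgue_measure R)%E]_(z in
       nneg_reals R `*` nneg_reals R) `|W z.1 z.2|.

Definition stretch (R : realType) (W : R -> R -> R) (x y : R) : R :=
  W (Num.sqrt (L1_norm W) * x) (Num.sqrt (L1_norm W) * y).

Definition stretched_cut_distance (R : realType) (W1 W2 : R -> R -> R) :
    \bar R :=
  cut_distance (stretch W1) (stretch W2).

Definition canonical_graphon (R : realType) (m : nat) (g : rel 'I_m)
    (x y : R) : R :=
  [exists i : 'I_m, exists j : 'I_m,
    [&& g i j, x \in `[i%:R / m%:R, i.+1%:R / m%:R[ &
               y \in `[j%:R / m%:R, j.+1%:R / m%:R[ ]]%:R.

Definition stretched_cut_cvg (R : realType) (g : forall n, rel 'I_n)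
    (W : R -> R -> R) : Prop :=
  stretched_cut_distance (canonical_graphon (g n)) W @[n --> \oo] --> 0%E.

(* Main.v *)
Require Import Defs.
From HB Require Import structures.
From mathcomp Require Import all_boot all_order all_algebra finmap.
From mathcomp Require Import all_classical all_reals all_analysis.
From mathcomp Require Import measurable_realfun lra.
Import Order.TTheory GRing.Theory Num.Theory numFieldNormedType.Exports.
Set Implicit Arguments.
Unset Strict Implicit.
Unset Printing Implicit Defensive.
Local Open Scope classical_set_scope.
Local Open Scope ring_scope.

(** Let [u_i = w_i / sqrt L] and [k(u, v) = u v / (1 + u v)], so that the edge
probabilities are [k(u_i, u_j)]. The theorem combines a probabilistic statement
on the graphs with a deterministic one on the weights.

The graphs: almost surely, for every [eta > 0] and all large [n], the number of
ordered adjacent pairs in [S * T] differs from its mean by at most [eta L],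
simultaneously for all sets of vertices [S] and [T] ([discrepancy_ae_small]).
For one pair [(S, T)] this fails with probability [exp(- C L)] by Chernoff's
bound. There are [4 ^ n] pairs and [L] may be much smaller than [n], so the union
bound is taken over the subsets of the heavy vertices only, those with
[u_i > eps]: there are at most [sqrt L / eps] of them. Since [a = 0], the light
vertices have total weight at most [delta L], hence few edges in the mean; a
single further event, with [S] the light vertices and [T] all vertices, makes
this true of the graph itself. As [L] dominates [log n], the exceptional
probabilities are summable.

The weights: let [v] be the [u_i] in decreasing order, [s] a width equivalent to
[1 / sqrt (c L)], and [f_n(x) = v_i] for [x] in the block [[i s, (i + 1) s[]. Then
[f_n(x) > t] if and only if [x / (s sqrt L)] is below the tail of [rho_n] at [t],
so that vague convergence gives [f_n -> F := tail_inv rho_w (sqrt c x)] off a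
countable set ([sorted_weight_cvg]). Since [a = 0], the functions [f_n] have
uniformly small mass far away, and [k(f_n, f_n) -> k(F, F)] in [L^1]
([sorted_kern_cvg]). With the third hypothesis, [k(F, F)] has integral [1], so
the limit graphon is its own stretched version ([stretch_GRG_graphon]).

The coupling: the stretched canonical graphon is the adjacency matrix spread over
blocks of width [s = 1 / sqrt E], where [E] counts the ordered adjacent pairs;
[E / L -> c] by the discrepancy estimate. Let [T] be the measure-preserving map
that rearranges the blocks by decreasing weight, and let [gamma] be the image of
Lebesgue measure under [x |-> (T x, x)]. Tested against [U] and [V], the
adjacency matrix minus [k(v_i, v_j)] is a bilinear form in the measures of the
traces of [U] and [V] on the blocks, hence is largest when every block is either
taken or left out: it is at most [s ^ 2] times a discrepancy, that is
[eta s ^ 2 L]. What remains is the [L^1] distance of [k(f_n, f_n)] and [k(F, F)]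
([coupling_cut_norm_le]). *)

(** * Sums of independent indicators *)

Lemma finite_bounded_integrable d (T : measurableType d) (R : realType)
    (P : probability T R) (f : T -> R) (M : R) :
  measurable_fun setT f -> (forall t, `|f t| <= M) ->
  P.-integrable setT (EFin \o f).
Proof.
move=> mf fM; apply: measurable_bounded_integrable => //.
  exact: le_lt_trans (probability_le1 P measurableT) (ltry _).
exists M; split; first exact: num_real.
by move=> x Mx t _; rewrite /= (le_trans (fM t))// ltW.
Qed.

(** Independence of events only says that the indicators of a finite family
multiply in expectation. Peeling the affine factors off one at a time, each
splits into a term without the indicator and a term where the indicator joins
the second product; hence the extra list [r]. *)
Lemma expectation_prod_affine d (T : measurableType d) (R : realType)
    (P : probability T R) (I : choiceType) (D : set I) (E : I -> set T)
    (c : I -> R) (s r : seq I) :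
  mutually_independent P D E -> (forall i, measurable (E i)) ->
  uniq (s ++ r) -> (forall i, i \in s ++ r -> D i) ->
  (\int[P]_t ((\prod_(i <- s) (1 + c i * \1_(E i) t)) *
              \prod_(i <- r) \1_(E i) t)%:E =
   ((\prod_(i <- s) (1 + c i * fine (P (E i)))) *
     \prod_(i <- r) fine (P (E i)))%:E)%E.
Proof.
move=> indE mE; elim: s r => [|i s ih] r.
  move=> /= ur Dr; rewrite big_nil mul1r.
  have -> : (fun t => (\prod_(i <- [::]) (1 + c i * \1_(E i) t) *
       \prod_(i <- r) \1_(E i) t)%:E) =
       (fun t => (\1_(\bigcap_(i in [set` [fset x in r]%fset]) E i) t)%:E).
    apply/funext => t; rewrite big_nil mul1r; congr EFin.
    rewrite indicE; have [|] := boolP (t \in _).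
      rewrite inE => tE; rewrite big_seq big1// => i ir.
      by rewrite indicE mem_set//; apply: tE; rewrite /= !inE.
    move=> tE; apply/eqP; rewrite prodf_seq_eq0.
    apply/negPn/negP => /hasPn h; move/negP: tE; apply; rewrite inE => i /=.
    rewrite !inE => ir; have := h i ir; rewrite /= indicE.
    by case: (boolP (t \in E i)) => [/set_mem//|]; rewrite eqxx.
  rewrite integral_indic//; last first.
    exact: fin_bigcap_measurable.
  rewrite setIT; transitivity (\prod_(i <- [fset x in r]%fset) P (E i))%E.
    by apply: indE => i; rewrite /= !inE; exact: Dr.
  rewrite (perm_big r)/=; last first.
    by apply: uniq_perm => // i; rewrite !inE.
  rewrite -prodEFin; apply: eq_bigr => i _.
  by rewrite fineK//; exact: fin_num_measure.
rewrite /= => /andP[nis us] Ds.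
have usr : uniq (s ++ i :: r) by rewrite -cat1s uniq_catCA /= nis.
have Dsr j : j \in s ++ i :: r -> D j.
  move=> jsr; apply: Ds; move: jsr; rewrite !(inE, mem_cat).
  by rewrite orbCA.
have h1 := ih r us (fun j js => Ds j (mem_behead (s := i :: s ++ r) js)).
have h2 := ih (i :: r) usr Dsr.
pose A (u : seq I) t := \prod_(i <- s) (1 + c i * \1_(E i) t) *
  \prod_(i <- u) (\1_(E i) t : R).
have iA u : P.-integrable setT (EFin \o A u).
  apply: (@finite_bounded_integrable _ _ _ _ _
    (\prod_(i <- s) (1 + `|c i|))).
    apply: measurable_funM; apply: measurable_prod => j _;
      last exact: measurable_indic.
    apply: measurable_funD => //; apply: measurable_funM => //.
  move=> t; rewrite normrM -[leRHS]mulr1 ler_pM//.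
    rewrite normr_prod ler_prod// => j _; rewrite normr_ge0/=.
    rewrite (le_trans (ler_normD _ _))// normr1 lerD2l normrM ler_piMr//.
    by rewrite indicE; case: (_ \in _); rewrite ?normr1 ?normr0.
  rewrite normr_prod (@le_trans _ _ (\prod_(i <- u) (1 : R)))//;
    last by rewrite big1_eq.
  apply: ler_prod => j _; rewrite normr_ge0/=.
  by rewrite indicE; case: (_ \in _); rewrite ?normr1 ?normr0.
transitivity (\int[P]_t ((EFin \o A r) t + (c i)%:E * (EFin \o A (i :: r)) t))%E.
  apply: eq_integral => t _; rewrite /= -EFinM -EFinD; congr EFin.
  by rewrite /A !big_cons; lra.
rewrite integralD//; last by apply: integrableZl.
rewrite integralZl// h1 h2 -EFinM -EFinD; congr EFin.
by rewrite !big_cons; lra.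
Qed.

(** From [exp (- t) >= 1 - t]: multiplied by [1 - t], the claim becomes
[1 <= 1 + t ^ 2 (1 - 2 t)]. *)
Lemma expR_le_quadratic (R : realType) (t : R) :
  t <= 2^-1 -> expR t <= 1 + t + 2 * t ^+ 2.
Proof.
move=> t2; have t1 : 0 < 1 - t by lra.
have h := expR_ge1Dx (- t); rewrite expRN in h.
have e0 := expR_gt0 t.
have h1 : expR t * (1 - t) <= 1.
  by have := ler_wpM2l (ltW e0) h; rewrite mulfV ?gt_eqF.
have h2 : 0 <= t ^+ 2 * (1 - 2 * t) by rewrite mulr_ge0 ?sqr_ge0//; lra.
rewrite -(ler_pM2r t1) (le_trans h1)//; rewrite -subr_ge0.
by rewrite (_ : _ - _ = t ^+ 2 * (1 - 2 * t))//; lra.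
Qed.

(** Markov's inequality for the exponential of the sum. For weights [t_i <= 1/2]
each factor [exp (- t p) (1 + (exp t - 1) p)] is at most [exp (2 p t ^ 2)]. The
factor [p] matters: in a sparse graph it makes the bound depend on the expected
number of edges and not on the number of pairs. *)
Lemma independent_chernoff d (T : measurableType d) (R : realType)
    (P : probability T R) (I : choiceType) (D : set I) (E : I -> set T)
    (p t : I -> R) (s : seq I) (x : R) :
  mutually_independent P D E -> (forall i, measurable (E i)) ->
  uniq s -> (forall i, i \in s -> D i) ->
  (forall i, i \in s -> P (E i) = (p i)%:E) ->
  (forall i, t i <= 2^-1) ->
  (P [set w | (x <= \sum_(i <- s) t i * (\1_(E i) w - p i))%R]
    <= (expR (- x + 2 * \sum_(i <- s) p i * t i ^+ 2))%:E)%E.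
Proof.
move=> indE mE us Ds Ep t2.
pose X w := \sum_(i <- s) t i * (\1_(E i) w - p i).
have mX : measurable_fun setT X.
  apply: measurable_sum => i; apply: measurable_funM => //.
  by apply: measurable_funB => //; exact: measurable_indic.
pose Xm := isMeasurableFun.Build _ _ _ _ X mX.
pose X' : {RV P >-> R} := HB.pack X Xm.
have := @chernoff _ _ _ P X' 1 x ltr01.
move/le_trans; apply; rewrite mul1r addrC expRD EFinM.
apply: lee_wpmul2r; first by rewrite lee_fin expR_ge0.
rewrite /mmt_gen_fun unlock.
have -> : (\int[P]_w ((expR \o 1 \o* X') w)%:E)%E =
  ((\prod_(i <- s) expR (- (t i * p i))) * \prod_(i <- s) (1 + (expR (t i) - 1) * p i))%:E.
  have := @expectation_prod_affine _ _ _ _ _ _ _ (fun i => expR (t i) - 1) s [::] indE mE.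
  rewrite cats0 => /(_ us Ds); rewrite !big_nil !mulr1 => h.
  rewrite EFinM (_ : (\prod_(i <- s) (1 + (expR (t i) - 1) * p i)) =
     \prod_(i <- s) (1 + (expR (t i) - 1) * fine (P (E i)))); last first.
    by rewrite big_seq [RHS]big_seq; apply: eq_bigr => i /Ep ->.
  rewrite -h -integralZl//; last first.
    apply: (@finite_bounded_integrable _ _ _ _ _
      (\prod_(i <- s) (1 + `|expR (t i) - 1|))).
      under eq_fun do rewrite big_nil mulr1.
      apply: measurable_prod => j _.
      apply: measurable_funD => //; apply: measurable_funM => //.
    move=> w; rewrite big_nil mulr1.
    rewrite normr_prod ler_prod// => j _; rewrite normr_ge0/=.
    rewrite (le_trans (ler_normD _ _))// normr1 lerD2l normrM ler_piMr//.
    by rewrite indicE; case: (_ \in _); rewrite ?normr1 ?normr0.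
  apply: eq_integral => w _; rewrite -EFinM; congr EFin.
  rewrite /= mulr1 big_nil mulr1 expR_sum -big_split/=.
  apply: eq_bigr => i _; rewrite mulrBr addrC expRD; congr (_ * _).
  rewrite indicE; case: (_ \in _) => /=; rewrite ?(mulr1,mulr0,expR0,addr0)//.
  lra.
rewrite lee_fin -big_split/= mulr_sumr expR_sum.
rewrite big_seq [leRHS]big_seq; apply: ler_prod => i si.
have p0 : 0 <= p i by rewrite -lee_fin -Ep.
have p1 : p i <= 1 by rewrite -lee_fin -Ep// probability_le1.
apply/andP; split.
  rewrite mulr_ge0 ?expR_ge0//.
  have := expR_ge0 (t i); nra.
rewrite (le_trans (y := expR (- (t i * p i)) * expR (p i * (t i + 2 * t i ^+ 2))))//.
  rewrite ler_wpM2l ?expR_ge0// (le_trans _ (expR_ge1Dx _))//.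
  rewrite lerD2l mulrC ler_wpM2l//.
  by have := expR_le_quadratic (t2 i); lra.
by rewrite -expRD ler_expR; lra.
Qed.

(** * Discrepancy of a generalized random graph *)

Lemma in_set_pred (T : Type) (b : pred T) (t : T) :
  (t \in [set x | b x]) = b t.
Proof. by apply/idP/idP; rewrite inE. Qed.

Section discrepancy.
Context (R : realType) (n : nat) (w : nat -> R).
Hypothesis w_ge0 : forall i : nat, (i < n)%N -> 0 <= w i.
Let L := total_weight n w.
Hypothesis L_gt0 : 0 < L.
Local Notation p := (edge_prob n w).

Definition discrepancy (g : rel 'I_n) (S T : {set 'I_n}) : R :=
  \sum_(i in S) \sum_(j in T) ((g i j)%:R - p i j).

Let wP (i : 'I_n) : 0 <= w i. Proof. exact: w_ge0. Qed.

Lemma edge_prob_ge0 (i j : 'I_n) : 0 <= p i j.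
Proof.
rewrite /edge_prob divr_ge0 ?addr_ge0 ?mulr_ge0//; exact: ltW.
Qed.

Lemma edge_prob_le (i j : 'I_n) : p i j <= w i * w j / L.
Proof.
have ww : 0 <= w i * w j by rewrite mulr_ge0.
rewrite /edge_prob ler_wpM2l// lef_pV2 ?posrE ?ltr_wpDr//.
by rewrite lerDl.
Qed.

Lemma edge_probC (i j : nat) : p i j = p j i.
Proof. by rewrite /edge_prob (mulrC (w i)). Qed.

Lemma sum_edge_prob_le (S T : {set 'I_n}) :
  \sum_(i in S) \sum_(j in T) p i j <= \sum_(i in S) w i.
Proof.
apply: ler_sum => i _.
rewrite (@le_trans _ _ (\sum_(j in T) w i * w j / L))//.
  by apply: ler_sum => j _; exact: edge_prob_le.
rewrite -mulr_suml -mulr_sumr -mulrA ler_piMr// ler_pdivrMr// mul1r.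
rewrite /L /total_weight [leRHS](bigID (mem T))/= lerDl.
exact: sumr_ge0.
Qed.

(** The discrepancy subtracts [p i i] for every loop, though loops are absent. Since
[p i i <= w_i / sqrt L], this costs at most [sqrt L], negligible against [L]. *)
Lemma sum_edge_prob_diag (S : {set 'I_n}) :
  0 <= \sum_(i in S) p i i <= Num.sqrt L.
Proof.
apply/andP; split; first by apply: sumr_ge0 => i _; exact: edge_prob_ge0.
have s0 : 0 < Num.sqrt L by rewrite sqrtr_gt0.
have sE : Num.sqrt L ^+ 2 = L by rewrite sqr_sqrtr// ltW.
rewrite (@le_trans _ _ (\sum_(i in S) w i / Num.sqrt L))//.
  apply: ler_sum => i _; rewrite /edge_prob -/L ler_pdivrMr; last first.
    by rewrite ltr_wpDr// mulr_ge0.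
  rewrite mulrAC ler_pdivlMr// -mulrA -subr_ge0 -{1}sE.
  rewrite (_ : _ - _ = w i * ((Num.sqrt L - w i) ^+ 2 + Num.sqrt L * w i)); last lra.
  by rewrite mulr_ge0// addr_ge0 ?sqr_ge0// mulr_ge0// ltW.
rewrite -mulr_suml ler_pdivrMr// -expr2 sE.
rewrite /L /total_weight [leRHS](bigID (mem S))/= lerDl.
exact: sumr_ge0.
Qed.

(** How often the unordered pair [e] is counted in the sum over [S] and [T]. *)
Definition pair_weight (S T : {set 'I_n}) (e : 'I_n * 'I_n) : R :=
  ((e.1 \in S) && (e.2 \in T))%:R + ((e.2 \in S) && (e.1 \in T))%:R.

Lemma pair_weight_bounds S T e : 0 <= pair_weight S T e <= 2.
Proof. rewrite /pair_weight; apply/andP.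
by split; case: (_ && _); case: (_ && _) => /=; lra. Qed.

(** Only the pairs [i < j] are independent, so the sum over ordered pairs is folded
along the symmetry; the diagonal is deterministic. *)
Lemma discrepancyE (g : rel 'I_n) S T : symmetric g -> irreflexive g ->
  discrepancy g S T =
  \sum_(e : 'I_n * 'I_n | (e.1 < e.2)%N)
    pair_weight S T e * ((g e.1 e.2)%:R - p e.1 e.2)
  - \sum_(i in S :&: T) p i i.
Proof.
move=> gC gI; rewrite /discrepancy.
pose b i j : R := (g i j)%:R - p i j.
have bC i j : b i j = b j i by rewrite /b gC edge_probC.
have -> : \sum_(i in S) \sum_(j in T) b i j =
  \sum_(e : 'I_n * 'I_n) ((e.1 \in S) && (e.2 \in T))%:R * b e.1 e.2.
  rewrite pair_big_dep/= big_mkcond/=; apply: eq_bigr => e _.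
  by case: ifP; rewrite ?mul1r ?mul0r.
rewrite (bigID (fun e : 'I_n * 'I_n => (e.1 < e.2)%N))/=.
rewrite [X in _ + X](bigID (fun e : 'I_n * 'I_n => (e.1 == e.2)))/=.
rewrite addrCA addrC; congr (_ + _).
  rewrite [X in _ + X](reindex_inj (h := fun e : 'I_n * 'I_n => (e.2, e.1)))/=; last first.
    by move=> [? ?] [? ?] [-> ->].
  rewrite [X in _ + X](eq_bigl (fun e : 'I_n * 'I_n => (e.1 < e.2)%N)); last first.
    move=> e; rewrite -leqNgt /= ltn_neqAle andbC; congr (_ && _).
    by rewrite eq_sym.
  rewrite -big_split/=; apply: eq_bigr => e _.
  by rewrite /pair_weight mulrDl (bC e.2).
rewrite (eq_bigl (fun e : 'I_n * 'I_n => e.1 == e.2)); last first.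
  by move=> e; case: eqP => [->|]; rewrite ?ltnn ?andbF.
rewrite -(pair_big_dep xpredT (fun i j => i == j)
  (fun i j => ((i \in S) && (j \in T))%:R * b i j))/=.
rewrite [X in - X]big_mkcond -sumrN; apply: eq_bigr => i _.
rewrite (eq_bigl (pred1 i)) => [|j]; last by rewrite /= eq_sym.
rewrite big_pred1_eq inE /b gI.
by case: (_ && _); rewrite ?mul0r ?oppr0// mul1r add0r.
Qed.

(** Reduction of arbitrary vertex sets to subsets of [H]. The vertices outside of
[H] have few edges: their expected number of edges is at most their weight [y],
and the discrepancy between the complement of [H] and all vertices bounds their
actual number. So removing them from [S] and [T] costs little. *)
Lemma discrepancy_extend (g : rel 'I_n) (H : {set 'I_n}) (x y : R) :
  symmetric g ->
  (forall S T : {set 'I_n}, S \subset H -> T \subset H -> `|discrepancy g S T| <= x) ->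
  `|discrepancy g (~: H) [set: 'I_n]%SET| <= x ->
  \sum_(i in ~: H) w i <= y ->
  forall S T, `|discrepancy g S T| <= 3 * x + 4 * y.
Proof.
move=> gC xH xC yC S T.
pose b i j : R := (g i j)%:R - p i j.
pose B := \sum_(i in ~: H) \sum_(j in [set: 'I_n]%SET) `|b i j|.
have BxY : B <= x + 2 * y.
  have h1 : B <= discrepancy g (~: H) [set: 'I_n]%SET +
      2 * \sum_(i in ~: H) \sum_(j in [set: 'I_n]%SET) p i j.
    rewrite mulr_sumr -big_split/=; apply: ler_sum => i _.
    rewrite mulr_sumr -big_split/=; apply: ler_sum => j _.
    rewrite (le_trans (ler_normB _ _))// normr_nat ger0_norm ?edge_prob_ge0//.
    by lra.
  have h2 := sum_edge_prob_le (~: H) [set: 'I_n]%SET.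
  have h3 := le_trans (ler_norm _) xC.
  lra.
(* a pair that is lost has its first or its second vertex outside of [H] *)
have bound : `|discrepancy g S T - discrepancy g (S :&: H) (T :&: H)| <= 2 * B.
  have -> : discrepancy g S T - discrepancy g (S :&: H) (T :&: H) =
      \sum_(i in S) \sum_(j in T) (~~ ((i \in H) && (j \in H)))%:R * b i j.
    apply/eqP; rewrite subr_eq; apply/eqP.
    have -> : discrepancy g (S :&: H) (T :&: H) =
        \sum_(i in S) \sum_(j in T) ((i \in H) && (j \in H))%:R * b i j.
      rewrite /discrepancy big_mkcond [RHS]big_mkcond; apply: eq_bigr => i _.
      rewrite inE; case: (i \in S) => //=; case: (i \in H) => /=; last first.
        by rewrite big1// => j _; rewrite mul0r.
      rewrite big_mkcond [RHS]big_mkcond; apply: eq_bigr => j _.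
      rewrite inE; case: (j \in T) => //=.
      by case: (j \in H); rewrite ?mul0r ?mul1r.
    rewrite -big_split/=; apply: eq_bigr => i _.
    rewrite -big_split/=; apply: eq_bigr => j _.
    by case: (_ && _); rewrite /= ?mul0r ?mul1r ?add0r ?addr0.
  have BE : B = \sum_i \sum_j (i \notin H)%:R * `|b i j|.
    rewrite /B big_mkcond; apply: eq_bigr => i _; rewrite inE.
    case: (i \in H) => /=; first by rewrite big1// => j _; rewrite mul0r.
    by apply: eq_big => j; rewrite ?inE// mul1r.
  have BE' : B = \sum_i \sum_j (j \notin H)%:R * `|b i j|.
    rewrite BE exchange_big/=; apply: eq_bigr => i _; apply: eq_bigr => j _.
    by rewrite /b gC edge_probC.
  rewrite (_ : 2 * B = B + B); last lra.
  rewrite {1}BE BE' -big_split/= (le_trans (ler_norm_sum _ _ _))//.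
  rewrite big_mkcond; apply: ler_sum => i _; rewrite -big_split/=.
  case: (i \in S); last first.
    by apply: sumr_ge0 => j _; rewrite addr_ge0// mulr_ge0.
  rewrite (le_trans (ler_norm_sum _ _ _))//.
  rewrite big_mkcond; apply: ler_sum => j _.
  rewrite -mulrDl; case: (j \in T); last by rewrite mulr_ge0// addr_ge0.
  rewrite normrM normr_nat ler_wpM2r//.
  by case: (i \in H); case: (j \in H) => /=; lra.
have xSH := xH (S :&: H) (T :&: H) (subsetIr _ _) (subsetIr _ _).
have := ler_normD (discrepancy g S T - discrepancy g (S :&: H) (T :&: H))
  (discrepancy g (S :&: H) (T :&: H)).
rewrite subrK; lra.
Qed.

(** Chernoff's bound for the sum over the pairs [i < j], whose coefficients
[pair_weight] are at most [2]; the slack [sqrt L] absorbs the diagonal. The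
multiplier [del / 16] of the coefficients balances the linear term [del L] with
the quadratic one, both signs being treated by [F 1] and [F (- 1)]. *)
Lemma discrepancy_tail d (T0 : measurableType d) (P : probability T0 R)
    (G : T0 -> rel 'I_n) (del : R) (S T : {set 'I_n}) :
  is_GRG P w G -> 0 < del -> del <= 1 ->
  measurable [set t | (del * L + Num.sqrt L <= `|discrepancy (G t) S T|)%R] /\
  (P [set t | (del * L + Num.sqrt L <= `|discrepancy (G t) S T|)%R]
    <= (2 * expR (- (del ^+ 2 * L / 32)))%:E)%E.
Proof.
move=> [gC gI gM gP gD] d0 d1.
pose E (e : 'I_n * 'I_n) := [set t | G t e.1 e.2].
pose s := [seq e : 'I_n * 'I_n <- enum {: 'I_n * 'I_n} | (e.1 < e.2)%N].
pose q (e : 'I_n * 'I_n) : R := p e.1 e.2.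
pose F (eps : R) := [set t | (del ^+ 2 * L / 16 <=
  \sum_(e <- s) (eps * (del / 16) * pair_weight S T e) * (\1_(E e) t - q e))%R].
have mD : measurable [set t | (del * L + Num.sqrt L <= `|discrepancy (G t) S T|)%R].
  rewrite -[X in measurable X]setTI.
  apply: measurable_fun_ler => //.
  apply: measurableT_comp => //.
  rewrite /discrepancy; under eq_fun do rewrite -big_enum/=.
  apply: measurable_sum => i; under eq_fun do rewrite -big_enum/=.
  apply: measurable_sum => j.
  apply: measurable_funB => //.
  rewrite (_ : (fun t => _) = \1_[set t | G t i j]); first exact: measurable_indic.
  by apply/funext => t; rewrite indicE in_set_pred.
have mF eps : measurable (F eps).
  rewrite -[X in measurable X]setTI; apply: measurable_fun_ler => //.
  apply: measurable_sum => e; apply: measurable_funM => //.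
  by apply: measurable_funB => //; apply: measurable_indic; exact: gM.
split=> //.
have PF eps : `|eps| = 1 -> (P (F eps) <= (expR (- (del ^+ 2 * L / 32)))%:E)%E.
  move=> e1; apply: le_trans.
    apply: (@independent_chernoff _ _ _ P _ _ E q
      (fun e => eps * (del / 16) * pair_weight S T e) s _ gD).
    - by move=> e; exact: gM.
    - by apply: filter_uniq; exact: enum_uniq.
    - by move=> e; rewrite mem_filter => /andP[].
    - move=> e; rewrite mem_filter => /andP[e12 _]; apply: gP.
      by apply: contraTneq e12 => ->; rewrite ltnn.
    - move=> e; rewrite (le_trans (ler_norm _))// normrM normrM e1 mul1r.
      have /andP[p0 p2] := pair_weight_bounds S T e.
      rewrite (ger0_norm p0) gtr0_norm; last by lra.
      rewrite (@le_trans _ _ (del / 16 * 2))//; last lra.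
      by rewrite ler_pM2l//; lra.
  rewrite lee_fin ler_expR.
  suff : \sum_(e <- s) q e * (eps * (del / 16) * pair_weight S T e) ^+ 2 <=
     del ^+ 2 / 64 * L by lra.
  rewrite (@le_trans _ _ (\sum_(e <- s) q e * (del ^+ 2 / 64)))//.
    apply: ler_sum => e _; apply: ler_wpM2l; first exact: edge_prob_ge0.
    have /andP[p0 p2] := pair_weight_bounds S T e.
    rewrite -real_normK ?num_real// !normrM e1 mul1r (ger0_norm p0).
    rewrite (gtr0_norm d0) (_ : del ^+ 2 / 64 = (del / 16 * 2) ^+ 2); last lra.
    have d16 : 0 <= del / 16 by lra.
    rewrite gtr0_norm ?invr_gt0// ler_pXn2r// ?nnegrE; first exact: ler_wpM2l.
      exact: mulr_ge0.
    by lra.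
  rewrite -mulr_suml mulrC ler_wpM2l//; first by have := sqr_ge0 del; lra.
  rewrite /s big_filter big_enum_cond/=.
  have h := sum_edge_prob_le [set: 'I_n]%SET [set: 'I_n]%SET.
  rewrite (@le_trans _ _ (\sum_(i in [set: 'I_n]%SET) w i))//; last first.
    by rewrite /L /total_weight le_eqVlt (eq_bigl xpredT) ?eqxx// => i; rewrite inE.
  apply: le_trans h; rewrite pair_big_dep/= [leRHS](eq_bigl xpredT); last first.
    by move=> i; rewrite !inE.
  rewrite [leRHS](bigID (fun e : 'I_n * 'I_n => (e.1 < e.2)%N))/= lerDl.
  by apply: sumr_ge0 => e _; exact: edge_prob_ge0.
have sub : [set t | (del * L + Num.sqrt L <= `|discrepancy (G t) S T|)%R]
   `<=` F 1 `|` F (-1).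
  move=> t /=; rewrite discrepancyE; [|exact: gC|exact: gI].
  set X := (X in `|X - _|).
  have FE eps : (\sum_(e <- s) (eps * (del / 16) * pair_weight S T e) *
      (\1_(E e) t - q e)) = eps * (del / 16) * X.
    rewrite /s big_filter big_enum_cond/= mulr_sumr; apply: eq_bigr => e _.
    rewrite -mulrA; do 2 congr (_ * _); congr (_ - _).
    by rewrite indicE in_set_pred.
  rewrite /F /= !FE.
  have /andP[D0 DL] := sum_edge_prob_diag (S :&: T).
  have := ler_normB X (\sum_(i in S :&: T) p i i).
  rewrite (ger0_norm D0) => h1 h2.
  have h3 : del * L <= `|X| by lra.
  have h4 : del ^+ 2 * L / 16 <= del / 16 * `|X|.
    have := ler_wpM2l (ltW d0) h3; lra.
  move: h4; case: (leP 0 X) => X0.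
    by rewrite (ger0_norm X0) => ?; left; lra.
  by rewrite (ltr0_norm X0) => ?; right; lra.
apply: (@le_trans _ _ (P (F 1 `|` F (-1)))).
  by apply: le_measure => //; rewrite inE//; exact: measurableU.
apply: (le_trans (measureU2 P (mF 1) (mF (-1)))).
rewrite (_ : 2 * _ = expR (- (del ^+ 2 * L / 32)) + expR (- (del ^+ 2 * L / 32)));
  last lra.
by rewrite EFinD; apply: leeD; apply: PF; rewrite ?normrN normr1.
Qed.

End discrepancy.

(** The union bound over the pairs of subsets of [H] and over the one pair that
controls the complement of [H], as required by [discrepancy_extend]. *)
Lemma discrepancy_union_tail (R : realType) (n : nat) (w : nat -> R)
    d (T0 : measurableType d) (P : probability T0 R)
    (G : T0 -> rel 'I_n) (del : R) (H : {set 'I_n}) :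
  (forall i : nat, (i < n)%N -> 0 <= w i) -> 0 < total_weight n w ->
  is_GRG P w G -> 0 < del -> del <= 1 ->
  let L := total_weight n w in
  exists B : set T0, [/\ measurable B,
    (P B <= ((4 ^+ #|H| + 1) * (2 * expR (- (del ^+ 2 * L / 32))))%:E)%E &
    forall t, ~ B t ->
      (forall S T : {set 'I_n}, S \subset H -> T \subset H ->
        `|discrepancy w (G t) S T| <= del * L + Num.sqrt L) /\
      `|discrepancy w (G t) (~: H) [set: 'I_n]%SET| <= del * L + Num.sqrt L].
Proof.
move=> w0 L0 hG d0 d1 L.
pose A (e : {set 'I_n} * {set 'I_n}) :=
  [set t | (del * L + Num.sqrt L <= `|discrepancy w (G t) e.1 e.2|)%R].
have AP e : measurable (A e) /\
    (P (A e) <= (2 * expR (- (del ^+ 2 * L / 32)))%:E)%E.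
  exact: (discrepancy_tail w0 L0 e.1 e.2 hG d0 d1).
have union_bound (F : seq ({set 'I_n} * {set 'I_n})) :
  exists B : set T0, [/\ measurable B,
    (P B <= ((size F)%:R * (2 * expR (- (del ^+ 2 * L / 32))))%:E)%E &
    forall t, ~ B t -> forall e, e \in F -> ~ A e t].
  elim: F => [|e F [B [mB PB HB]]].
    by exists set0; split => //; rewrite measure0 mul0r.
  exists (A e `|` B); split.
  - by apply: measurableU => //; case: (AP e).
  - apply: (le_trans (measureU2 P (AP e).1 mB)) => /=.
    rewrite -natr1 mulrDl mul1r addrC EFinD; apply: leeD => //.
    by case: (AP e).
  - move=> t /not_orP[At Bt] e'; rewrite inE => /orP[/eqP->//|].
    exact: HB.
pose F := (~: H, [set: 'I_n]%SET) :: enum (finset.setX (powerset H) (powerset H)).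
have [B [mB PB HB]] := union_bound F.
exists B; split => //.
  apply: le_trans PB _; rewrite lee_fin ler_wpM2r//.
  rewrite /= -cardE cardsX !card_powerset -natr1 lerD2r.
  by rewrite -expnMn natrX.
move=> t /HB HBt; split.
  move=> S T SH TH; rewrite leNgt; apply/negP => /ltW h.
  apply: (HBt (S, T)) => //.
  by rewrite inE mem_enum inE !inE SH TH orbT.
rewrite leNgt; apply/negP => /ltW h.
by apply: (HBt (~: H, [set: 'I_n]%SET)) => //; rewrite inE eqxx.
Qed.

Lemma sum_inv_mul_succ_le1 (R : realType) (n : nat) :
  \sum_(i < n) ((i.+1 * i.+2)%N%:R^-1 : R) <= 1.
Proof.
suff -> : \sum_(i < n) ((i.+1 * i.+2)%N%:R^-1 : R) = 1 - n.+1%:R^-1.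
  by rewrite lerBlDr lerDl invr_ge0.
elim: n => [|n ih]; first by rewrite big_ord0 invr1 subrr.
rewrite big_ord_recr/= ih natrM invfM.
have : (n.+2%:R^-1 : R) = n.+1%:R^-1 - n.+1%:R^-1 * n.+2%:R^-1.
  apply: (@mulIf _ n.+2%:R) => //; rewrite mulVf// mulrBl mulfVK//.
  rewrite -[X in _ - X]mulr1 -mulrBr (_ : n.+2%:R - 1 = n.+1%:R) ?mulVf//.
  by rewrite -natr1 addrK.
by set x := n.+1%:R^-1; set y := n.+2%:R^-1; lra.
Qed.

(** Borel-Cantelli, with the events only included in measurable sets of summable
probability; [1 / ((n + 1) (n + 2))] telescopes. *)
Lemma borel_cantelli_inv_square d (T : measurableType d) (R : realType)
    (P : probability T R) (N : nat) (Q : nat -> T -> Prop) :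
  (forall n, (N <= n)%N -> exists B : set T, [/\ measurable B,
    (P B <= ((n.+1 * n.+2)%N%:R^-1)%:E)%E & forall t, ~ B t -> Q n t]) ->
  {ae P, forall t, \forall n \near \oo, Q n t}.
Proof.
move=> h.
have /choice[B HB] : forall n, exists B : set T, [/\ measurable B,
    (P B <= ((n.+1 * n.+2)%N%:R^-1)%:E)%E &
    (N <= n)%N -> forall t, ~ B t -> Q n t].
  move=> n; have [/h[B [mB PB QB]]|nN] := leqP N n; first by exists B.
  by exists set0; split => //; rewrite measure0 lee_fin.
exists (lim_sup_set B); split.
- apply: bigcap_measurable => // k _; apply: bigcup_measurable => j _.
  by case: (HB j).
- apply: lim_sup_set_cvg0; first by move=> k; case: (HB k).
  apply: (@le_lt_trans _ _ 1%E); last by rewrite ltry.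
  apply: lime_le; first exact: is_cvg_nneseries.
  apply: nearW => n; rewrite big_mkord.
  apply: (@le_trans _ _ (\sum_(i < n) ((i.+1 * i.+2)%N%:R^-1 : R)%:E)%E).
    by apply: lee_sum => i _; case: (HB i).
  by rewrite sumEFin lee_fin sum_inv_mul_succ_le1.
- move=> t /= nQ m _; apply: contrapT => nB; apply: nQ.
  exists (maxn m N) => // n /=; rewrite geq_max => /andP[mn Nn].
  case: (HB n) => _ _ /(_ Nn t); apply => Bnt.
  by apply: nB; exists n.
Qed.

(** With [H] the vertices of weight above [eps sqrt L], of which there are at most
[sqrt L / eps], the failure probability is at most
[exp (O(sqrt L) - C L) <= exp (- 4 log n)], because [L] tends to infinity and
dominates [log n]. *)
Lemma discrepancy_ae_small (R : realType) (w : nat -> nat -> R)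
    (d : measure_display) (T0 : measurableType d) (P : probability T0 R)
    (G : forall n : nat, T0 -> rel 'I_n) :
  (forall n i : nat, (i < n)%N -> 0 <= w n i) ->
  total_weight n (w n) / ln (n%:R : R) @[n --> \oo] --> +oo ->
  (forall n, is_GRG P (w n) (G n)) ->
  (forall eta : R, 0 < eta -> exists2 eps : R, 0 < eps & \forall n \near \oo,
     \sum_(i < n | w n i <= eps * Num.sqrt (total_weight n (w n))) w n i <=
       eta * total_weight n (w n)) ->
  {ae P, forall t, forall eta : R, 0 < eta -> \forall n \near \oo,
     forall S T : {set 'I_n},
       `|discrepancy (w n) (G n t) S T| <= eta * total_weight n (w n)}.
Proof.
move=> w0 Llog hG low.
suff fixed_eta (eta : R) : 0 < eta -> {ae P, forall t, \forall n \near \oo,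
     forall S T : {set 'I_n},
       `|discrepancy (w n) (G n t) S T| <= eta * total_weight n (w n)}.
  have : {ae P, forall t, forall k : nat, \forall n \near \oo,
     forall S T : {set 'I_n},
       `|discrepancy (w n) (G n t) S T| <= k.+1%:R^-1 * total_weight n (w n)}.
    by apply: ae_foralln => k; exact: fixed_eta.
  apply: filterS => t ht eta eta0.
  have [k keta] : exists k : nat, k.+1%:R^-1 <= eta.
    exists (Num.truncn eta^-1); rewrite -[leRHS]invrK lef_pV2 ?posrE ?invr_gt0//.
    exact/ltW/truncnS_gt.
  have := ht k; apply: filterS => n h S T; apply: (le_trans (h S T)).
  apply: ler_wpM2r => //; apply: sumr_ge0 => i _; exact: w0.
move=> eta0; wlog eta1 : eta eta0 / eta <= 1.
  move=> hw; have m0 : 0 < Num.min eta 1 by rewrite lt_min eta0 ltr01.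
  have := hw _ m0; rewrite ge_min lexx orbT => /(_ isT).
  apply: filterS => t; apply: filterS => n h S T; apply: (le_trans (h S T)).
  apply: ler_wpM2r; first by apply: sumr_ge0 => i _; exact: w0.
  by rewrite ge_min lexx.
pose del := eta / 16.
have d0 : 0 < del by rewrite /del; lra.
have d1 : del <= 1 by rewrite /del; lra.
have [eps eps0 lowP] := low del d0.
have e64 : 0 < del ^+ 2 / 64 by rewrite divr_gt0 ?exprn_gt0.
have logP (M : R) : \forall n \near \oo, M * ln n%:R <= total_weight n (w n).
  move/cvgryPge : Llog => /(_ (Num.max M 0)) hM; near=> n.
  have n2 : (1 < n)%N by near: n; exact: nbhs_infty_gt.
  have ln0 : 0 < ln (n%:R : R) by rewrite ln_gt0// ltr1n.
  have : Num.max M 0 <= total_weight n (w n) / ln n%:R by near: n.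
  rewrite ge_max => /andP[+ _].
  by rewrite ler_pdivlMr.
have Llarge (M : R) : \forall n \near \oo, M <= total_weight n (w n).
  have ln2 : 0 < ln (2 : R) by rewrite ln_gt0// ltr1n.
  near=> n.
  have n2 : (1 < n)%N by near: n; exact: nbhs_infty_gt.
  have : `|M| / ln 2 * ln n%:R <= total_weight n (w n) by near: n; exact: logP.
  apply: le_trans; apply: (le_trans (ler_norm M)).
  rewrite -[leLHS](divfK (lt0r_neq0 ln2)) ler_wpM2l ?divr_ge0 ?(ltW ln2)//.
  by rewrite ler_ln ?posrE ?ltr0n ?(ltnW n2)// ler_nat.
(* [L >= K] makes [sqrt L] at most [del L], and the [sqrt L] terms in the
   exponent at most half of [del ^ 2 L / 32] *)
pose K := Num.max ((del^-1) ^+ 2)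
  (Num.max (((2 * eps^-1 + 2) / (del ^+ 2 / 64)) ^+ 2) 1).
suff [N HN] : exists N, forall n, (N <= n)%N -> [/\
    4 * (del ^+ 2 / 64)^-1 * ln n%:R <= total_weight n (w n),
    K <= total_weight n (w n),
    \sum_(i < n | w n i <= eps * Num.sqrt (total_weight n (w n))) w n i <=
       del * total_weight n (w n) & (2 < n)%N].
  apply: (@borel_cantelli_inv_square _ _ _ _ N) => n /HN.
  set L := total_weight n (w n) => -[lnL KL lowL n2].
  move: KL; rewrite /K !ge_max => /and3P[K1 K2 L1].
  have L0 : 0 < L by rewrite (lt_le_trans ltr01).
  have s0 : 0 < Num.sqrt L by rewrite sqrtr_gt0.
  have sE : Num.sqrt L * Num.sqrt L = L by rewrite -expr2 sqr_sqrtr// ltW.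
  have s1 : 1 <= Num.sqrt L by rewrite -sqrtr1 ler_wsqrtr.
  have sdel : Num.sqrt L <= del * L.
    rewrite -[leLHS]mul1r -{2}sE mulrA ler_wpM2r ?(ltW s0)//.
    rewrite mulrC -ler_pdivrMr// div1r.
    rewrite -[leLHS]ger0_norm ?invr_ge0 ?(ltW d0)// -sqrtr_sqr.
    exact: ler_wsqrtr.
  have seps : (2 * eps^-1 + 2) * Num.sqrt L <= del ^+ 2 / 64 * L.
    rewrite -{2}sE mulrA ler_wpM2r ?(ltW s0)// [leRHS]mulrC -ler_pdivrMr//.
    rewrite (le_trans _ (ler_wsqrtr K2))// sqrtr_sqr ler_norm//.
  pose H := [set i : 'I_n | eps * Num.sqrt L < w n i]%SET.
  have [B [mB PB HB]] := discrepancy_union_tail H (w0 n) L0 (hG n) d0 d1.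
  exists B; split => //.
    apply: (le_trans PB); rewrite lee_fin -/L.
    have HL : #|H|%:R <= Num.sqrt L / eps.
      rewrite ler_pdivlMr// -(ler_pM2r s0) sE -mulrA.
      rewrite mulr_natl -sumr_const /L /total_weight.
      rewrite [leRHS](bigID (mem H))/= -[leLHS]addr0 lerD//.
        by apply: ler_sum => i; rewrite inE => /ltW.
      by apply: sumr_ge0 => i _; exact: w0.
    have e2 : (2 : R) <= expR 1 by have := expR_ge1Dx (1 : R); lra.
    have e4 : (4 : R) <= expR 2.
      rewrite (_ : (2 : R) = 1 + 1)// expRD; nra.
    have p1 : (4 : R) ^+ #|H| + 1 <= 2 * 4 ^+ #|H|.
      have : (1 : R) <= 4 ^+ #|H| by apply: exprn_ege1; lra.
      by lra.
    have p2 : (4 : R) ^+ #|H| <= expR (2 * (Num.sqrt L / eps)).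
      apply: (@le_trans _ _ (expR 2 ^+ #|H|)).
        by apply: lerXn2r => //; rewrite nnegrE ?expR_ge0.
      by rewrite -expRM_natr ler_expR ler_wpM2l.
    apply: (@le_trans _ _ (expR (2 + 2 * (Num.sqrt L / eps) - del ^+ 2 * L / 32))).
      rewrite mulrA [leRHS]expRD ler_wpM2r ?expR_ge0// expRD.
      apply: (@le_trans _ _ (4 * 4 ^+ #|H|)); first by lra.
      by apply: ler_pM; rewrite // exprn_ge0.
    apply: (@le_trans _ _ (expR (- (4 * ln n%:R)))).
      rewrite ler_expR.
      have h1 : 4 * ln n%:R <= del ^+ 2 / 64 * L.
        have := ler_wpM2l (ltW e64) lnL.
        by rewrite mulrA (mulrCA _ 4) mulfV ?mulr1// gt_eqF.
      have h2 : 2 * (Num.sqrt L / eps) = 2 * eps^-1 * Num.sqrt L by lra.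
      move: seps; rewrite h2; lra.
    have n0 : (0 : R) < n%:R by rewrite ltr0n (ltn_trans _ n2).
    rewrite expRN lef_pV2 ?posrE ?expR_gt0 ?ltr0n//.
    rewrite mulrC expRM_natr lnK ?posrE// -natrX ler_nat.
    have n2n : (n.+2 <= n ^ 2)%N.
      have h1 : (n.+2 <= n + n)%N by rewrite -addn2 leq_add2l ltnW.
      by rewrite (leq_trans h1)// addnn -muln2 -mulnn leq_mul2l (ltnW n2) orbT.
    by rewrite (expnD n 2 2) leq_mul// ltnW.
  move=> t /HB[hS hC] S T.
  have := @discrepancy_extend _ _ _ (w0 n) L0 (G n t) H (del * L + Num.sqrt L) (del * L).
  move=> /(_ _ hS hC) h.
  have gC : symmetric (G n t) by case: (hG n) => gC _ _ _ _; exact: gC.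
  apply: (le_trans (h gC _ S T)).
    rewrite (eq_bigl (fun i : 'I_n => w n i <= eps * Num.sqrt L))//.
    by move=> i; rewrite !inE -leNgt.
  have : 16 * del = eta by rewrite /del; lra.
  move=> <-; nra.
have [N _ HN] : \forall n \near \oo, [/\
    4 * (del ^+ 2 / 64)^-1 * ln n%:R <= total_weight n (w n),
    K <= total_weight n (w n),
    \sum_(i < n | w n i <= eps * Num.sqrt (total_weight n (w n))) w n i <=
       del * total_weight n (w n) & (2 < n)%N].
  near=> n; split; near: n.
  - exact: logP.
  - exact: Llarge.
  - exact: lowP.
  - exact: nbhs_infty_gt.
by exists N.
Unshelve. all: by end_near. Qed.

(** * Rescaled weights and tails of their vague limit *)

Definition scaled_weight (R : realType) (n : nat) (w : nat -> R) (i : nat) : R :=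
  w i / Num.sqrt (total_weight n w).

Lemma integral_weight_measure (R : realType) (n : nat) (w : nat -> R)
    (D : set (measurableTypeR R)) (f : R -> R) :
  measurable D -> measurable_fun D f -> (forall x, D x -> 0 <= f x) ->
  (\int[weight_measure n w]_(x in D) (f x)%:E =
   ((Num.sqrt (total_weight n w))^-1 *
     \sum_(i < n) \1_D (scaled_weight n w i) * f (scaled_weight n w i))%:E)%E.
Proof.
move=> mD mf f0.
have mf' : measurable_fun D (EFin \o f) by exact/measurable_EFinP.
have f0' x : D x -> (0 <= (f x)%:E)%E by move=> Dx; rewrite lee_fin f0.
rewrite /weight_measure ge0_integral_mscale// ge0_integral_measure_sum//.
rewrite EFinM; congr (_ * _)%E; rewrite -sumEFin; apply: eq_bigr => i _.
by rewrite integral_dirac.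
Qed.

Lemma total_scaled_weight (R : realType) (n : nat) (w : nat -> R) :
  \sum_(i < n) scaled_weight n w i = Num.sqrt (total_weight n w).
Proof.
rewrite /scaled_weight -mulr_suml.
have [L0|L0] := leP (total_weight n w) 0.
  by rewrite (ler0_sqrtr L0) invr0 mulr0.
apply: (@mulIf _ (Num.sqrt (total_weight n w))); first by rewrite gt_eqF ?sqrtr_gt0.
by rewrite divfK ?gt_eqF ?sqrtr_gt0// -expr2 sqr_sqrtr ?ltW.
Qed.

(** A continuous function supported by [[a, b]] and equal to [1] on
[[a + h, b - h]], to test vague convergence against. *)
Definition trapezoid (R : realType) (a b h x : R) : R :=
  Num.max 0 (Num.min 1 (Num.min ((x - a) / h) ((b - x) / h))).

Section trapezoid.
Context (R : realType) (a b h : R).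
Hypothesis h_gt0 : 0 < h.

Lemma trapezoid_ge0 x : 0 <= trapezoid a b h x.
Proof. by rewrite /trapezoid le_max lexx. Qed.

Lemma trapezoid_le1 x : trapezoid a b h x <= 1.
Proof. by rewrite /trapezoid ge_max ler01 ge_min lexx. Qed.

Lemma trapezoid_eq1 x : a + h <= x -> x <= b - h -> trapezoid a b h x = 1.
Proof.
move=> ax xb; rewrite /trapezoid min_l; first by rewrite max_r.
by rewrite le_min !ler_pdivlMr// !mul1r; apply/andP; split; lra.
Qed.

Lemma trapezoid_neq0 x : trapezoid a b h x != 0 -> a < x < b.
Proof.
apply: contraNT; rewrite negb_and -!leNgt /trapezoid => ab.
rewrite max_l// !ge_min; case/orP: ab => [xa|bx].
  by rewrite (_ : (x - a) / h <= 0) ?orbT// pmulr_lle0 ?invr_gt0// subr_le0.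
by rewrite (_ : (b - x) / h <= 0) ?orbT// pmulr_lle0 ?invr_gt0// subr_le0.
Qed.

Lemma continuous_trapezoid : continuous (trapezoid a b h).
Proof.
move=> x.
pose f1 : R -> R^o := fun y => (y - a) / h.
pose f2 : R -> R^o := fun y => (b - y) / h.
have cf1 : {for x, continuous f1}.
  by apply: cvgMl; apply: cvgB; [exact: cvg_id | exact: cvg_cst].
have cf2 : {for x, continuous f2}.
  by apply: cvgMl; apply: cvgB; [exact: cvg_cst | exact: cvg_id].
have cc (r : R) : {for x, continuous (cst r : R -> R^o)} by exact: cvg_cst.
exact: (continuous_max (cc 0) (continuous_min (cc 1) (continuous_min cf1 cf2))).
Qed.

Lemma closure_trapezoid : closure [set x | trapezoid a b h x != 0] `<=` `[a, b].
Proof.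
have /closure_id -> : closed (`[a, b]%classic : set R) by exact: interval_closed.
by apply: closure_subset => x /= /trapezoid_neq0 /andP[/ltW ? /ltW ?];
  rewrite in_itv/=; apply/andP.
Qed.

End trapezoid.

(** The tail of [weight_measure n w], as a real number. *)
Definition empirical_tail (R : realType) (n : nat) (w : nat -> R) (t : R) : R :=
  (Num.sqrt (total_weight n w))^-1 * \sum_(i < n) (t < scaled_weight n w i)%R%:R.

(** Markov's inequality: [rho_n] has first moment at most [1], the [u_i] having sum
[sqrt L]. *)
Lemma empirical_tail_le (R : realType) (n : nat) (w : nat -> R) (t : R) :
  (forall i : nat, (i < n)%N -> 0 <= w i) -> 0 < t ->
  empirical_tail n w t <= t^-1.
Proof.
move=> w0 t0; set s : R := Num.sqrt (total_weight n w).
have s0 : 0 <= s by exact: sqrtr_ge0.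
rewrite /empirical_tail -/s -[leRHS]div1r ler_pdivlMr// -mulrA mulr_suml.
have [->|sN0] := eqVneq s 0; first by rewrite invr0 mul0r.
have sgt0 : 0 < s by rewrite lt_neqAle eq_sym sN0.
rewrite mulrC ler_pdivrMr// mul1r /s -total_scaled_weight.
apply: ler_sum => i _; case: ltP => [/ltW|_]; rewrite ?mul1r// mul0r.
by rewrite /scaled_weight divr_ge0// w0.
Qed.

Section vague_tail.
Context (R : realType) (w : nat -> nat -> R)
  (rho : {measure set (measurableTypeR R) -> \bar R}).
Hypothesis w_ge0 : forall n i : nat, (i < n)%N -> 0 <= w n i.
Hypothesis rho_cvg : vague_cvg (fun n => weight_measure n (w n)) rho.

Lemma trapezoid_sum_cvg (a b h : R) : 0 < a -> 0 < h ->
  (((Num.sqrt (total_weight n (w n)))^-1 *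
     \sum_(i < n) trapezoid a b h (scaled_weight n (w n) i))%:E
    @[n --> \oo] -->
   \int[rho]_(x in pos_reals R) (trapezoid a b h x)%:E)%E.
Proof.
move=> a0 h0.
have supp : closure [set x | trapezoid a b h x != 0] `<=` pos_reals R.
  apply: subset_trans (closure_trapezoid h0) _ => x /=.
  by rewrite /pos_reals/= !in_itv/= => /andP[ax _]; rewrite andbT (lt_le_trans a0).
have cpt : compact (closure [set x | trapezoid a b h x != 0]).
  apply: (subclosed_compact _ (@segment_compact _ a b)).
    exact: closed_closure.
  exact: closure_trapezoid.
have := rho_cvg (@continuous_trapezoid R a b h) cpt supp.
apply: cvg_trans; apply: near_eq_cvg; apply: nearW => n.
rewrite integral_weight_measure//.
- congr (_ * _)%:E; apply: eq_bigr => i _.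
  have [->|nz] := eqVneq (trapezoid a b h (scaled_weight n (w n) i)) 0.
    by rewrite mulr0.
  rewrite indicE mem_set ?mul1r//; apply: supp.
  exact: subset_closure.
- exact: measurable_itv.
- apply: measurable_funTS; apply: continuous_measurable_fun.
  exact: continuous_trapezoid.
- by move=> x _; exact: trapezoid_ge0.
Qed.

Lemma measurable_trapezoid (a b h : R) (D : set (measurableTypeR R)) : 0 < h ->
  measurable_fun D (EFin \o trapezoid a b h).
Proof.
move=> h0; apply/measurable_EFinP; apply: measurable_funTS.
by apply: continuous_measurable_fun; exact: continuous_trapezoid.
Qed.

(** By inner regularity, already a compact interval inside of [(t, oo)] has measure
above [y]; a trapezoid below the indicator of [(t, oo)] detects it. *)
Lemma eventually_lt_empirical_tail (t y : R) : 0 < t -> (y%:E < tail rho t)%E ->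
  \forall n \near \oo, y < empirical_tail n (w n) t.
Proof.
move=> t0 yt.
pose B (j : nat) : set (measurableTypeR R) := `[t + j.+1%:R^-1, t + j.+1%:R]%classic.
have BU : \bigcup_j B j = `]t, +oo[%classic.
  apply/seteqP; split=> [x [j _]|x] /=; rewrite /B /= !in_itv/=.
    by move=> /andP[jx _]; rewrite andbT (lt_le_trans _ jx)// ltrDl.
  rewrite andbT => tx.
  have xt0 : 0 < x - t by rewrite subr_gt0.
  exists (maxn (Num.truncn (x - t)^-1) (Num.truncn (x - t))) => //=.
  rewrite in_itv/=; apply/andP; split.
    rewrite -lerBrDl -[leRHS]invrK lef_pV2 ?posrE ?invr_gt0//.
    by apply/ltW/(lt_le_trans (truncnS_gt _)); rewrite ler_nat ltnS leq_maxl.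
  rewrite -lerBlDl.
  by apply/ltW/(lt_le_trans (truncnS_gt _)); rewrite ler_nat ltnS leq_maxr.
have [j yj] : exists j, (y%:E < rho (B j))%E.
  apply: contrapT => /forallNP nB; move: yt; apply/negP; rewrite -leNgt.
  have : rho (B j) @[j --> \oo] --> rho (\bigcup_j B j).
    apply: nondecreasing_cvg_mu => //.
    - by move=> j; exact: measurable_itv.
    - by apply: bigcup_measurable => j _; exact: measurable_itv.
    - move=> i j ij; apply/subsetPset => x; rewrite /B /= !in_itv/=.
      move=> /andP[h1 h2]; apply/andP; split.
        by apply: le_trans h1; rewrite lerD2l lef_pV2 ?posrE// ler_nat.
      by apply: (le_trans h2); rewrite lerD2l ler_nat.
  rewrite BU /tail => Bcvg; rewrite -(cvg_lim _ Bcvg)//.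
  apply: lime_le; first by apply/cvg_ex; eexists; exact: Bcvg.
  by apply: nearW => j; rewrite leNgt; apply/negP; exact: nB.
pose h : R := j.+1%:R^-1.
have h0 : 0 < h by rewrite invr_gt0.
have yint : (y%:E < \int[rho]_(x in pos_reals R)
    (trapezoid t (t + j.+1%:R + h) h x)%:E)%E.
  apply: (lt_le_trans yj).
  have mp : measurable (pos_reals R : set (measurableTypeR R)) by exact: measurable_itv.
  have mB : measurable (B j) by exact: measurable_itv.
  have Bp : B j `<=` pos_reals R.
    move=> x; rewrite /B /pos_reals/= !in_itv/= andbT => /andP[h1 _].
    by rewrite (lt_le_trans _ h1)// addr_gt0.
  have -> : rho (B j) = (\int[rho]_(x in B j) (cst 1%E x))%E.
    by rewrite integral_cst// mul1e.
  apply: (@le_trans _ _ (\int[rho]_(x in B j) (trapezoid t (t + j.+1%:R + h) h x)%:E)%E).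
    apply: ge0_le_integral => //.
    - exact: measurable_trapezoid.
    - move=> x; rewrite /B /= in_itv/= => /andP[h1 h2].
      by rewrite trapezoid_eq1// addrK.
  apply: ge0_subset_integral => //.
  - exact: measurable_trapezoid.
  - by move=> x _; rewrite lee_fin trapezoid_ge0.
have := @trapezoid_sum_cvg t (t + j.+1%:R + h) h t0 h0.
move=> /(_ [set z | y%:E < z]%E) /=.
have : nbhs (\int[rho]_(x in pos_reals R) (trapezoid t (t + j.+1%:R + h) h x)%:E)%E
    [set z | (y%:E < z)%E].
  by apply: open_nbhs_nbhs; split => //; exact: open_ereal_gt_ereal.
move=> nb H; have {nb H} := H nb; rewrite nbhs_simpl /=.
apply: filterS => n /=; rewrite lte_fin => yn.
apply: (lt_le_trans yn); rewrite /empirical_tail.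
apply: ler_wpM2l; first by rewrite invr_ge0 sqrtr_ge0.
apply: ler_sum => i _.
have [->|/trapezoid_neq0 - /(_ h0)/andP[-> _]] :=
  eqVneq (trapezoid t (t + j.+1%:R + h) h (scaled_weight n (w n) i)) 0; first by [].
exact: trapezoid_le1.
Qed.

(** The bound of [empirical_tail_le] passes to the vague limit. *)
Lemma tail_le_inv (t : R) : 0 < t -> (tail rho t <= (t^-1)%:E)%E.
Proof.
move=> t0; rewrite leNgt; apply/negP => /(eventually_lt_empirical_tail t0) [N _ HN].
have := HN N (leqnn N); rewrite /= ltNge empirical_tail_le//.
exact: w_ge0.
Qed.

(** A trapezoid dominates the indicator of [(t, M]]. Vague convergence does not see
the mass near infinity, which [empirical_tail_le] bounds by [1 / M]. The gap
between [t0] and [t] is needed since [rho] may have an atom at [t]. *)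
Lemma eventually_empirical_tail_lt (t0 t y : R) : 0 < t0 -> t0 < t ->
  (tail rho t0 < y%:E)%E ->
  \forall n \near \oo, empirical_tail n (w n) t < y.
Proof.
move=> t00 t0t ty.
have t_fin : tail rho t0 \is a fin_num.
  by rewrite ge0_fin_numE// (lt_trans ty)// ltry.
pose r := fine (tail rho t0).
have rE : tail rho t0 = r%:E by rewrite /r fineK.
have ry : r < y by rewrite -lte_fin -rE.
pose M := Num.max t (4 / (y - r)).
have tM : t <= M by rewrite /M le_max lexx.
have M0 : 0 < M by rewrite (lt_le_trans _ tM)// (lt_trans t00).
have MV : M^-1 <= (y - r) / 4.
  rewrite -[leRHS]invrK lef_pV2 ?posrE ?invr_gt0 ?divr_gt0 ?subr_gt0//.
  by rewrite invf_div /M le_max lexx orbT.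
pose h := t - t0; have h0 : 0 < h by rewrite subr_gt0.
pose f := trapezoid t0 (M + h) h.
have fr : (\int[rho]_(x in pos_reals R) (f x)%:E < (r + (y - r) / 2)%:E)%E.
  apply: (@le_lt_trans _ _ r%:E); last by rewrite lte_fin; lra.
  rewrite -rE /tail.
  have mt : measurable (`]t0, +oo[%classic : set (measurableTypeR R)) by exact: measurable_itv.
  have mp : measurable (pos_reals R : set (measurableTypeR R)) by exact: measurable_itv.
  have -> : `]t0, +oo[%classic = `]t0, +oo[%classic `&` pos_reals R.
    apply/esym/setIidPl => x; rewrite /pos_reals/= !in_itv/= !andbT.
    exact: lt_trans.
  rewrite -integral_indic//; apply: ge0_le_integral => //.
  - by move=> x _; rewrite lee_fin trapezoid_ge0.
  - exact: measurable_trapezoid.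
  - by apply/measurable_EFinP; exact: measurable_indic.
  - move=> x _; rewrite lee_fin.
    have [->|/(trapezoid_neq0 h0)/andP[h1 _]] := eqVneq (f x) 0; first by [].
    rewrite indicE mem_set; last by rewrite /= in_itv/= andbT.
    exact: trapezoid_le1.
have := @trapezoid_sum_cvg t0 (M + h) h t00 h0.
move=> /(_ [set z | z < (r + (y - r) / 2)%:E]%E) /=.
have : nbhs (\int[rho]_(x in pos_reals R) (f x)%:E)%E [set z | (z < (r + (y - r) / 2)%:E)%E].
  by apply: open_nbhs_nbhs; split => //; exact: open_ereal_lt_ereal.
move=> nb H; have {nb H} := H nb; rewrite nbhs_simpl /=.
apply: filterS => n /=; rewrite lte_fin => yn.
have h1 : empirical_tail n (w n) t <=
    (Num.sqrt (total_weight n (w n)))^-1 *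
      \sum_(i < n) f (scaled_weight n (w n) i) + empirical_tail n (w n) M.
  rewrite /empirical_tail -mulrDr ler_wpM2l ?invr_ge0 ?sqrtr_ge0//.
  rewrite -big_split/=; apply: ler_sum => i _.
  set u := scaled_weight n (w n) i.
  have f0 : 0 <= f u by exact: trapezoid_ge0.
  have [tu|_] := ltP t u; last by rewrite addr_ge0.
  have [Mu|uM] := ltP M u; first by rewrite /= lerDr.
  by rewrite addr0 /f trapezoid_eq1//; [rewrite /h; lra|rewrite addrK].
have := empirical_tail_le (w_ge0 (n := n)) M0.
lra.
Qed.

End vague_tail.

Section tail_inverse.
Context (R : realType) (rho : {measure set (measurableTypeR R) -> \bar R}).
Hypothesis tail_le : forall t : R, 0 < t -> (tail rho t <= (t^-1)%:E)%E.

Lemma tail_nonincreasing (s t : R) : s <= t -> (tail rho t <= tail rho s)%E.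
Proof.
move=> st; apply: le_measure; rewrite ?inE; [exact: measurable_itv..|].
by apply: subset_itvr; rewrite bnd_simp.
Qed.

Lemma tail_right_continuous (y t : R) :
  (forall s, t < s -> (tail rho s <= y%:E)%E) -> (tail rho t <= y%:E)%E.
Proof.
move=> ty; pose B (j : nat) : set (measurableTypeR R) := `]t + j.+1%:R^-1, +oo[%classic.
have BU : \bigcup_j B j = `]t, +oo[%classic.
  apply/seteqP; split=> [x [j _]|x] /=; rewrite /B /= !in_itv/= !andbT.
    by apply: lt_trans; rewrite ltrDl.
  move=> tx; have xt0 : 0 < x - t by rewrite subr_gt0.
  exists (Num.truncn (x - t)^-1) => //=.
  rewrite in_itv/= andbT -ltrBrDl -[ltRHS]invrK ltf_pV2 ?posrE ?invr_gt0//.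
  exact: truncnS_gt.
have : rho (B j) @[j --> \oo] --> rho (\bigcup_j B j).
  apply: nondecreasing_cvg_mu => //.
  - by move=> j; exact: measurable_itv.
  - by apply: bigcup_measurable => j _; exact: measurable_itv.
  - move=> i j ij; apply/subsetPset => x; rewrite /B /= !in_itv/= !andbT.
    by apply: le_lt_trans; rewrite lerD2l lef_pV2 ?posrE// ler_nat.
rewrite BU /tail => Bcvg; rewrite -(cvg_lim _ Bcvg)//.
apply: lime_le; first by apply/cvg_ex; eexists; exact: Bcvg.
by apply: nearW => j; apply: ty; rewrite ltrDl.
Qed.

(** The tail is right-continuous, so the infimum defining its inverse is attained
and the two are adjoint. *)
Lemma tail_inv_le (y t : R) : 0 < y -> 0 <= t ->
  (tail_inv rho y <= t) = (tail rho t <= y%:E)%E.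
Proof.
move=> y0 t0; rewrite /tail_inv y0.
set A := [set x : R | 0 <= x /\ (tail rho x <= y%:E)%E].
have A0 : has_inf A.
  split; last by exists 0 => x [].
  exists y^-1; split; first by rewrite invr_ge0 ltW.
  by rewrite (le_trans (tail_le _)) ?invr_gt0// invrK.
apply/idP/idP => [infA|ty]; last first.
  by apply: ge_inf => //; case: A0.
apply: tail_right_continuous => s ts.
have [x [x0 xy] xs] : exists2 x, A x & x < s.
  by apply: inf_lt; [case: A0|exact: le_lt_trans ts].
by apply: le_trans xy; apply: tail_nonincreasing; exact: ltW.
Qed.

Lemma tail_inv_ge0 (y : R) : 0 <= tail_inv rho y.
Proof.
rewrite /tail_inv; case: ltP => // y0.
have [->|/set0P A0] := eqVneq [set x : R | 0 <= x /\ (tail rho x <= y%:E)%E] set0.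
  by rewrite inf0.
by apply: lb_le_inf => // x [].
Qed.

Lemma tail_inv_nonincreasing (x y : R) : 0 < x -> x <= y ->
  tail_inv rho y <= tail_inv rho x.
Proof.
move=> x0 xy; rewrite tail_inv_le ?tail_inv_ge0// ?(lt_le_trans x0 xy)//.
apply: (@le_trans _ _ x%:E); last by rewrite lee_fin.
by rewrite -tail_inv_le// tail_inv_ge0.
Qed.

(** The inverse is nonincreasing on the positive reals only, jumping from its
supremum, possibly infinite, down to [0] at the origin. Hence the detour by
[exp (- tail_inv)], extended by [0], which is nondecreasing on the whole line. *)
Lemma measurable_tail_inv : measurable_fun setT (tail_inv rho).
Proof.
pose h (y : R) : R := if 0 < y then expR (- tail_inv rho y) else 0.
have mh : measurable_fun setT h.
  apply: nondecreasing_measurable => // x y xy; rewrite /h.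
  case: ltP => x0; last by case: ltP => // _; rewrite expR_ge0.
  by rewrite (lt_le_trans x0 xy) ler_expR lerN2 tail_inv_nonincreasing.
have -> : tail_inv rho = fun y => - ln (h y).
  apply/funext => y; rewrite /h; case: ifPn => y0; first by rewrite expRK opprK.
  by rewrite ln0// oppr0 /tail_inv (negbTE y0).
by apply: measurableT_comp => //; apply: measurableT_comp.
Qed.

End tail_inverse.

(** * The connection kernel, iterated integrals and blocks *)

Definition saturation (R : realType) (t : R) : R := t / (1 + t).

(** The edge probability of two vertices, as a function of their rescaled
weights. *)
Definition kern (R : realType) (u v : R) : R := saturation (u * v).

Section kern.
Context (R : realType).
Implicit Types t u v : R.

Lemma saturation_ge0 t : 0 <= t -> 0 <= saturation t.
Proof. by move=> t0; rewrite /saturation divr_ge0// addr_ge0. Qed.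

Lemma saturation_le t : 0 <= t -> saturation t <= t.
Proof.
move=> t0; rewrite /saturation ler_pdivrMr ?ltr_wpDr//.
by rewrite mulrDr mulr1 lerDl mulr_ge0.
Qed.

Lemma saturation_le1 t : 0 <= t -> saturation t <= 1.
Proof.
by move=> t0; rewrite /saturation ler_pdivrMr ?ltr_wpDr// mul1r lerDr.
Qed.

Lemma measurable_saturation d (T : measurableType d) (f : T -> R) :
  (forall x, 0 <= f x) -> measurable_fun setT f ->
  measurable_fun setT (fun x => saturation (f x)).
Proof.
move=> f0 mf; pose h t : R := if 0 <= t then saturation t else 0.
have mh : measurable_fun setT h.
  apply: nondecreasing_measurable => // x y xy; rewrite /h.
  case: (leP 0 x) => x0; last by case: (leP 0 y) => // y0; rewrite saturation_ge0.
  have y0 := le_trans x0 xy.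
  rewrite y0 /saturation ler_pdivrMr ?ltr_wpDr// mulrAC ler_pdivlMr ?ltr_wpDr//.
  nra.
rewrite (_ : (fun x => _) = h \o f); first exact: measurableT_comp.
by apply/funext => x; rewrite /= /h f0.
Qed.

Lemma cvg_saturation (u : nat -> R) (l : R) : 0 <= l ->
  u n @[n --> \oo] --> l -> saturation (u n) @[n --> \oo] --> saturation l.
Proof.
move=> l0 ul; apply: cvgM => //; apply: cvgV.
  by rewrite gt_eqF// ltr_wpDr.
by apply: cvgD => //; exact: cvg_cst.
Qed.

Lemma kern_ge0 u v : 0 <= u -> 0 <= v -> 0 <= kern u v.
Proof. by move=> u0 v0; rewrite saturation_ge0// mulr_ge0. Qed.

Lemma kern_leM u v : 0 <= u -> 0 <= v -> kern u v <= u * v.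
Proof. by move=> u0 v0; rewrite saturation_le// mulr_ge0. Qed.

Lemma kern_le1 u v : 0 <= u -> 0 <= v -> kern u v <= 1.
Proof. by move=> u0 v0; rewrite saturation_le1// mulr_ge0. Qed.

Lemma kern_dist_le1 u v u' v' : 0 <= u -> 0 <= v -> 0 <= u' -> 0 <= v' ->
  `|kern u v - kern u' v'| <= 1.
Proof.
move=> u0 v0 u'0 v'0; rewrite ler_norml.
have := kern_ge0 u0 v0; have := kern_le1 u0 v0.
have := kern_ge0 u'0 v'0; have := kern_le1 u'0 v'0.
by move=> *; apply/andP; split; lra.
Qed.

Lemma kern_dist_leM u v u' v' : 0 <= u -> 0 <= v -> 0 <= u' -> 0 <= v' ->
  `|kern u v - kern u' v'| <= u * v + u' * v'.
Proof.
move=> u0 v0 u'0 v'0; rewrite (le_trans (ler_normB _ _))// lerD//.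
  by rewrite ger0_norm ?kern_ge0// kern_leM.
by rewrite ger0_norm ?kern_ge0// kern_leM.
Qed.

End kern.

Section iterated_integral.
Context (R : realType).
Local Notation mu := (@lebesgue_measure R).
Local Notation RR := (measurableTypeR R).

Lemma measurable_inner_integral d (Y : measurableType d) (B : set RR)
    (h : Y * RR -> \bar R) :
  measurable B -> measurable_fun setT h -> (forall z, (0 <= h z)%E) ->
  measurable_fun setT (fun x : Y => \int[mu]_(y in B) h (x, y))%E.
Proof.
move=> mB mh h0.
pose g := h \_ (setT `*` B).
have mg : measurable_fun setT g.
  apply/(measurable_restrictT _ _).1; first exact: measurableX.
  exact: measurable_funTS.
have g0 z : (0 <= g z)%E by apply: erestrict_ge0 => ? _.
rewrite (_ : (fun x => _) = fubini_F mu g).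
  exact: measurable_fun_fubini_tonelli_F.
apply/funext => x; rewrite /fubini_F [LHS]integral_mkcond.
apply: eq_integral => y _; rewrite /g /patch.
by congr (if _ then _ else _); rewrite in_setX in_setT.
Qed.

(** Iterated integrals make sense for arbitrary functions, so additivity and
monotonicity have to be applied once for each of the two integrals. *)
Lemma iterated_integral_le_add (A B : set RR) (g h e : RR * RR -> \bar R) :
  measurable A -> measurable B ->
  measurable_fun setT g -> measurable_fun setT h -> measurable_fun setT e ->
  (forall z, 0 <= g z)%E -> (forall z, 0 <= h z)%E -> (forall z, 0 <= e z)%E ->
  (forall z, g z <= h z + e z)%E ->
  (\int[mu]_(x in A) \int[mu]_(y in B) g (x, y) <=
   \int[mu]_(x in A) \int[mu]_(y in B) h (x, y) +
   \int[mu]_(x in A) \int[mu]_(y in B) e (x, y))%E.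
Proof.
move=> mA mB mg mh me g0 h0 e0 ghe.
have mig := measurable_inner_integral mB mg g0.
have mih := measurable_inner_integral mB mh h0.
have mie := measurable_inner_integral mB me e0.
have mslice (k : RR * RR -> \bar R) x : measurable_fun setT k ->
    measurable_fun B (fun y => k (x, y)).
  by move=> mk; apply: measurable_funTS; exact: measurableT_comp mk (measurable_pair1 x).
rewrite -ge0_integralD//; last 4 first.
- by move=> x _; exact: integral_ge0.
- exact: measurable_funTS.
- by move=> x _; exact: integral_ge0.
- exact: measurable_funTS.
apply: ge0_le_integral => //.
- by move=> x _; exact: integral_ge0.
- exact: measurable_funTS.
- by apply: emeasurable_funD; exact: measurable_funTS.
move=> x _; rewrite -ge0_integralD//; [|exact: mslice|exact: mslice].
apply: ge0_le_integral => //; [exact: mslice|].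
by apply: emeasurable_funD; exact: mslice.
Qed.

Lemma measurable_funX_fst (f : R -> R) : measurable_fun setT f ->
  measurable_fun setT (fun z : RR * RR => f z.1).
Proof. by move=> mf; exact: measurableT_comp mf measurable_fst. Qed.

Lemma measurable_funX_snd (f : R -> R) : measurable_fun setT f ->
  measurable_fun setT (fun z : RR * RR => f z.2).
Proof. by move=> mf; exact: measurableT_comp mf measurable_snd. Qed.

Lemma measurable_kern_fun (f : R -> R) : (forall x, 0 <= f x) ->
  measurable_fun setT f ->
  measurable_fun setT (fun z : RR * RR => kern (f z.1) (f z.2)).
Proof.
move=> f0 mf; apply: measurable_saturation; first by move=> z; rewrite mulr_ge0.
by apply: measurable_funM; [exact: measurable_funX_fst|exact: measurable_funX_snd].
Qed.

End iterated_integral.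

Section blocks.
Context (R : realType).
Local Notation mu := (@lebesgue_measure R).

(** The index [i] of the interval [[i s, (i + 1) s[] that contains [x]. A vertex of
the graph becomes such an interval. *)
Definition block (s x : R) : nat := Num.truncn (x / s).

Lemma blockE (s x : R) (i : nat) : 0 < s -> 0 <= x ->
  (block s x == i) = (i%:R * s <= x < i.+1%:R * s).
Proof.
move=> s0 x0; rewrite /block truncn_eq ?divr_ge0 ?(ltW s0)//.
by rewrite ler_pdivlMr// ltr_pdivrMr.
Qed.

Lemma block_lt (s x : R) (i : nat) : 0 < s -> 0 <= x ->
  (block s x < i)%N = (x < i%:R * s).
Proof.
move=> s0 x0; rewrite /block truncn_lt_nat ?divr_ge0 ?(ltW s0)//.
by rewrite ltr_pdivrMr.
Qed.

(** A function of the block index takes countably many values, each on an interval. *)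
Lemma measurable_block (s : R) (h : nat -> R) : 0 < s ->
  measurable_fun setT (fun x : measurableTypeR R => h (block s x)).
Proof.
move=> s0.
have mb : measurable_fun setT (fun x : measurableTypeR R => ((block s x)%:R : R)).
  apply: nondecreasing_measurable => // x y xy; rewrite ler_nat.
  by apply: le_truncn; rewrite ler_wpM2r// invr_ge0 ltW.
move=> _ Y mY; rewrite setTI.
rewrite (_ : _ @^-1` Y = \bigcup_(k in [set k | Y (h k)])
    ((fun x : measurableTypeR R => ((block s x)%:R : R)) @^-1` [set k%:R])).
  apply: bigcup_measurable => k _.
  by rewrite -[X in measurable X]setTI; exact: mb.
apply/seteqP; split=> [x /= Yx|x [k /= Yk] /eqP]; first by exists (block s x).
by rewrite eqr_nat => /eqP ->.
Qed.

Lemma lebesgue_block (s : R) (i : nat) : 0 < s ->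
  mu (`[i%:R * s, i.+1%:R * s[%classic) = s%:E.
Proof.
move=> s0; rewrite lebesgue_measure_itv/= lte_fin ltr_pM2r// ltr_nat ltnSn.
by rewrite -EFinD -mulrBl -natrB ?subSnn ?mul1r.
Qed.

Definition block_itv (s : R) (i : nat) : set (measurableTypeR R) :=
  `[i%:R * s, i.+1%:R * s[%classic.

Lemma block_itvP s i x : 0 < s -> block_itv s i x <-> 0 <= x /\ block s x = i.
Proof.
move=> s_gt0; rewrite /block_itv/= in_itv/=; split.
  move=> xi; have x0 : 0 <= x.
    by case/andP: xi => + _; apply: le_trans; rewrite mulr_ge0// ltW.
  by split => //; apply/eqP; rewrite blockE.
by move=> [x0 <-]; rewrite -blockE.
Qed.

Lemma measurable_block_itv s i : measurable (block_itv s i).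
Proof. exact: measurable_itv. Qed.

Lemma integral_block_on (A : set (measurableTypeR R)) (s : R) (m : nat)
    (h : nat -> R) : measurable A -> A `<=` nneg_reals R -> 0 < s ->
  (forall i, 0 <= h i) -> (forall i, (m <= i)%N -> h i = 0) ->
  (\int[mu]_(x in A) (h (block s x))%:E =
    \sum_(i < m) (h i)%:E * mu (A `&` block_itv s i))%E.
Proof.
move=> mA AD s0 h0 hm.
have mJ i : measurable_fun A (fun x => (\1_(block_itv s i) x)%:E : \bar R).
  apply/measurable_EFinP; apply: measurable_indic; exact: measurable_block_itv.
transitivity (\int[mu]_(x in A) \sum_(i < m)
    ((h i)%:E * (\1_(block_itv s i) x)%:E))%E.
  apply: eq_integral => x; rewrite inE => /AD.
  rewrite /nneg_reals/= in_itv/= andbT => x0.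
  under eq_bigr do rewrite -EFinM.
  rewrite sumEFin; congr EFin.
  have E i : \1_(block_itv s i) x = (block s x == i)%:R :> R.
    rewrite indicE; congr (nat_of_bool _)%:R.
    by apply/idP/eqP; rewrite inE block_itvP// => -[].
  have [bm|mb] := ltnP (block s x) m.
    rewrite (bigD1 (Ordinal bm))//= E eqxx mulr1 big1 ?addr0// => i ib.
    rewrite E (_ : _ == _ = false) ?mulr0//.
    by apply: contraNF ib => /eqP bi; apply/eqP/val_inj.
  rewrite hm// big1// => i _; rewrite E (_ : _ == _ = false) ?mulr0//.
  by apply: contraTF mb => /eqP ->; rewrite -ltnNge.
rewrite ge0_integral_sum//; last 2 first.
- by move=> i; exact: measurable_funeM.
- by move=> i x _; rewrite mule_ge0// lee_fin// h0.
apply: eq_bigr => i _; rewrite ge0_integralZl_EFin//.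
congr (_ * _)%E; rewrite integral_indic; first by rewrite setIC.
- exact: mA.
- exact: measurable_block_itv.
Qed.

Lemma integral_block (s : R) (m : nat) (h : nat -> R) : 0 < s ->
  (forall i, 0 <= h i) -> (forall i, (m <= i)%N -> h i = 0) ->
  (\int[mu]_(x in nneg_reals R) (h (block s x))%:E =
    (s * \sum_(i < m) h i)%:E)%E.
Proof.
move=> s0 h0 hm; rewrite (integral_block_on (m := m))//; last exact: measurable_itv.
rewrite mulr_sumr -sumEFin; apply: eq_bigr => i _.
rewrite (_ : _ `&` _ = block_itv s i); last first.
  by apply: setIidr => x /(block_itvP _ _ s0)[x0 _]; rewrite /nneg_reals/= in_itv/= x0.
transitivity ((h i)%:E * s%:E)%E; last by rewrite -EFinM mulrC.
by congr (_ * _)%E; exact: lebesgue_block.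
Qed.

End blocks.

(** * Convergence of kernels in L1 *)

Section limits_off_countable.
Context (R : realType).
Local Notation mu := (@lebesgue_measure R).
Local Notation RR := (measurableTypeR R).

Lemma ae_off_countable (N : set R) (Q : R -> Prop) :
  countable N -> (forall x, ~ N x -> Q x) -> {ae mu, forall x, Q x}.
Proof.
move=> cN NQ; exists N; split.
- exact: countable_measurable.
- exact: countable_lebesgue_measure0.
- by move=> x /= nQ; apply: contrapT => /NQ.
Qed.

Lemma limn_einf_le (u : (\bar R)^nat) (C : \bar R) :
  (\forall n \near \oo, u n <= C)%E -> (limn_einf u <= C)%E.
Proof.
move=> [N _ HN]; rewrite limn_einf_lim.
apply: lime_le; first exact: is_cvg_einfs.
apply: nearW => n; apply: (@le_trans _ _ (u (maxn n N))).
  by apply: ereal_inf_lbound; exists (maxn n N) => //=; rewrite leq_maxl.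
by apply: HN; rewrite /= leq_maxr.
Qed.

(** Fatou's lemma; countable exceptional sets are negligible. *)
Lemma fatou_bound (A : set RR) (N : set R) (g_ : nat -> R -> R) (g : R -> R)
    (C : R) : measurable A -> countable N ->
  (forall n, measurable_fun setT (g_ n)) -> (forall n x, 0 <= g_ n x) ->
  measurable_fun setT g -> (forall x, 0 <= g x) ->
  (forall x, A x -> ~ N x -> g_ n x @[n --> \oo] --> g x) ->
  (\forall n \near \oo, \int[mu]_(x in A) (g_ n x)%:E <= C%:E)%E ->
  (\int[mu]_(x in A) (g x)%:E <= C%:E)%E.
Proof.
move=> mA cN mg_ g_0 mg g0 g_g gC.
have mN : measurable (N : set RR) by exact: countable_measurable.
have N0 : mu N = 0%E by exact: countable_lebesgue_measure0.
have mAN : measurable (A `\` N) by exact: measurableD.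
rewrite (@ge0_negligible_integral _ _ _ mu _ N)//; last 2 first.
- by apply: measurable_funTS; exact/measurable_EFinP.
- by move=> x _; rewrite lee_fin.
rewrite (_ : \int[mu]_(x in A `\` N) (g x)%:E =
    \int[mu]_(x in A `\` N) limn_einf (fun n => (g_ n x)%:E))%E; last first.
  apply: eq_integral => x; rewrite inE => -[Ax Nx]; apply/esym.
  have gx : (g_ n x)%:E @[n --> \oo] --> (g x)%:E.
    by apply: cvg_EFin; [exact: nearW|exact: g_g].
  rewrite is_cvg_limn_einfE; last by apply/cvg_ex; eexists; exact: gx.
  exact: cvg_lim.
apply: (@le_trans _ _ (limn_einf (fun n => \int[mu]_(x in A `\` N) (g_ n x)%:E))%E).
  apply: fatou => //.
  - by move=> n; apply/measurable_EFinP; exact: measurable_funTS (mg_ n).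
  - by move=> n x _; rewrite lee_fin.
apply: limn_einf_le; apply: filterS gC => n; apply: le_trans.
apply: ge0_subset_integral => //.
- by apply/measurable_EFinP; exact: measurable_funTS (mg_ n).
- by move=> x _; rewrite lee_fin.
Qed.

(** The integrand of the [L^1] distance between the kernels of two weight
functions. *)
Definition kern_dist (f g : R -> R) (z : RR * RR) : R :=
  `|kern (f z.1) (f z.2) - kern (g z.1) (g z.2)|.

Lemma kern_dist_ge0 f g z : 0 <= kern_dist f g z.
Proof. exact: normr_ge0. Qed.

Lemma measurable_kern_dist (f g : R -> R) :
  (forall x, 0 <= f x) -> (forall x, 0 <= g x) ->
  measurable_fun setT f -> measurable_fun setT g ->
  measurable_fun setT (EFin \o kern_dist f g).
Proof.
move=> f0 g0 mf mg; apply/measurable_EFinP; apply: measurableT_comp => //.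
by apply: measurable_funB; exact: measurable_kern_fun.
Qed.

(** On a bounded square the kernels are dominated by the constant [1]. Dominated
convergence is applied to the inner integral for every [x] outside of [N], and
then to the outer one. *)
Lemma kern_dist_box_cvg0 (N : set R) (f_ : nat -> R -> R) (F : R -> R) (K : R) :
  0 < K -> countable N ->
  (forall n, measurable_fun setT (f_ n)) -> (forall n x, 0 <= f_ n x) ->
  measurable_fun setT F -> (forall x, 0 <= F x) ->
  (forall x, 0 <= x -> ~ N x -> f_ n x @[n --> \oo] --> F x) ->
  (\int[mu]_(x in `[0%R, K]) \int[mu]_(y in `[0%R, K])
    (kern_dist (f_ n) F (x, y))%:E @[n --> \oo] --> 0)%E.
Proof.
move=> K0 cN mf_ f_0 mF F0 f_F.
pose B : set RR := `[0%R, K]%classic.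
have mB : measurable B by exact: measurable_itv.
have muB : (mu : {measure set RR -> \bar R}) B = K%:E.
  by have := lebesgue_measure_itv `[0%R, K]; rewrite /= lte_fin K0 -EFinD subr0 => ->.
have int_cst (c : R) : 0 <= c -> mu.-integrable B (cst c%:E).
  move=> c0; apply/integrableP; split => //.
  rewrite (eq_integral (cst c%:E)) => [|x _]; last by rewrite gee0_abs.
  by rewrite integral_cst// muB -EFinM ltry.
have mD n := measurable_kern_dist (f_0 n) F0 (mf_ n) mF.
pose phi n x := (\int[mu]_(y in B) (kern_dist (f_ n) F (x, y))%:E)%E.
have mphi n : measurable_fun setT (phi n).
  apply: (measurable_inner_integral mB (mD n)) => z.
  by rewrite lee_fin kern_dist_ge0.
have mDx n x : measurable_fun setT (fun y : RR => (kern_dist (f_ n) F (x, y))%:E).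
  exact: measurableT_comp (mD n) (measurable_pair1 x).
have D1 n z : kern_dist (f_ n) F z <= 1 by exact: kern_dist_le1.
have phi0 n x : (0 <= phi n x)%E.
  by apply: integral_ge0 => y _; rewrite lee_fin kern_dist_ge0.
have phiK n x : (phi n x <= K%:E)%E.
  rewrite -muB -[leRHS]mul1e -(integral_cst mu mB 1%E).
  apply: ge0_le_integral => //.
  - by move=> y _; rewrite lee_fin kern_dist_ge0.
  - exact: measurable_funTS.
  - by move=> y _; rewrite lee_fin.
have D_cvg x y : 0 <= x -> 0 <= y -> ~ N x -> ~ N y ->
    kern_dist (f_ n) F (x, y) @[n --> \oo] --> (0 : R).
  move=> x0 y0 Nx Ny.
  rewrite -(@normr0 _ R) -(subrr (kern (F x) (F y))).
  apply: cvg_norm; apply: cvgB; last exact: cvg_cst.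
  apply: cvg_saturation; first by rewrite mulr_ge0.
  by apply: cvgM; exact: f_F.
have phi_cvg x : B x -> ~ N x -> (phi n x @[n --> \oo] --> 0)%E.
  move=> Bx Nx.
  have x0 : 0 <= x by move: Bx; rewrite /B/= in_itv/= => /andP[].
  have := @dominated_convergence _ _ _ mu B mB
    (fun n y => (kern_dist (f_ n) F (x, y))%:E) (cst 0%E) (cst 1%E).
  move=> /(_ (fun n => measurable_funTS (mDx n x)) (measurable_cst _)).
  case=> [||//|_ _].
  - apply: (@ae_off_countable N) => // y Ny By.
    apply: cvg_EFin; first exact: nearW.
    apply: D_cvg => //.
    by move: By; rewrite /B/= in_itv/= => /andP[].
  - exact: int_cst.
  - by apply: aeW => y n By; rewrite gee0_abs lee_fin ?kern_dist_ge0.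
  - by rewrite integral0.
have := @dominated_convergence _ _ _ mu B mB phi (cst 0%E) (cst K%:E).
move=> /(_ (fun n => measurable_funTS (mphi n)) (measurable_cst _)).
case=> [||//|_ _].
- by apply: (@ae_off_countable N) => // x Nx Bx; exact: phi_cvg.
- by apply: int_cst; exact: ltW.
- by apply: aeW => x n Bx; rewrite gee0_abs.
- by rewrite integral0.
Qed.

End limits_off_countable.

Lemma cvge0_le (R : realType) (u : (\bar R)^nat) : (forall n, 0 <= u n)%E ->
  (forall e : R, 0 < e -> \forall n \near \oo, (u n <= e%:E)%E) ->
  (u n @[n --> \oo] --> 0)%E.
Proof.
move=> u0 ue; apply: limn_esup_le_cvg => //.
apply/lee_addgt0Pr => e e0; rewrite add0e.
have [M _ HM] := ue e e0.
apply: (@le_trans _ _ (ereal_sup (u @` [set n | (M <= n)%N]))).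
  by apply: ereal_inf_lbound; exists [set n | (M <= n)%N] => //; exists M.
by apply: ge_ereal_sup => _ [n Mn <-]; exact: HM.
Qed.

Lemma cvge_lt_near (R : realType) (u : (\bar R)^nat) (l a : \bar R) :
  (u n @[n --> \oo] --> l)%E -> (l < a)%E -> \forall n \near \oo, (u n < a)%E.
Proof.
move=> ul la; have := ul [set z | (z < a)%E].
by apply; apply: open_nbhs_nbhs; split => //; exact: open_ereal_lt_ereal.
Qed.

Section kern_L1.
Context (R : realType).
Local Notation mu := (@lebesgue_measure R).
Local Notation RR := (measurableTypeR R).

(** By [k(u, v) <= u v], the integral factorizes. *)
Lemma kern_dist_rect_le (f g : R -> R) (A1 A2 : set RR) (c1 c2 : R) :
  measurable A1 -> measurable A2 ->
  (forall x, 0 <= f x) -> (forall x, 0 <= g x) ->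
  measurable_fun setT f -> measurable_fun setT g -> 0 <= c2 ->
  (\int[mu]_(x in A1) (f x)%:E <= c1%:E)%E ->
  (\int[mu]_(x in A1) (g x)%:E <= c1%:E)%E ->
  (\int[mu]_(x in A2) (f x)%:E <= c2%:E)%E ->
  (\int[mu]_(x in A2) (g x)%:E <= c2%:E)%E ->
  (\int[mu]_(x in A1) \int[mu]_(y in A2) (kern_dist f g (x, y))%:E
    <= (2 * c1 * c2)%:E)%E.
Proof.
move=> mA1 mA2 f0 g0 mf mg c20 f1 g1 f2 g2.
have mD := measurable_kern_dist f0 g0 mf mg.
have mfE (A : set RR) : measurable A -> measurable_fun A (EFin \o f).
  by move=> mA; apply/measurable_EFinP; exact: measurable_funTS mf.
have mgE (A : set RR) : measurable A -> measurable_fun A (EFin \o g).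
  by move=> mA; apply/measurable_EFinP; exact: measurable_funTS mg.
have Zl (h : R -> R) (k : R) : 0 <= k -> (forall x, 0 <= h x) ->
    measurable_fun setT h -> (\int[mu]_(y in A2) (k%:E * (h y)%:E) =
      k%:E * \int[mu]_(y in A2) (h y)%:E)%E.
  move=> k0 h0 mh; apply: ge0_integralZl_EFin => //.
    by move=> y _; rewrite lee_fin.
  by apply/measurable_EFinP; exact: measurable_funTS mh.
have inner x : (\int[mu]_(y in A2) (kern_dist f g (x, y))%:E <=
    c2%:E * ((f x)%:E + (g x)%:E))%E.
  apply: (@le_trans _ _ (\int[mu]_(y in A2)
      ((f x)%:E * (f y)%:E + (g x)%:E * (g y)%:E))%E).
    apply: ge0_le_integral => //.
    - by move=> y _; rewrite lee_fin kern_dist_ge0.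
    - by apply: measurable_funTS; exact: measurableT_comp mD (measurable_pair1 x).
    - apply: emeasurable_funD; apply: measurable_funeM.
        exact: mfE.
      exact: mgE.
    - by move=> y _; rewrite -!EFinM -EFinD lee_fin; exact: kern_dist_leM.
  rewrite ge0_integralD//; last 4 first.
  - by move=> y _; rewrite -EFinM lee_fin mulr_ge0.
  - by apply: measurable_funeM; exact: mfE.
  - by move=> y _; rewrite -EFinM lee_fin mulr_ge0.
  - by apply: measurable_funeM; exact: mgE.
  rewrite (Zl f)// (Zl g)//.
  rewrite [leRHS]ge0_muleDr ?lee_fin//.
  by apply: leeD; rewrite [leRHS]muleC; apply: lee_wpmul2l; rewrite ?lee_fin.
apply: (@le_trans _ _ (\int[mu]_(x in A1) (c2%:E * ((f x)%:E + (g x)%:E)))%E).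
  apply: ge0_le_integral => //.
  - by move=> x _; apply: integral_ge0 => y _; rewrite lee_fin kern_dist_ge0.
  - apply: measurable_funTS; apply: (measurable_inner_integral mA2 mD) => z.
    by rewrite lee_fin kern_dist_ge0.
  - by apply: measurable_funeM; apply: emeasurable_funD; [exact: mfE|exact: mgE].
rewrite ge0_integralZl_EFin//; last 2 first.
- by move=> x _; rewrite -EFinD lee_fin addr_ge0.
- by apply: emeasurable_funD; [exact: mfE|exact: mgE].
rewrite ge0_integralD//; last 4 first.
- by move=> x _; rewrite lee_fin.
- exact: mfE.
- by move=> x _; rewrite lee_fin.
- exact: mgE.
rewrite (_ : (2 * c1 * c2)%:E = c2%:E * (c1%:E + c1%:E))%E; last first.
  by rewrite -EFinD -EFinM; congr EFin; lra.
by apply: lee_wpmul2l; rewrite ?lee_fin//; exact: leeD.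
Qed.

Lemma integral_block_limit_le (v : nat -> nat -> R) (s : nat -> R) (F : R -> R)
    (N : set R) (C : R) :
  (forall n i, 0 <= v n i) ->
  (forall n i, (n <= i)%N -> v n i = 0) ->
  (forall n, 0 < s n) ->
  (\forall n \near \oo, s n * \sum_(i < n) v n i <= C) ->
  measurable_fun setT F -> (forall x, 0 <= F x) -> countable N ->
  (forall x, 0 <= x -> ~ N x ->
    v n (block (s n) x) @[n --> \oo] --> F x) ->
  (\int[mu]_(x in nneg_reals R) (F x)%:E <= C%:E)%E.
Proof.
move=> v0 vfin s0 sC mF F0 cN vF.
apply: (@fatou_bound _ _ N (fun n x => v n (block (s n) x)) F) => //.
- exact: measurable_itv.
- by move=> n; exact: measurable_block.
- by move=> x; rewrite /nneg_reals/= in_itv/= andbT; exact: vF.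
apply: filterS sC => n; rewrite -lee_fin; apply: le_trans.
by rewrite (integral_block (m := n) (s0 n) (v0 n) (vfin n)).
Qed.

(** Dominated convergence settles the square [[0, K] ^ 2]. Monotonicity of [v] gives
[x f_n(x) <= C], so [f_n <= eps] beyond [K = C / eps]; there the total mass is at
most [eta], by the smallness hypothesis, and the same holds of [F] by Fatou. As
[k(u, v) <= u v], the strips outside of the square then contribute [O(C eta)]. *)
Lemma kern_L1_cvg (v : nat -> nat -> R) (s : nat -> R) (F : R -> R)
    (N : set R) (C : R) :
  (forall n i, 0 <= v n i) ->
  (forall n i j, (i <= j)%N -> v n j <= v n i) ->
  (forall n i, (n <= i)%N -> v n i = 0) ->
  (forall n, 0 < s n) ->
  0 < C -> (\forall n \near \oo, s n * \sum_(i < n) v n i <= C) ->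
  (forall eta : R, 0 < eta -> exists2 eps : R, 0 < eps & \forall n \near \oo,
     s n * \sum_(i < n | v n i <= eps) v n i <= eta) ->
  measurable_fun setT F -> (forall x, 0 <= F x) -> countable N ->
  (forall x, 0 <= x -> ~ N x ->
    v n (block (s n) x) @[n --> \oo] --> F x) ->
  (\int[mu]_(x in nneg_reals R) \int[mu]_(y in nneg_reals R)
    (kern_dist (fun x => v n (block (s n) x)) F (x, y))%:E
     @[n --> \oo] --> 0)%E.
Proof.
move=> v0 vmon vfin s0 C0 sC small mF F0 cN vF.
pose f n x := v n (block (s n) x).
have mf n : measurable_fun setT (f n) by exact: measurable_block.
have f0 n x : 0 <= f n x by exact: v0.
pose D : set RR := nneg_reals R.
have mD : measurable D by exact: measurable_itv.
have intf : \forall n \near \oo, (\int[mu]_(x in D) (f n x)%:E <= C%:E)%E.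
  apply: filterS sC => n; rewrite -lee_fin; apply: le_trans.
  by rewrite /f /D (integral_block (m := n) (s0 n) (v0 n) (vfin n)).
have intF : (\int[mu]_(x in D) (F x)%:E <= C%:E)%E.
  exact: (integral_block_limit_le v0 vfin s0 sC mF F0 cN vF).
apply: cvge0_le.
  move=> n; apply: integral_ge0 => x _; apply: integral_ge0 => y _.
  by rewrite lee_fin kern_dist_ge0.
(* each of the two strips contributes at most 2 * C * eta = e / 4 *)
move=> e e0; pose eta := e / (8 * C).
have eta0 : 0 < eta by rewrite divr_gt0// mulr_gt0.
have etaC : 4 * C * eta = e / 2.
  transitivity ((C * C^-1) * (e / 2)); first by rewrite /eta invfM; lra.
  by rewrite mulfV ?mul1r// gt_eqF.
have [eps eps0 smallE] := small eta eta0.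
pose K := C / eps.
have K0 : 0 < K by rewrite divr_gt0.
pose B : set RR := `[0%R, K]%classic.
pose T : set RR := `]K, +oo[%classic.
have mB : measurable B by exact: measurable_itv.
have mT : measurable T by exact: measurable_itv.
have BT : D = B `|` T.
  apply/seteqP; split=> [x|x [|]]; rewrite /D /B /T /nneg_reals/= !in_itv/= ?andbT.
  - by move=> x0; case: (leP x K) => xK; [left; rewrite x0|right].
  - by move=> /andP[].
  - by move=> Kx; rewrite ltW// (lt_trans K0).
have dBT : [disjoint B & T].
  apply/disj_setPS => x []; rewrite /B /T/= !in_itv/= andbT => /andP[_ xK].
  by rewrite ltNge xK.
have TD : T `<=` D by rewrite BT; exact: subsetUr.
have BD : B `<=` D by rewrite BT; exact: subsetUl.
have tailf : \forall n \near \oo, (\int[mu]_(x in T) (f n x)%:E <= eta%:E)%E.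
  near=> n.
  have sCn : s n * \sum_(i < n) v n i <= C by near: n; exact: sC.
  pose h i := if v n i <= eps then v n i else 0.
  have h0 i : 0 <= h i by rewrite /h; case: ifP.
  have fh x : T x -> f n x = h (block (s n) x).
    rewrite /T/= in_itv/= andbT => Kx.
    have x0 : 0 <= x by rewrite ltW// (lt_trans K0).
    rewrite /h /f ifT//.
    set b := block (s n) x.
    have [nb|bn] := leqP n b; first by rewrite vfin// ltW.
    have xb : x < b.+1%:R * s n by rewrite -block_lt.
    have h1 : s n * (b.+1%:R * v n b) <= C.
      apply: le_trans sCn; rewrite ler_wpM2l ?(ltW (s0 n))//.
      apply: (@le_trans _ _ (\sum_(i < n | (i < b.+1)%N) v n i)).
        rewrite mulr_natl -[X in _ *+ X]card_ord.
        rewrite (big_ord_narrow bn).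
        rewrite -sumr_const; apply: ler_sum => i _ /=.
        by apply: vmon; rewrite -ltnS.
      rewrite [leRHS](bigID (fun i : 'I_n => (i < b.+1)%N))/= lerDl.
      exact: sumr_ge0.
    have h2 : x * v n b <= C.
      apply: le_trans h1; rewrite mulrA [s n * _]mulrC.
      by rewrite ler_wpM2r// ltW.
    have x0' : 0 < x by exact: lt_trans Kx.
    rewrite -(ler_pM2l x0'); apply: (le_trans h2).
    by rewrite -ler_pdivrMr// ltW.
  rewrite (eq_integral (fun x : RR => (h (block (s n) x))%:E)); last first.
    by move=> x; rewrite inE => /fh ->.
  apply: (@le_trans _ _ (\int[mu]_(x in D) (h (block (s n) x))%:E)%E).
    apply: ge0_subset_integral => //.
    - by apply/measurable_EFinP; apply: measurable_funTS; exact: measurable_block.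
    - by move=> x _; rewrite lee_fin.
  rewrite (integral_block (m := n))//; last first.
    by move=> i ni; rewrite /h vfin//; case: ifP.
  rewrite lee_fin /h -big_mkcond/=.
  by near: n; exact: smallE.
have tailF : (\int[mu]_(x in T) (F x)%:E <= eta%:E)%E.
  apply: (@fatou_bound _ T N f F) => // x /TD.
  by rewrite /D /nneg_reals/= in_itv/= andbT; exact: vF.
have boxF := @kern_dist_box_cvg0 _ N f F K K0 cN mf f0 mF F0 vF.
have e2 : (0 < (e / 2)%:E :> \bar R)%E by rewrite lte_fin divr_gt0.
have := cvge_lt_near boxF e2 => box.
near=> n.
have intfn : (\int[mu]_(x in D) (f n x)%:E <= C%:E)%E by near: n; exact: intf.
have tailfn : (\int[mu]_(x in T) (f n x)%:E <= eta%:E)%E by near: n; exact: tailf.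
have mkd := measurable_kern_dist (f0 n) F0 (mf n) mF.
have kd0 z : (0 <= (kern_dist (f n) F z)%:E)%E by rewrite lee_fin kern_dist_ge0.
have mkdx x : measurable_fun setT (fun y : RR => (kern_dist (f n) F (x, y))%:E).
  exact: measurableT_comp mkd (measurable_pair1 x).
have minner A : measurable A ->
    measurable_fun setT (fun x : RR => \int[mu]_(y in A) (kern_dist (f n) F (x, y))%:E)%E.
  by move=> mA; exact: (measurable_inner_integral mA mkd).
have subB (g : R -> R) : (forall x, 0 <= g x) -> measurable_fun setT g ->
    (\int[mu]_(x in D) (g x)%:E <= C%:E)%E -> (\int[mu]_(x in B) (g x)%:E <= C%:E)%E.
  move=> g0 mg; apply: le_trans; apply: ge0_subset_integral => //.
  - by apply/measurable_EFinP; exact: measurable_funTS mg.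
  - by move=> x _; rewrite lee_fin.
have TDle : (\int[mu]_(x in T) \int[mu]_(y in D) (kern_dist (f n) F (x, y))%:E
    <= (2 * eta * C)%:E)%E.
  by apply: kern_dist_rect_le => //; exact: ltW.
have BTle : (\int[mu]_(x in B) \int[mu]_(y in T) (kern_dist (f n) F (x, y))%:E
    <= (2 * C * eta)%:E)%E.
  by apply: kern_dist_rect_le => //; [exact: ltW|exact: subB|exact: subB].
rewrite -/D {1}BT ge0_integral_setU//; last 2 first.
- by apply: measurable_funTS; exact: minner.
- by move=> x _; apply: integral_ge0.
have -> : (\int[mu]_(x in B) \int[mu]_(y in D) (kern_dist (f n) F (x, y))%:E =
    \int[mu]_(x in B) \int[mu]_(y in B) (kern_dist (f n) F (x, y))%:E +
    \int[mu]_(x in B) \int[mu]_(y in T) (kern_dist (f n) F (x, y))%:E)%E.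
  rewrite -ge0_integralD//; last 4 first.
  - by move=> x _; apply: integral_ge0.
  - by apply: measurable_funTS; exact: minner.
  - by move=> x _; apply: integral_ge0.
  - by apply: measurable_funTS; exact: minner.
  apply: eq_integral => x _; rewrite BT ge0_integral_setU//.
  exact: measurable_funTS.
have -> : e%:E = ((e / 2)%:E + (2 * C * eta)%:E + (2 * eta * C)%:E)%E.
  by rewrite -!EFinD; congr EFin; lra.
apply: leeD => //; apply: leeD => //.
by apply: ltW; near: n; exact: box.
Unshelve. all: by end_near. Qed.

End kern_L1.

(** * Weights in decreasing order *)

Section sorted_weights.
Context (R : realType) (n : nat) (w : nat -> R).

Definition weight_order : seq nat :=
  sort (fun i j => w j <= w i) (iota 0 n).

(** The rescaled weights in decreasing order, continued by [0] so that step functions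
built from them vanish beyond the last block. *)
Definition sorted_weight (i : nat) : R :=
  if (i < n)%N then scaled_weight n w (nth 0%N weight_order i) else 0.

Lemma size_weight_order : size weight_order = n.
Proof. by rewrite size_sort size_iota. Qed.

Lemma mem_weight_order i : (i \in weight_order) = (i < n)%N.
Proof. by rewrite mem_sort mem_iota. Qed.

Lemma weight_order_lt i : (i < n)%N -> (nth 0%N weight_order i < n)%N.
Proof. by move=> ni; rewrite -mem_weight_order mem_nth// size_weight_order. Qed.

Lemma weight_order_uniq : uniq weight_order.
Proof. by rewrite sort_uniq iota_uniq. Qed.

Lemma sum_weight_order (V : nmodType) (h : nat -> V) :
  \sum_(i < n) h (nth 0%N weight_order i) = \sum_(i < n) h i.
Proof.
rewrite -(big_mkord xpredT h) /index_iota subn0.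
have P : perm_eq weight_order (iota 0 n) by rewrite /weight_order perm_sort.
rewrite -(perm_big _ P)/= (big_nth 0%N) size_weight_order.
by rewrite -(big_mkord xpredT (fun i => h (nth 0%N weight_order i))).
Qed.

Lemma sum_sorted_weight (h : R -> R) :
  \sum_(i < n) h (sorted_weight i) = \sum_(i < n) h (scaled_weight n w i).
Proof.
rewrite -(sum_weight_order (fun i => h (scaled_weight n w i))).
by apply: eq_bigr => i _; rewrite /sorted_weight ltn_ord.
Qed.

Lemma sorted_weight_eq0 i : (n <= i)%N -> sorted_weight i = 0.
Proof. by rewrite /sorted_weight ltnNge => ->. Qed.

Hypothesis w_ge0 : forall i : nat, (i < n)%N -> 0 <= w i.

Lemma scaled_weight_ge0 i : (i < n)%N -> 0 <= scaled_weight n w i.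
Proof. by move=> ni; rewrite /scaled_weight divr_ge0 ?w_ge0 ?sqrtr_ge0. Qed.

Lemma sorted_weight_ge0 i : 0 <= sorted_weight i.
Proof.
rewrite /sorted_weight; case: ifP => // ni.
by rewrite scaled_weight_ge0// weight_order_lt.
Qed.

Lemma sorted_weight_nonincreasing i j : (i <= j)%N ->
  sorted_weight j <= sorted_weight i.
Proof.
move=> ij; have [nj|jn] := leqP n j.
  by rewrite sorted_weight_eq0// sorted_weight_ge0.
rewrite /sorted_weight jn (leq_ltn_trans ij jn) /scaled_weight ler_wpM2r//.
have st : sorted (fun i j => w j <= w i) weight_order.
  by apply: sort_sorted => x y; exact: le_total.
apply: (sorted_leq_nth (leT := fun i j => w j <= w i) _ _ 0%N st) => //.
- by move=> y x z xy yz; exact: le_trans xy.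
- by rewrite inE size_weight_order (leq_ltn_trans ij jn).
- by rewrite inE size_weight_order.
Qed.

(** A decreasing sequence exceeds [t] exactly at the indices below the number of its
terms that exceed [t]. *)
Lemma lt_sorted_weight (t : R) i : 0 <= t ->
  (t < sorted_weight i) = (i < \sum_(j < n) (t < scaled_weight n w j)%R)%N.
Proof.
move=> t0; have -> : (\sum_(j < n) (t < scaled_weight n w j)%R)%N =
    (\sum_(j < n) (t < sorted_weight j)%R)%N.
  rewrite -(@sum_weight_order nat (fun j => (t < scaled_weight n w j)%R : nat)).
  by apply: eq_bigr => j _; rewrite /sorted_weight ltn_ord.
apply/idP/idP => [ti|].
  have ni : (i < n)%N.
    by rewrite ltnNge; apply: contraTN ti => /sorted_weight_eq0 ->; rewrite -leNgt.
  rewrite (bigID (fun j : 'I_n => (j < i.+1)%N))/=.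
  apply: leq_trans (leq_addr _ _); rewrite (big_ord_narrow ni)/=.
  rewrite -[X in (X <= _)%N]card_ord -sum1_card; apply: leq_sum => j _.
  rewrite lt0b; apply: lt_le_trans ti _; apply: sorted_weight_nonincreasing.
  by rewrite -ltnS ltn_ord.
apply: contraTT; rewrite -leNgt -leqNgt => ti.
have minE m : (\sum_(j < m) (j < i))%N = minn m i.
  elim: m => [|m ih]; first by rewrite big_ord0 min0n.
  rewrite big_ord_recr/= ih; case: (ltnP m i) => mi.
    by rewrite (minn_idPl mi) addn1.
  by rewrite (minn_idPr (leqW mi)) addn0.
apply: (@leq_trans (\sum_(j < n) (j < i)%N)%N); last by rewrite minE geq_minr.
apply: leq_sum => j _; case: (ltnP j i) => [_|ij]; first exact: leq_b1.
by rewrite leqn0 eqb0 -leNgt (le_trans _ ti)// sorted_weight_nonincreasing.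
Qed.

(** The step function of the sorted weights is the generalized inverse of the tail of
the weight measure, up to the rescaling of the argument. *)
Lemma lt_sorted_weight_block (s t x : R) : 0 < s -> 0 <= x -> 0 <= t ->
  0 < total_weight n w ->
  (t < sorted_weight (block s x)) =
  (x / (s * Num.sqrt (total_weight n w)) < empirical_tail n w t).
Proof.
move=> s0 x0 t0 L0; rewrite lt_sorted_weight// block_lt// /empirical_tail.
have q0 : 0 < Num.sqrt (total_weight n w) by rewrite sqrtr_gt0.
rewrite ltr_pdivrMr ?mulr_gt0// natr_sum; set S := \sum_(i < n) _.
by rewrite [_^-1 * S * _]mulrC mulrA mulfK ?gt_eqF// [s * S]mulrC.
Qed.

End sorted_weights.

(** Convergence of tails passes to their generalized inverses, at every level
[y = sqrt c x] which is not the value of the limit tail on an interval. Such a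
value is also taken at a rational, so the exceptions are countable. For the
upper bound, [y] differs from the tail at a rational between [tail_inv y] and
[tail_inv y + e]. *)
Lemma sorted_weight_cvg (R : realType) (w : nat -> nat -> R)
    (rho : {measure set (measurableTypeR R) -> \bar R}) (s : nat -> R) (c x : R) :
  (forall n i : nat, (i < n)%N -> 0 <= w n i) ->
  (\forall n \near \oo, 0 < total_weight n (w n)) ->
  vague_cvg (fun n => weight_measure n (w n)) rho ->
  0 < c -> (forall n, 0 < s n) ->
  s n * Num.sqrt (total_weight n (w n)) @[n --> \oo] --> (Num.sqrt c)^-1 ->
  0 < x -> (forall q : rat, fine (tail rho (ratr q)) != Num.sqrt c * x) ->
  sorted_weight n (w n) (block (s n) x) @[n --> \oo]
    --> tail_inv rho (Num.sqrt c * x).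
Proof.
move=> w0 L0 rho_cvg c0 s0 sq x0 xq.
have c12 : 0 < Num.sqrt c by rewrite sqrtr_gt0.
set y := Num.sqrt c * x.
have y0 : 0 < y by rewrite mulr_gt0.
have tail_le := tail_le_inv w0 rho_cvg.
have xy : x / (s n * Num.sqrt (total_weight n (w n))) @[n --> \oo] --> y.
  rewrite /y mulrC -[Num.sqrt c]invrK.
  by apply: cvgMr; apply: cvgV => //; rewrite invr_neq0// gt_eqF.
apply/cvgrPdist_le => e e0; near=> n.
have Ln : 0 < total_weight n (w n) by near: n.
have sw0 := sorted_weight_ge0 (w0 n) (block (s n) x).
rewrite ler_distlC; apply/andP; split.
- near: n; have [Fe|eF] := leP (tail_inv rho y) e.
    apply: nearW => n; rewrite (@le_trans _ _ 0) ?subr_le0//.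
    exact: (sorted_weight_ge0 (w0 n)).
  set t := tail_inv rho y - e.
  have t0 : 0 < t by rewrite subr_gt0.
  have yt : (y%:E < tail rho t)%E.
    by rewrite ltNge -tail_inv_le ?(ltW t0)// -ltNge /t ltrBlDr ltrDl.
  have tfin : tail rho t \is a fin_num.
    by rewrite ge0_fin_numE// (le_lt_trans (tail_le t t0))// ltry.
  have yr : y < fine (tail rho t) by rewrite -lte_fin fineK.
  pose y' := (y + fine (tail rho t)) / 2.
  have y'r : (y'%:E < tail rho t)%E by rewrite -(fineK tfin) lte_fin /y'; lra.
  have yy' : y < y' by rewrite /y'; lra.
  have h1 := eventually_lt_empirical_tail rho_cvg t0 y'r.
  have h2 : \forall n \near \oo,
      x / (s n * Num.sqrt (total_weight n (w n))) < y'.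
    by apply: (cvgr_lt y).
  near=> n; apply: ltW.
  rewrite (lt_sorted_weight_block (w0 n)) ?(ltW x0) ?(ltW t0)//; last by near: n.
  by apply: (@lt_trans _ _ y'); near: n.
- near: n; set t := tail_inv rho y + e.
  have F0 := tail_inv_ge0 rho y.
  have t0 : 0 < t by rewrite ltr_wpDl.
  have [q] := @rat_in_itvoo R (tail_inv rho y) t ltac:(by rewrite ltrDl).
  rewrite in_itv/= => /andP[Fq qt].
  have q0 : 0 < (ratr q : R) by exact: le_lt_trans Fq.
  have qy : (tail rho (ratr q) <= y%:E)%E.
    by rewrite -tail_inv_le ?(ltW q0)// ltW.
  have qfin : tail rho (ratr q) \is a fin_num.
    by rewrite ge0_fin_numE// (le_lt_trans qy)// ltry.
  have ry : fine (tail rho (ratr q)) < y.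
    by rewrite lt_neqAle xq -lee_fin fineK.
  pose y' := (y + fine (tail rho (ratr q))) / 2.
  have y'r : (tail rho (ratr q) < y'%:E)%E by rewrite -(fineK qfin) lte_fin /y'; lra.
  have yy' : y' < y by rewrite /y'; lra.
  have h1 := eventually_empirical_tail_lt w0 rho_cvg q0 qt y'r.
  have h2 : \forall n \near \oo,
      y' < x / (s n * Num.sqrt (total_weight n (w n))).
    by apply: (cvgr_gt y).
  near=> n; rewrite leNgt (lt_sorted_weight_block (w0 n)) ?(ltW x0) ?(ltW t0)//;
    last by near: n.
  by rewrite -leNgt ltW//; apply: (@lt_trans _ _ y'); near: n.
Unshelve. all: by end_near. Qed.

(** * The hypotheses on the weight measures, as sums over vertices *)

Section scaled_weight_sums.
Context (R : realType) (w : nat -> nat -> R).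
Hypothesis w_ge0 : forall n i : nat, (i < n)%N -> 0 <= w n i.

Lemma limn_esup_lt_near (u : (\bar R)^nat) (a : \bar R) :
  (limn_esup u < a)%E -> \forall n \near \oo, (u n < a)%E.
Proof.
rewrite /limn_esup limf_esupE => /ereal_inf_lt[_ [V Voo <-] Va].
apply: filterS Voo => n Vn; apply: le_lt_trans Va.
by apply: ereal_sup_ubound; exists n.
Qed.

Lemma small_scaled_weights :
  (limn_esup (fun n =>
     \int[weight_measure n (w n)]_(x in `]0%R, eps]) (x : R)%:E)%E
     @[eps --> (0 : R)^'+] --> 0%E) ->
  forall eta : R, 0 < eta -> exists2 eps : R, 0 < eps & \forall n \near \oo,
    (Num.sqrt (total_weight n (w n)))^-1 *
      \sum_(i < n | scaled_weight n (w n) i <= eps) scaled_weight n (w n) i <= eta.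
Proof.
move=> lim0 eta eta0.
have e0 : (0 < eta%:E :> \bar R)%E by rewrite lte_fin.
have nb : \forall eps \near (0 : R)^'+, (limn_esup (fun n =>
     \int[weight_measure n (w n)]_(x in `]0%R, eps]) (x : R)%:E)%E < eta%:E)%E.
  have := lim0 [set z | (z < eta%:E)%E].
  by apply; apply: open_nbhs_nbhs; split => //; exact: open_ereal_lt_ereal.
have [eps [eps0 esup]] : exists eps : R, 0 < eps /\ (limn_esup (fun n =>
     \int[weight_measure n (w n)]_(x in `]0%R, eps]) (x : R)%:E)%E < eta%:E)%E.
  near (0 : R)^'+ => eps; exists eps; split; near: eps => //.
  exact: nbhs_right_gt.
exists eps => //; have := limn_esup_lt_near esup; apply: filterS => n.
have D0 (x : measurableTypeR R) : `]0%R, eps]%classic x -> 0 <= x.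
  by rewrite /= in_itv/= => /andP[/ltW].
rewrite (@integral_weight_measure _ _ _ `]0%R, eps]%classic id)//.
rewrite lte_fin => /ltW; apply: le_trans.
rewrite ler_wpM2l ?invr_ge0 ?sqrtr_ge0// big_mkcond/=; apply: ler_sum => i _.
set u := scaled_weight n (w n) i.
have u0 : 0 <= u by exact: (scaled_weight_ge0 (w_ge0 (n := n))).
case: ifP => ue; last by rewrite mulr_ge0.
(* a vertex of weight 0 lies outside of the interval, but adds nothing to the sum *)
have [->|un] := eqVneq u 0; first by rewrite mulr0.
rewrite indicE mem_set ?mul1r//= in_itv/= ue andbT.
by rewrite lt_neqAle eq_sym un.
Unshelve. all: by end_near. Qed.

Lemma sum_kern_cvg (c : R) :
  (\int[weight_measure n (w n)]_(y in pos_reals R)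
     \int[weight_measure n (w n)]_(x in pos_reals R)
       ((x : R) * (y : R) / (1 + (x : R) * (y : R)))%:E)%E
      @[n --> \oo] --> c%:E ->
  ((Num.sqrt (total_weight n (w n)))^-1 ^+ 2 *
    \sum_(i < n) \sum_(j < n)
      kern (scaled_weight n (w n) i) (scaled_weight n (w n) j)
   @[n --> \oo] --> c).
Proof.
move=> /fine_cvg; apply: cvg_trans; apply: near_eq_cvg; apply: nearW => n /=.
set I := (\int[_]_(y in _) _)%E; set S := (X in _ = X).
suff -> : I = S%:E by []; rewrite /I /S.
have mp : measurable (pos_reals R : set (measurableTypeR R)) by exact: measurable_itv.
set q := Num.sqrt (total_weight n (w n)).
have msat (y : R) : 0 < y ->
    measurable_fun (pos_reals R : set (measurableTypeR R)) (fun x => x * y / (1 + x * y)).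
  move=> y0; apply: (eq_measurable_fun (fun x : measurableTypeR R => saturation `|x * y|)).
    move=> x; rewrite inE /pos_reals/= in_itv/= andbT => x0.
    by rewrite ger0_norm// mulr_ge0 ?ltW.
  apply: measurable_funTS; apply: measurable_saturation => //.
  by apply: measurableT_comp => //; exact: measurable_funM.
have inner (y : measurableTypeR R) : pos_reals R y ->
  (\int[weight_measure n (w n)]_(x in pos_reals R)
       ((x : R) * (y : R) / (1 + (x : R) * (y : R)))%:E =
   (q^-1 * \sum_(i < n) \1_(pos_reals R) (scaled_weight n (w n) i) *
       kern (scaled_weight n (w n) i) y)%:E)%E.
  rewrite /pos_reals/= in_itv/= andbT => y0.
  rewrite (@integral_weight_measure _ _ _ _ (fun x => x * y / (1 + x * y)))//.
    exact: msat.
  move=> x; rewrite /= in_itv/= andbT => x0.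
  by apply: saturation_ge0; rewrite mulr_ge0 ?ltW.
rewrite (eq_integral (fun y : measurableTypeR R => (q^-1 * \sum_(i < n)
    \1_(pos_reals R) (scaled_weight n (w n) i) *
       kern (scaled_weight n (w n) i) y)%:E)); last first.
  by move=> y; rewrite inE => /inner.
rewrite integral_weight_measure//.
- rewrite expr2 -mulrA -/q; congr (_ * _)%:E.
  rewrite exchange_big/= mulr_sumr; apply: eq_bigr => j _.
  rewrite mulrCA; congr (_ * _); rewrite mulr_sumr; apply: eq_bigr => i _.
  set u := scaled_weight n (w n) i; set v := scaled_weight n (w n) j.
  have u0 : 0 <= u by exact: (scaled_weight_ge0 (w_ge0 (n := n))).
  have v0 : 0 <= v by exact: (scaled_weight_ge0 (w_ge0 (n := n))).
  have ind r : 0 <= r -> r != 0 -> \1_(pos_reals R) r = 1 :> R.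
    move=> r0 rn; rewrite indicE mem_set// /pos_reals/= in_itv/= andbT.
    by rewrite lt_neqAle eq_sym rn.
  have [uz|un] := eqVneq u 0.
    by rewrite /kern uz mul0r /saturation mul0r !mulr0.
  have [vz|vn] := eqVneq v 0.
    by rewrite /kern vz mulr0 /saturation mul0r !mulr0.
  by rewrite !ind// !mul1r.
- apply: measurable_funM => //; apply: measurable_sum => i.
  apply: measurable_funM => //.
  set u := scaled_weight n (w n) i.
  have u0 : 0 <= u by exact: (scaled_weight_ge0 (w_ge0 (n := n))).
  apply: (eq_measurable_fun (fun y : measurableTypeR R => saturation `|u * y|)).
    move=> y; rewrite inE /pos_reals/= in_itv/= andbT => y0.
    by rewrite /kern ger0_norm// mulr_ge0// ltW.
  apply: measurable_funTS; apply: measurable_saturation => //.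
  by apply: measurableT_comp => //; exact: measurable_funM.
- move=> y; rewrite /pos_reals/= in_itv/= andbT => y0.
  rewrite mulr_ge0 ?invr_ge0 ?sqrtr_ge0//; apply: sumr_ge0 => i _.
  rewrite mulr_ge0// kern_ge0 ?(ltW y0)//.
  exact: (scaled_weight_ge0 (w_ge0 (n := n))).
Qed.

End scaled_weight_sums.

Lemma integral_kern_block (R : realType) (s : R) (n : nat) (w : nat -> R) :
  0 < s -> (forall i : nat, (i < n)%N -> 0 <= w i) ->
  (\int[lebesgue_measure]_(x in nneg_reals R)
   \int[lebesgue_measure]_(y in nneg_reals R)
     (kern (sorted_weight n w (block s x)) (sorted_weight n w (block s y)))%:E =
   (s ^+ 2 * \sum_(i < n) \sum_(j < n)
      kern (scaled_weight n w i) (scaled_weight n w j))%:E)%E.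
Proof.
move=> s0 w0; have v0 := sorted_weight_ge0 w0.
pose h i := s * \sum_(j < n) kern (sorted_weight n w i) (sorted_weight n w j).
have kern0l v : kern 0 v = 0 :> R by rewrite /kern /saturation !mul0r.
have kern0r u : kern u 0 = 0 :> R by rewrite /kern /saturation mulr0 mul0r.
rewrite (eq_integral (fun x : measurableTypeR R => (h (block s x))%:E)); last first.
  move=> x _; rewrite (@integral_block _ s n (fun j =>
    kern (sorted_weight n w (block s x)) (sorted_weight n w j)))//.
  - by move=> i; exact: kern_ge0.
  - by move=> i ni; rewrite (sorted_weight_eq0 _ ni) kern0r.
rewrite (@integral_block _ s n h)//; last 2 first.
- by move=> i; rewrite mulr_ge0 ?(ltW s0)// sumr_ge0// => j _; exact: kern_ge0.
- by move=> i ni; rewrite /h sorted_weight_eq0// big1 ?mulr0.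
congr EFin; rewrite /h -mulr_sumr mulrA -expr2; congr (_ * _).
rewrite (sum_sorted_weight n w (fun u => \sum_(j < n) kern u (sorted_weight n w j))).
apply: eq_bigr => i _.
exact: (sum_sorted_weight n w (fun v => kern (scaled_weight n w i) v)).
Qed.

(** * The limit graphon *)

Section plane_integrals.
Context (R : realType).
Local Notation mu := (@lebesgue_measure R).
Local Notation RR := (measurableTypeR R).

Lemma integral_rect (A B : set RR) (h : RR * RR -> \bar R) :
  measurable A -> measurable B -> measurable_fun setT h ->
  (forall z, 0 <= h z)%E ->
  (\int[(mu \x mu)%E]_(z in A `*` B) h z =
   \int[mu]_(x in A) \int[mu]_(y in B) h (x, y))%E.
Proof.
move=> mA mB mh h0.
pose g := h \_ (A `*` B).
have mg : measurable_fun setT g.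
  apply/(measurable_restrictT _ _).1; first exact: measurableX.
  exact: measurable_funTS.
have g0 z : (0 <= g z)%E by apply: erestrict_ge0 => ? _.
rewrite integral_mkcond (@fubini_tonelli1 _ _ _ _ _ mu mu g mg g0).
rewrite [RHS]integral_mkcond; apply: eq_integral => x _.
rewrite /fubini_F /g /patch; case: ifPn => [xA|xA].
  rewrite [RHS]integral_mkcond; apply: eq_integral => y _; rewrite /patch.
  by rewrite in_setX/= xA.
by rewrite integral0_eq// => y _; rewrite in_setX/= (negbTE xA).
Qed.

Lemma measurable_kern_offdiag (F : R -> R) : (forall x, 0 <= F x) ->
  measurable_fun setT F ->
  measurable_fun setT (fun z : RR * RR =>
    if z.1 == z.2 then 0 else kern (F z.1) (F z.2)).
Proof.
move=> F0 mF; apply: measurable_fun_if => //.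
- by apply: measurable_fun_eqr; [exact: measurable_fst|exact: measurable_snd].
- by apply: measurable_funTS; exact: measurable_kern_fun.
Qed.

(** The diagonal meets every vertical line in a single point. *)
Lemma integral_offdiag (A : set RR) (x : R) (h : R -> \bar R) :
  measurable A -> measurable_fun setT h -> (forall y, 0 <= h y)%E ->
  (\int[mu]_(y in A) (if x == y then 0 else h y) = \int[mu]_(y in A) h y)%E.
Proof.
move=> mA mh h0.
have mx : measurable ([set x] : set RR) by exact: measurable_set1.
have mux : mu [set x] = 0%E by exact: lebesgue_measure_set1.
rewrite (@ge0_negligible_integral _ _ _ mu A [set x])//; last 2 first.
- apply: measurable_funTS; apply: measurable_fun_if => //.
    by apply: measurable_fun_eqr.
  exact: measurable_funTS.
- by move=> y _; case: ifP.
rewrite [RHS](@ge0_negligible_integral _ _ _ mu A [set x])//; last first.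
  exact: measurable_funTS.
apply: eq_integral => y; rewrite inE => -[_ /= yx].
by case: eqP => // xy; exfalso; apply: yx.
Qed.

End plane_integrals.

Section limit_graphon.
Context (R : realType) (w : nat -> nat -> R)
  (rho : {measure set (measurableTypeR R) -> \bar R}) (c : R).
Local Notation mu := (@lebesgue_measure R).
Local Notation RR := (measurableTypeR R).
Local Notation D := (nneg_reals R).
Hypothesis w_ge0 : forall n i : nat, (i < n)%N -> 0 <= w n i.
Hypothesis L_gt0 : \forall n \near \oo, 0 < total_weight n (w n).
Hypothesis rho_cvg : vague_cvg (fun n => weight_measure n (w n)) rho.
Hypothesis small_mass : forall eta : R, 0 < eta ->
  exists2 eps : R, 0 < eps & \forall n \near \oo,
    (Num.sqrt (total_weight n (w n)))^-1 *
      \sum_(i < n | scaled_weight n (w n) i <= eps) scaled_weight n (w n) i <= eta.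
Hypothesis int_c : (Num.sqrt (total_weight n (w n)))^-1 ^+ 2 *
    \sum_(i < n) \sum_(j < n)
      kern (scaled_weight n (w n) i) (scaled_weight n (w n) j)
   @[n --> \oo] --> c.
Hypothesis c_gt0 : 0 < c.

(** The limit of the step functions of the sorted weights; [GRG_graphon] is its
kernel off the diagonal. *)
Definition limit_weight (x : R) : R := tail_inv rho (Num.sqrt c * x).

Lemma measurable_limit_weight : measurable_fun setT limit_weight.
Proof.
apply: measurableT_comp; first by apply: measurable_tail_inv; exact: (tail_le_inv w_ge0 rho_cvg).
exact: measurable_funM.
Qed.

Lemma limit_weight_ge0 x : 0 <= limit_weight x.
Proof. exact: tail_inv_ge0. Qed.

(** The exceptional set of [sorted_weight_cvg], together with the point [0], where
[tail_inv] has the conventional value [0]. *)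
Lemma sorted_weight_block_cvg (s : nat -> R) : (forall n, 0 < s n) ->
  s n * Num.sqrt (total_weight n (w n)) @[n --> \oo] --> (Num.sqrt c)^-1 ->
  exists2 N : set R, countable N & forall x, 0 <= x -> ~ N x ->
    sorted_weight n (w n) (block (s n) x) @[n --> \oo] --> limit_weight x.
Proof.
move=> s0 sq; have c12 : 0 < Num.sqrt c by rewrite sqrtr_gt0.
pose bad (q : option rat) : R :=
  if q is Some q' then fine (tail rho (ratr q')) / Num.sqrt c else 0.
exists (range bad).
  by apply: sub_countable (card_image_le _ _) _; exact: countableP.
move=> x x0 xbad; apply: sorted_weight_cvg => //.
  rewrite lt_neqAle x0 andbT; apply/eqP => x0'.
  by apply: xbad; exists None.
move=> q; apply/eqP => qx; apply: xbad; exists (Some q) => //=.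
by rewrite qx mulrAC mulfV ?mul1r// gt_eqF.
Qed.

Lemma sorted_weight_mass_le (s : nat -> R) :
  s n * Num.sqrt (total_weight n (w n)) @[n --> \oo] --> (Num.sqrt c)^-1 ->
  \forall n \near \oo,
    s n * \sum_(i < n) sorted_weight n (w n) i <= 2 / Num.sqrt c.
Proof.
move=> sq.
have sq2 : \forall n \near \oo,
    s n * Num.sqrt (total_weight n (w n)) <= 2 / Num.sqrt c.
  apply: (cvgr_le (Num.sqrt c)^-1) => //.
  by rewrite ltr_pMl ?invr_gt0 ?sqrtr_gt0// ltr1n.
apply: filterS sq2 => n; apply: le_trans.
by rewrite (sum_sorted_weight n (w n) id)/= total_scaled_weight.
Qed.

Lemma sorted_kern_cvg (s : nat -> R) : (forall n, 0 < s n) ->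
  s n * Num.sqrt (total_weight n (w n)) @[n --> \oo] --> (Num.sqrt c)^-1 ->
  (\int[mu]_(x in D) \int[mu]_(y in D)
    (kern_dist (fun x => sorted_weight n (w n) (block (s n) x)) limit_weight (x, y))%:E
     @[n --> \oo] --> 0)%E.
Proof.
move=> s0 sq; have c12 : 0 < Num.sqrt c by rewrite sqrtr_gt0.
have sC := sorted_weight_mass_le sq.
have sq2 : \forall n \near \oo,
    s n * Num.sqrt (total_weight n (w n)) <= 2 / Num.sqrt c.
  apply: filterS sC => n.
  by rewrite (sum_sorted_weight n (w n) id)/= total_scaled_weight.
have [N cN vF] := sorted_weight_block_cvg s0 sq.
apply: (@kern_L1_cvg _ (fun n => sorted_weight n (w n)) s _ N (2 / Num.sqrt c)) => //.
- by move=> n i; exact: (sorted_weight_ge0 (w_ge0 (n := n))).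
- by move=> n i j; exact: (sorted_weight_nonincreasing (w_ge0 (n := n))).
- by move=> n i; exact: sorted_weight_eq0.
- by rewrite divr_gt0.
- move=> eta eta0.
  have eta'0 : 0 < eta * Num.sqrt c / 2 by rewrite divr_gt0// mulr_gt0.
  have [eps eps0 epsP] := small_mass eta'0; exists eps => //.
  near=> n.
  have Ln : 0 < total_weight n (w n) by near: n.
  have q0 : 0 < Num.sqrt (total_weight n (w n)) by rewrite sqrtr_gt0.
  rewrite big_mkcond/= (sum_sorted_weight n (w n) (fun u => if u <= eps then u else 0)).
  rewrite -big_mkcond/=; set S := \sum_(i < n | _) _.
  have -> : s n * S = (s n * Num.sqrt (total_weight n (w n))) *
      ((Num.sqrt (total_weight n (w n)))^-1 * S).
    by rewrite mulrA mulfK ?gt_eqF.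
  have -> : eta = (2 / Num.sqrt c) * (eta * Num.sqrt c / 2).
    rewrite mulrCA -mulrA mulrA [X in _ = X](_ : _ = eta * (Num.sqrt c / Num.sqrt c)).
      by rewrite mulfV ?mulr1// gt_eqF.
    lra.
  apply: ler_pM.
  + by rewrite mulr_ge0// ltW.
  + rewrite mulr_ge0 ?invr_ge0 ?(ltW q0)//; apply: sumr_ge0 => i _.
    exact: (scaled_weight_ge0 (w_ge0 (n := n))).
  + by near: n.
  + by rewrite /S; near: n.
- exact: measurable_limit_weight.
- exact: limit_weight_ge0.
Unshelve. all: by end_near. Qed.

(** A particular width of the blocks. Statements on the limit alone follow from any
choice of widths. *)
Lemma step_size_cvg :
  let s n := if 0 < total_weight n (w n)
    then (Num.sqrt c)^-1 / Num.sqrt (total_weight n (w n)) else 1 in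
  (forall n, 0 < s n) /\
  (s n * Num.sqrt (total_weight n (w n)) @[n --> \oo] --> (Num.sqrt c)^-1).
Proof.
move=> s; split=> [n|].
  by rewrite /s; case: ifP => // Ln; rewrite divr_gt0 ?invr_gt0 ?sqrtr_gt0.
apply: (@cvg_trans _ (cst (Num.sqrt c)^-1 @ \oo)); last exact: cvg_cst.
apply: near_eq_cvg; apply: filterS L_gt0 => n Ln /=.
by rewrite /s Ln divfK// gt_eqF// sqrtr_gt0.
Qed.

Lemma integral_limit_weight_lty : (\int[mu]_(x in D) (limit_weight x)%:E < +oo)%E.
Proof.
have [] := step_size_cvg; set s := (X in forall n, 0 < X n) => s0 sq.
have [N cN vF] := sorted_weight_block_cvg s0 sq.
apply: le_lt_trans (ltry (2 / Num.sqrt c)).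
apply: (integral_block_limit_le (v := fun n => sorted_weight n (w n)) _ _ s0
  (sorted_weight_mass_le sq) measurable_limit_weight limit_weight_ge0 cN vF).
- by move=> n i; exact: (sorted_weight_ge0 (w_ge0 (n := n))).
- by move=> n i; exact: sorted_weight_eq0.
Qed.

Lemma integral_step_kern_cvg (s : nat -> R) : (forall n, 0 < s n) ->
  s n * Num.sqrt (total_weight n (w n)) @[n --> \oo] --> (Num.sqrt c)^-1 ->
  (\int[mu]_(x in D) \int[mu]_(y in D)
     (kern (sorted_weight n (w n) (block (s n) x))
           (sorted_weight n (w n) (block (s n) y)))%:E @[n --> \oo] --> 1)%E.
Proof.
move=> s0 sq.
have E n := integral_kern_block (s0 n) (w_ge0 (n := n)).
under eq_fun do rewrite E.
apply: cvg_EFin; first exact: nearW.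
rewrite -[1](_ : (Num.sqrt c)^-1 ^+ 2 * c = 1); last first.
  by rewrite exprVn sqr_sqrtr ?(ltW c_gt0)// mulVf// gt_eqF.
rewrite [_^-1 ^+ 2]expr2; apply: cvg_trans (cvgM (cvgM sq sq) int_c).
apply: near_eq_cvg; apply: filterS L_gt0 => n Ln /=.
rewrite mulrA; congr (_ * _).
have q0 : 0 < Num.sqrt (total_weight n (w n)) by rewrite sqrtr_gt0.
by rewrite -expr2 -exprMn mulfK ?gt_eqF.
Qed.

(** By the hypothesis on the double integrals the kernels of the step functions have
integrals tending to [1], and they converge in [L^1]. *)
Lemma integral_limit_kern :
  (\int[mu]_(x in D) \int[mu]_(y in D)
     (kern (limit_weight x) (limit_weight y))%:E = 1)%E.
Proof.
have [] := step_size_cvg; set s := (X in forall n, 0 < X n) => s0 sq.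
pose f n x := sorted_weight n (w n) (block (s n) x).
have f0 n x : 0 <= f n x by exact: (sorted_weight_ge0 (w_ge0 (n := n))).
have mf n : measurable_fun setT (f n) by exact: measurable_block.
have F0 := limit_weight_ge0; have mF := measurable_limit_weight.
have mD : measurable (D : set RR) by exact: measurable_itv.
pose I (g : R -> R) := (\int[mu]_(x in D) \int[mu]_(y in D) (kern (g x) (g y))%:E)%E.
pose d n := (\int[mu]_(x in D) \int[mu]_(y in D)
   (kern_dist (f n) limit_weight (x, y))%:E)%E.
have I0 (g : R -> R) : (forall x, 0 <= g x) -> (0 <= I g)%E.
  by move=> g0; apply: integral_ge0 => x _; apply: integral_ge0 => y _;
    rewrite lee_fin kern_ge0.
have triangle (g h : R -> R) n : (forall x, 0 <= g x) -> (forall x, 0 <= h x) ->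
    measurable_fun setT g -> measurable_fun setT h ->
    (forall z, kern (g z.1) (g z.2) <= kern (h z.1) (h z.2) +
       kern_dist (f n) limit_weight z) -> (I g <= I h + d n)%E.
  move=> g0 h0 mg mh gh.
  have mkg : measurable_fun setT (fun z : RR * RR => (kern (g z.1) (g z.2))%:E).
    by apply/measurable_EFinP; exact: measurable_kern_fun.
  have mkh : measurable_fun setT (fun z : RR * RR => (kern (h z.1) (h z.2))%:E).
    by apply/measurable_EFinP; exact: measurable_kern_fun.
  have mkd := measurable_kern_dist (f0 n) F0 (mf n) mF.
  have kd0 z : (0 <= (kern_dist (f n) limit_weight z)%:E)%E.
    by rewrite lee_fin kern_dist_ge0.
  have kg0 (z : RR * RR) : (0 <= (kern (g z.1) (g z.2))%:E)%E by rewrite lee_fin kern_ge0.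
  have kh0 (z : RR * RR) : (0 <= (kern (h z.1) (h z.2))%:E)%E by rewrite lee_fin kern_ge0.
  apply: (iterated_integral_le_add mD mD mkg mkh mkd kg0 kh0 kd0) => z.
  by rewrite -EFinD lee_fin.
have I1 : (I (f n) @[n --> \oo] --> 1)%E by exact: integral_step_kern_cvg.
have d0 : (d n @[n --> \oo] --> 0)%E by exact: sorted_kern_cvg.
apply/eqP; rewrite eq_le; apply/andP; split.
  have cv : (I (f n) + d n @[n --> \oo] --> 1 + 0)%E by apply: cvgeD.
  rewrite -[leRHS]adde0 -(cvg_lim _ cv)//.
  apply: lime_ge; first by apply/cvg_ex; eexists; exact: cv.
  apply: nearW => n; apply: triangle => // z.
  by rewrite -lerBlDl (le_trans (ler_norm _))// /kern_dist distrC.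
have cv : (I limit_weight + d n @[n --> \oo] --> I limit_weight + 0)%E.
  apply: cvgeD => //; last exact: cvg_cst.
  by apply: ge0_adde_def; rewrite inE// I0.
rewrite -[leRHS]adde0 -(cvg_lim _ I1)// -(cvg_lim _ cv)//.
apply: lee_lim; [by apply/cvg_ex; eexists; exact: I1|by apply/cvg_ex; eexists; exact: cv|].
apply: nearW => n; apply: triangle => // z.
by rewrite -lerBlDl (le_trans (ler_norm _)).
Qed.

Lemma GRG_graphonE (x y : R) : GRG_graphon rho c x y =
  if x == y then 0 else kern (limit_weight x) (limit_weight y).
Proof. by []. Qed.

Lemma L1_norm_GRG_graphon : L1_norm (GRG_graphon rho c) = 1.
Proof.
have F0 := limit_weight_ge0; have mF := measurable_limit_weight.
have mD : measurable (D : set RR) by exact: measurable_itv.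
rewrite /L1_norm /Rintegral integral_rect//; last first.
  apply/measurable_EFinP; apply: measurableT_comp => //.
  exact: (measurable_kern_offdiag F0 mF).
rewrite (eq_integral (fun x : RR => \int[mu]_(y in D)
    (kern (limit_weight x) (limit_weight y))%:E)%E).
  by rewrite integral_limit_kern.
move=> x _.
rewrite -[RHS](@integral_offdiag _ D x)//.
- apply: eq_integral => y _ /=; rewrite GRG_graphonE.
  by case: ifP => _; rewrite ?normr0// ger0_norm ?kern_ge0.
- apply/measurable_EFinP.
  exact: measurableT_comp (measurable_kern_fun F0 mF) (measurable_pair1 x).
- by move=> y; rewrite lee_fin kern_ge0.
Qed.

Lemma stretch_GRG_graphon : stretch (GRG_graphon rho c) = GRG_graphon rho c.
Proof.
by apply/funext => x; apply/funext => y; rewrite /stretch L1_norm_GRG_graphon sqrtr1 !mul1r.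
Qed.

End limit_graphon.

(** * The coupling that sorts the blocks *)

Section image_measure.
Context d1 d2 (X : measurableType d1) (Y : measurableType d2) (R : realType)
  (mu : {measure set X -> \bar R}) (phi : X -> Y).
Hypothesis mphi : measurable_fun setT phi.

Definition image_measure : {measure set Y -> \bar R} :=
  measure_function_pushforward__canonical__measure_function_Measure mu mphi.

Lemma image_measureE A : image_measure A = mu (phi @^-1` A).
Proof. by []. Qed.

Lemma integral_image_measure (D : set Y) (f : Y -> \bar R) :
  measurable D -> measurable_fun D f ->
  (\int[image_measure]_(y in D) f y = \int[mu]_(x in phi @^-1` D) f (phi x))%E.
Proof.
move=> mD mf; rewrite integralE [RHS]integralE; congr (_ - _)%E.
  have E := ge0_integral_pushforward mphi mu mD (measurable_funepos mf)
    (fun y _ => funepos_ge0 f y).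
  apply: (etrans E); apply: eq_integral => x _.
  by rewrite /= !unlock.
have E := ge0_integral_pushforward mphi mu mD (measurable_funeneg mf)
  (fun y _ => funeneg_ge0 f y).
apply: (etrans E); apply: eq_integral => x _.
by rewrite /= !unlock.
Qed.

End image_measure.

(** Lebesgue measure is determined by its values on bounded intervals. *)
Lemma lebesgue_measure_translate (R : realType) (t : R)
    (A : set (measurableTypeR R)) : measurable A ->
  lebesgue_measure ((fun x => x + t) @^-1` A) = lebesgue_measure A.
Proof.
have mt : measurable_fun setT (fun x : measurableTypeR R => (x + t : measurableTypeR R)).
  exact: measurable_funD.
move=> mA; apply/esym.
apply: (@lebesgue_measure_unique _ (image_measure lebesgue_measure mt)) => //.
move=> _ [[a b] _ <-]; rewrite image_measureE.
rewrite (_ : _ @^-1` _ = `]a - t, b - t]%classic); last first.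
  by apply/seteqP; split => x; rewrite /= !in_itv/= ltrBlDr lerBrDr.
rewrite lebesgue_measure_itv [RHS]lebesgue_measure_itv/= !lte_fin ltrD2r -!EFinD.
by case: ifP => // _; congr EFin; lra.
Qed.

Section block_permutation.
Context (R : realType) (s : R) (n : nat) (sg : 'I_n -> 'I_n).
Local Notation mu := (@lebesgue_measure R).
Local Notation RR := (measurableTypeR R).
Hypothesis s_gt0 : 0 < s.
Hypothesis sg_inj : injective sg.

Lemma lebesgue_block_decomposition (A : set RR) : measurable A ->
  A `<=` nneg_reals R ->
  (mu A = \sum_(i < n) mu (A `&` block_itv s i) +
    mu (A `&` `[(n%:R * s)%R, +oo[%classic))%E.
Proof.
move=> mA A0; elim: n => [|m ih].
  rewrite big_ord0 add0e mul0r; congr (mu _); apply/esym/setIidPl.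
  exact: A0.
rewrite ih big_ord_recr/= -addeA; congr (_ + _)%E.
rewrite -measureU//.
- congr (mu _); rewrite -setIUr; congr (_ `&` _).
  apply/seteqP; split=> [x|x [|]]; rewrite /block_itv/= !in_itv/= ?andbT.
  + by move=> mx; case: (ltP x (m.+1%:R * s)) => xm; [left; rewrite mx|right].
  + by move=> /andP[].
  + by apply: le_trans; rewrite ler_wpM2r ?(ltW s_gt0)// ler_nat.
- by apply: measurableI => //; exact: measurable_itv.
- by apply: measurableI => //; exact: measurable_itv.
- apply/seteqP; split => // x [[_ +] [_]].
  rewrite /block_itv/= !in_itv/= andbT => /andP[_ xm] mx.
  by move: xm; rewrite ltNge mx.
Qed.

(** Translates the [i]-th block onto the block [sg i], and fixes the other points. *)
Definition block_perm (x : R) : R :=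
  x + \sum_(i < n) ((sg i)%:R - i%:R) * s * \1_(block_itv s i) x.

Lemma block_permE (i : 'I_n) x : block_itv s i x ->
  block_perm x = x + ((sg i)%:R - i%:R) * s.
Proof.
move=> xi; rewrite /block_perm (bigD1 i)//= big1.
  by rewrite addr0 indicE mem_set ?mulr1.
move=> k ki; rewrite indicE memNset ?mulr0// => /(block_itvP _ _ s_gt0)[_ xk].
move: xi ki => /(block_itvP _ _ s_gt0)[_ xi].
by rewrite -val_eqE/= -xk xi eqxx.
Qed.

Lemma block_perm_out x : 0 <= x -> (n <= block s x)%N -> block_perm x = x.
Proof.
move=> x0 nx; rewrite /block_perm big1 ?addr0// => i _.
rewrite indicE memNset ?mulr0// => /(block_itvP _ _ s_gt0)[_ xi].
by move: nx; rewrite xi leqNgt ltn_ord.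
Qed.

Lemma block_itv_perm (i : 'I_n) x : block_itv s i x ->
  block_itv s (sg i) (block_perm x).
Proof.
move=> xi; rewrite (block_permE xi); move: xi.
rewrite /block_itv/= !in_itv/= -!natr1 => /andP[h1 h2].
by apply/andP; split; lra.
Qed.

Lemma block_perm_ge0 x : 0 <= x -> 0 <= block_perm x.
Proof.
move=> x0; have [xn|nx] := ltnP (block s x) n; last by rewrite block_perm_out.
have xi : block_itv s (Ordinal xn) x by apply/(block_itvP _ _ s_gt0).
by have /(block_itvP _ _ s_gt0)[] := block_itv_perm xi.
Qed.

Lemma indic_block_perm (i : 'I_n) x : 0 <= x ->
  \1_(block_itv s (sg i)) (block_perm x) = \1_(block_itv s i) x :> R.
Proof.
move=> x0; rewrite !indicE; congr (nat_of_bool _)%:R.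
have [xn|nx] := ltnP (block s x) n.
  have xk : block_itv s (Ordinal xn) x by apply/(block_itvP _ _ s_gt0).
  apply/idP/idP => /set_mem xi; apply/mem_set; last exact: block_itv_perm.
  have /(block_itvP _ _ s_gt0)[_ E] := block_itv_perm xk.
  by move: xi => /(block_itvP _ _ s_gt0)[_]; rewrite E => /val_inj/sg_inj <-.
rewrite block_perm_out//; apply/idP/idP => /set_mem.
  by move=> /(block_itvP _ _ s_gt0)[_ xi]; move: nx; rewrite xi leqNgt ltn_ord.
by move=> /(block_itvP _ _ s_gt0)[_ xi]; move: nx; rewrite xi leqNgt ltn_ord.
Qed.

Lemma measurable_block_perm : measurable_fun setT (block_perm : RR -> RR).
Proof.
apply: measurable_funD => //; apply: measurable_sum => i.
by apply: measurable_funM => //; apply: measurable_indic; exact: measurable_itv.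
Qed.

(** On each block the map is a translation, and the images of the first [n] blocks
are the same blocks in another order. *)
Lemma block_perm_preserves (A : set RR) : measurable A -> A `<=` nneg_reals R ->
  mu (block_perm @^-1` A `&` nneg_reals R) = mu A.
Proof.
move=> mA A0.
have mD : measurable (nneg_reals R : set RR) by exact: measurable_itv.
have mP : measurable (block_perm @^-1` A : set RR).
  by rewrite -[X in measurable X]setTI; exact: measurable_block_perm.
rewrite lebesgue_block_decomposition//; last exact: measurableI.
rewrite [RHS]lebesgue_block_decomposition// [in RHS](reindex_inj sg_inj).
congr (_ + _)%E.
  apply: eq_bigr => i _.
  pose t : R := ((sg i)%:R - i%:R) * s.
  rewrite -(lebesgue_measure_translate t (measurableI _ _ mA (measurable_block_itv s (sg i)))).
  congr (mu _); apply/seteqP; split => x.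
    move=> [[Ax _] xi]; move: (Ax) (block_itv_perm xi).
    by rewrite /= (block_permE xi).
  move=> [Ax /= xsg].
  have xi : block_itv s i x.
    move: xsg; rewrite /block_itv/= !in_itv/= -!natr1 /t => /andP[h1 h2].
    by apply/andP; split; lra.
  have [x0 _] := (block_itvP i x s_gt0).1 xi.
  split => //; split; last by rewrite /nneg_reals/= in_itv/= x0.
  by rewrite /= (block_permE xi).
congr (mu _); apply/seteqP; split => x.
  move=> [[Ax x0] nx]; split => //.
  move: Ax; rewrite /= block_perm_out//.
    by move: x0; rewrite /nneg_reals/= in_itv/= andbT.
  move: x0 nx; rewrite /nneg_reals/= !in_itv/= !andbT => x0 nx.
  by rewrite leqNgt block_lt// -leNgt.
move=> [Ax nx]; have x0 : 0 <= x.
  by have := A0 _ Ax; rewrite /nneg_reals/= in_itv/= andbT.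
split => //; split; last by rewrite /nneg_reals/= in_itv/= x0.
rewrite /= block_perm_out// leqNgt block_lt// -leNgt.
by move: nx; rewrite /= in_itv/= andbT.
Qed.

Lemma measurable_block_graph : measurable_fun setT (fun x : RR => (block_perm x, x) : RR * RR).
Proof.
by apply: measurable_fun_pair => //; exact: measurable_block_perm.
Qed.

(** The first coordinate lives in the graphon of the graph, with its vertices in
their given order; the second in the limit graphon, with the weights decreasing. *)
Definition block_coupling : {measure set (RR * RR) -> \bar R} :=
  image_measure mu measurable_block_graph.

Lemma block_coupling_lebesgue : lebesgue_coupling block_coupling.
Proof.
move=> A mA A0; split; rewrite /block_coupling image_measureE.
  rewrite -[RHS]block_perm_preserves//; congr (mu _).
have -> : (fun x : RR => (block_perm x, x)) @^-1` (nneg_reals R `*` A) = A.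
  apply/seteqP; split => [x [_ /=]//|x Ax]; split => //=.
  have x0 := A0 _ Ax; move: x0; rewrite /nneg_reals/= !in_itv/= !andbT.
  exact: block_perm_ge0.
by [].
Qed.

End block_permutation.

Section bilinear.
Context (R : realType).

Lemma linear_box_le (n : nat) (s : R) (al c : 'I_n -> R) :
  (forall i, 0 <= al i <= s) ->
  \sum_i al i * c i <= s * \sum_(i in [set i | 0 < c i]%SET) c i.
Proof.
move=> als; rewrite mulr_sumr [leRHS]big_mkcond; apply: ler_sum => i _.
have /andP[a0 asl] := als i; rewrite inE; case: (ltP 0 (c i)) => ci.
  by rewrite ler_wpM2r// ltW.
by rewrite mulr_ge0_le0.
Qed.

(** A bilinear form on a cube is maximal at vertices of the cube, which are sets of
indices. Here the vertices are found directly: for fixed [al], keep the indices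
where the coefficient is positive. *)
Lemma bilinear_box_le (n : nat) (s M : R) (B : 'I_n -> 'I_n -> R)
    (al be : 'I_n -> R) :
  0 <= s -> (forall i, 0 <= al i <= s) -> (forall i, 0 <= be i <= s) ->
  (forall S T : {set 'I_n}, `|\sum_(i in S) \sum_(j in T) B i j| <= M) ->
  `|\sum_i \sum_j al i * B i j * be j| <= s ^+ 2 * M.
Proof.
have half (C : 'I_n -> 'I_n -> R) : 0 <= s -> (forall i, 0 <= al i <= s) ->
    (forall i, 0 <= be i <= s) ->
    (forall S T : {set 'I_n}, \sum_(i in S) \sum_(j in T) C i j <= M) ->
    \sum_i \sum_j al i * C i j * be j <= s ^+ 2 * M.
  move=> s0 als bes CM.
  under eq_bigr do under eq_bigr do rewrite -mulrA.
  under eq_bigr do rewrite -mulr_sumr.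
  apply: (le_trans (linear_box_le _ als)); rewrite expr2 -mulrA ler_wpM2l//.
  set S := [set i | _]%SET; rewrite exchange_big/=.
  under eq_bigr do rewrite -mulr_suml mulrC.
  apply: (le_trans (linear_box_le _ bes)); rewrite ler_wpM2l//.
  by rewrite exchange_big/=.
move=> s0 als bes BM; rewrite ler_norml; apply/andP; split; last first.
  by apply: half => // S T; exact: le_trans (ler_norm _) (BM S T).
rewrite lerNl; have -> : - (\sum_i \sum_j al i * B i j * be j) =
    \sum_i \sum_j al i * (- B i j) * be j.
  rewrite -sumrN; apply: eq_bigr => i _; rewrite -sumrN; apply: eq_bigr => j _.
  by rewrite mulrN mulNr.
apply: half => // S T; apply: le_trans (BM S T); rewrite -normrN.
apply: le_trans (ler_norm _); rewrite le_eqVlt; apply/orP; left; apply/eqP.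
by rewrite -sumrN; apply: eq_bigr => i _; rewrite -sumrN.
Qed.

End bilinear.

(** * Step graphons *)

Section step_graphon.
Context (R : realType) (n : nat) (s : R).
Local Notation mu := (@lebesgue_measure R).
Local Notation RR := (measurableTypeR R).

(** The matrix [a] spread over blocks of width [s]. Sums of products of indicators
rather than a lookup of the block index: measurability and integrals are then
linear in [a], and the function vanishes outside of the blocks. *)
Definition step_graphon (a : 'I_n -> 'I_n -> R) (x y : R) : R :=
  \sum_i \sum_j a i j * (\1_(block_itv s i) x * \1_(block_itv s j) y).

Lemma step_graphon_ge0 a x y : (forall i j, 0 <= a i j) -> 0 <= step_graphon a x y.
Proof.
by move=> a0; apply: sumr_ge0 => i _; apply: sumr_ge0 => j _; rewrite !mulr_ge0.
Qed.

Lemma measurable_step_graphon a :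
  measurable_fun setT (fun z : RR * RR => step_graphon a z.1 z.2).
Proof.
apply: measurable_sum => i; apply: measurable_sum => j.
apply: measurable_funM => //; apply: measurable_funM.
  apply: (measurable_funX_fst (f := \1_(block_itv s i))).
  by apply: measurable_indic; exact: measurable_block_itv.
apply: (measurable_funX_snd (f := \1_(block_itv s j))).
by apply: measurable_indic; exact: measurable_block_itv.
Qed.

Definition block_mass (A : set RR) (i : nat) : R := fine (mu (A `&` block_itv s i)).

Hypothesis s_gt0 : 0 < s.

Lemma block_mass_bounds A i : measurable A -> 0 <= block_mass A i <= s.
Proof.
move=> mA; rewrite fine_ge0//= -lee_fin.
have h : (mu (A `&` block_itv s i) <= s%:E)%E.
  rewrite -(lebesgue_block i s_gt0); apply: le_measure => //.
  - by rewrite inE; apply: measurableI => //; exact: measurable_block_itv.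
  - by rewrite inE; exact: measurable_block_itv.
rewrite fineK// ge0_fin_numE//; exact: le_lt_trans h (ltry _).
Qed.

Lemma block_massE (A : set RR) i : measurable A ->
  (\int[mu]_(x in A) (\1_(block_itv s i) x)%:E = (block_mass A i)%:E)%E.
Proof.
move=> mA; rewrite integral_indic; [|exact: mA|exact: measurable_block_itv].
rewrite setIC /block_mass fineK// ge0_fin_numE//.
apply: (@le_lt_trans _ _ s%:E); last exact: ltry.
rewrite -(lebesgue_block i s_gt0); apply: le_measure => //.
- by rewrite inE; apply: measurableI => //; exact: measurable_block_itv.
- by rewrite inE; exact: measurable_block_itv.
Qed.

Lemma integral_step_graphon_snd a (x : R) (B : set RR) :
  (forall i j, 0 <= a i j) -> measurable B ->
  (\int[mu]_(y in B) (step_graphon a x y)%:E =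
   (\sum_i (\sum_j a i j * block_mass B j) * \1_(block_itv s i) x)%:E)%E.
Proof.
move=> a0 mB.
have mJ i : measurable_fun B (fun x : RR => (\1_(block_itv s i) x)%:E : \bar R).
  by apply/measurable_EFinP; apply: measurable_indic; exact: measurable_block_itv.
rewrite (eq_integral (fun y => \sum_i \sum_j
    ((a i j * \1_(block_itv s i) x)%:E * (\1_(block_itv s j) y)%:E))%E); last first.
  move=> y _; rewrite /step_graphon -sumEFin; apply: eq_bigr => i _.
  by rewrite -sumEFin; apply: eq_bigr => j _; rewrite mulrA EFinM.
have mt i j : measurable_fun B (fun y : RR =>
    ((a i j * \1_(block_itv s i) x)%:E * (\1_(block_itv s j) y)%:E)%E).
  exact: measurable_funeM.
have t0 i j (y : RR) : (0 <=
    (a i j * \1_(block_itv s i) x)%:E * (\1_(block_itv s j) y)%:E)%E.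
  by rewrite -EFinM lee_fin !mulr_ge0.
rewrite ge0_integral_sum//; last 2 first.
- by move=> i; apply: emeasurable_sum => j; exact: mt.
- by move=> i y _; apply: sume_ge0 => j _; exact: t0.
rewrite -sumEFin; apply: eq_bigr => i _.
rewrite ge0_integral_sum// mulr_suml -sumEFin; apply: eq_bigr => j _.
rewrite ge0_integralZl_EFin//; last by rewrite mulr_ge0.
by rewrite block_massE// -EFinM mulrAC.
Qed.

Lemma integral_step_graphon a (A B : set RR) :
  (forall i j, 0 <= a i j) -> measurable A -> measurable B ->
  (\int[mu]_(x in A) \int[mu]_(y in B) (step_graphon a x y)%:E =
   (\sum_(i < n) \sum_(j < n) block_mass A i * a i j * block_mass B j)%:E)%E.
Proof.
move=> a0 mA mB.
have b0 i : 0 <= \sum_j a i j * block_mass B j.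
  apply: sumr_ge0 => j _; rewrite mulr_ge0//.
  by have /andP[] := block_mass_bounds j mB.
have mJ i : measurable_fun A (fun x : RR => (\1_(block_itv s i) x)%:E : \bar R).
  by apply/measurable_EFinP; apply: measurable_indic; exact: measurable_block_itv.
rewrite (eq_integral (fun x => \sum_i
    ((\sum_j a i j * block_mass B j)%:E * (\1_(block_itv s i) x)%:E))%E); last first.
  move=> x _; rewrite integral_step_graphon_snd// -sumEFin.
  by apply: eq_bigr => i _; rewrite EFinM.
rewrite ge0_integral_sum//; last 2 first.
- by move=> i; exact: measurable_funeM.
- by move=> i x _; rewrite -EFinM lee_fin mulr_ge0.
rewrite -sumEFin; apply: eq_bigr => i _.
rewrite ge0_integralZl_EFin//.
rewrite block_massE// -EFinM mulr_suml; congr EFin; apply: eq_bigr => j _.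
by rewrite mulrC mulrA.
Qed.

Lemma step_graphonE (a : 'I_n -> 'I_n -> R) (v : nat -> R) x y : 0 <= x -> 0 <= y ->
  (forall i, (n <= i)%N -> v i = 0) ->
  (forall i j, a i j = kern (v i) (v j)) ->
  step_graphon a x y = kern (v (block s x)) (v (block s y)).
Proof.
move=> x0 y0 vn aE.
have E z (i : nat) : 0 <= z -> \1_(block_itv s i) z = (block s z == i)%:R :> R.
  move=> z0; rewrite indicE; congr (nat_of_bool _)%:R.
  by apply/idP/eqP; rewrite inE block_itvP// => -[].
have k0 u : kern u 0 = 0 :> R by rewrite /kern/saturation mulr0 mul0r.
have k0' u : kern 0 u = 0 :> R by rewrite /kern/saturation mul0r mul0r.
have collapse (h : nat -> R) z : 0 <= z -> (forall i, (n <= i)%N -> h i = 0) ->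
    \sum_(i < n) h i * \1_(block_itv s i) z = h (block s z).
  move=> z0 hn; have [bn|nb] := ltnP (block s z) n.
    rewrite (bigD1 (Ordinal bn))//= E// eqxx mulr1 big1 ?addr0// => i ib.
    rewrite E// (_ : _ == _ = false) ?mulr0//.
    by apply: contraNF ib => /eqP bi; apply/eqP/val_inj.
  rewrite hn// big1// => i _; rewrite E// (_ : _ == _ = false) ?mulr0//.
  by apply: contraTF nb => /eqP ->; rewrite -ltnNge.
transitivity (\sum_(i < n) kern (v i) (v (block s y)) * \1_(block_itv s i) x).
  apply: eq_bigr => i _.
  rewrite -(collapse (fun j => kern (v i) (v j)) y y0); last first.
    by move=> j /vn ->; exact: k0.
  by rewrite mulr_suml; apply: eq_bigr => j _; rewrite aE mulrA mulrAC.
by rewrite (collapse (fun i => kern (v i) (v (block s y))))// => i /vn ->; exact: k0'.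
Qed.

Lemma step_graphon_perm (sg : 'I_n -> 'I_n) a x y : injective sg ->
  0 <= x -> 0 <= y ->
  step_graphon a (block_perm s sg x) (block_perm s sg y) =
  step_graphon (fun i j => a (sg i) (sg j)) x y.
Proof.
move=> sg_inj x0 y0; rewrite /step_graphon (reindex_inj sg_inj).
apply: eq_bigr => i _; rewrite (reindex_inj sg_inj); apply: eq_bigr => j _.
by rewrite !indic_block_perm.
Qed.

(** Each block has area [s ^ 2]. *)
Lemma L1_norm_step_graphon a : (forall i j, 0 <= a i j) ->
  L1_norm (step_graphon a) = s ^+ 2 * \sum_i \sum_j a i j.
Proof.
move=> a0; have mD : measurable (nneg_reals R : set RR) by exact: measurable_itv.
rewrite /L1_norm /Rintegral integral_rect//; last first.
  apply/measurable_EFinP; apply: measurableT_comp => //.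
  exact: measurable_step_graphon.
under eq_integral do under eq_integral do rewrite ger0_norm ?step_graphon_ge0//.
rewrite integral_step_graphon//=.
have DE i : block_mass (nneg_reals R) i = s.
  rewrite /block_mass setIidr ?lebesgue_block//.
  by move=> x /(block_itvP _ _ s_gt0)[x0 _]; rewrite /nneg_reals/= in_itv/= x0.
rewrite mulr_sumr; apply: eq_bigr => i _; rewrite mulr_sumr; apply: eq_bigr => j _.
by rewrite !DE; lra.
Qed.

End step_graphon.

Lemma step_graphon_scale (R : realType) n (s q : R) (a : 'I_n -> 'I_n -> R) x y :
  0 < q -> step_graphon s a (q * x) (q * y) = step_graphon (s / q) a x y.
Proof.
move=> q0; have E (i : nat) (z : R) :
    \1_(block_itv s i) (q * z) = \1_(block_itv (s / q) i) z :> R.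
  rewrite !indicE; congr (nat_of_bool _)%:R.
  have h : block_itv s i (q * z) = block_itv (s / q) i z.
    rewrite /block_itv/= !in_itv/= !mulrA ler_pdivrMr// ltr_pdivlMr//.
    by rewrite (mulrC q).
  by apply/idP/idP => /set_mem; rewrite ?h => ?; apply/mem_set; rewrite ?h.
by apply: eq_bigr => i _; apply: eq_bigr => j _; rewrite !E.
Qed.

Lemma canonical_graphonE (R : realType) n (g : rel 'I_n) : (0 < n)%N ->
  canonical_graphon g = step_graphon (n%:R^-1 : R) (fun i j => (g i j)%:R).
Proof.
move=> n0; apply/funext => x; apply/funext => y.
have s0 : 0 < n%:R^-1 :> R by rewrite invr_gt0 ltr0n.
have J_inj (i j : 'I_n) z : block_itv (n%:R^-1 : R) i z -> block_itv n%:R^-1 j z -> i = j.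
  move=> /(block_itvP _ _ s0)[_ zi] /(block_itvP _ _ s0)[_ zj].
  by apply: val_inj; rewrite /= -zi -zj.
rewrite /canonical_graphon; case: existsP => [[i /existsP[j /and3P[gij xi yj]]]|nex].
  rewrite /step_graphon (bigD1 i)//= (bigD1 j)//= gij !indicE.
  rewrite !mem_set//=  !mulr1 big1 ?addr0; last first.
    move=> k kj; rewrite indicE memNset ?mulr0// => yk.
    by move: kj; rewrite (J_inj k j y)// eqxx.
  rewrite big1 ?addr0// => k ki; rewrite big1// => l _.
  rewrite indicE memNset ?mul0r ?mulr0// => xk.
  by move: ki; rewrite (J_inj k i x)// eqxx.
rewrite /step_graphon big1// => i _; rewrite big1// => j _.
case gij : (g i j); last by rewrite mul0r.
rewrite !indicE; case: (boolP (x \in _)) => xi; last by rewrite mul0r mulr0.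
case: (boolP (y \in _)) => yj; last by rewrite !mulr0.
exfalso; apply: nex; exists i; apply/existsP; exists j; rewrite gij /=.
by move: xi yj => /set_mem xi /set_mem yj; apply/andP; split.
Qed.

(** Blocks of width [1 / n] are stretched by the inverse of the square root of the
norm [E / n ^ 2], so their width becomes [1 / sqrt E]. *)
Lemma stretch_canonical_graphon (R : realType) n (g : rel 'I_n) :
  let E : R := \sum_i \sum_j (g i j)%:R in
  0 < E -> (0 < n)%N ->
  stretch (canonical_graphon g) = step_graphon (Num.sqrt E)^-1 (fun i j => (g i j)%:R).
Proof.
move=> E E0 n0; apply/funext => x; apply/funext => y; rewrite /stretch.
rewrite canonical_graphonE// L1_norm_step_graphon ?invr_gt0 ?ltr0n// -/E.
have n1 : 0 < n%:R^-1 :> R by rewrite invr_gt0 ltr0n.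
rewrite sqrtrM ?exprn_ge0 ?ltW// sqrtr_sqr gtr0_norm//.
rewrite step_graphon_scale; last by rewrite mulr_gt0// sqrtr_gt0.
by rewrite invfM mulrA mulfV ?mul1r// gt_eqF.
Qed.

(** * Cut norm of the coupling *)

Section cut_norm.
Context (R : realType) (n : nat) (s : R) (sg : 'I_n -> 'I_n)
  (a : 'I_n -> 'I_n -> R) (v : nat -> R) (F : R -> R).
Local Notation mu := (@lebesgue_measure R).
Local Notation RR := (measurableTypeR R).
Local Notation D := (nneg_reals R).
Hypothesis s_gt0 : 0 < s.
Hypothesis sg_inj : injective sg.
Hypothesis a_ge0 : forall i j, 0 <= a i j.
Hypothesis v_ge0 : forall i, 0 <= v i.
Hypothesis v_eq0 : forall i, (n <= i)%N -> v i = 0.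
Hypothesis F_ge0 : forall x, 0 <= F x.
Hypothesis mF : measurable_fun setT F.
Hypothesis F_fin : (\int[mu]_(x in D) (F x)%:E < +oo)%E.
Hypothesis kF_fin : (\int[mu]_(x in D) \int[mu]_(y in D) (kern (F x) (F y))%:E < +oo)%E.

Let W2 (x y : R) : R := if x == y then 0 else kern (F x) (F y).
Let f (x : R) : R := v (block s x).
Let gamma := block_coupling s sg.
Let phi (x : RR) : RR * RR := (block_perm s sg x, x).

Let D_measurable : measurable (D : set RR). Proof. exact: measurable_itv. Qed.

Let kern_slice (B : set RR) x : measurable B ->
  measurable_fun B (fun y : RR => (kern (F x) (F y))%:E).
Proof.
move=> mB; apply/measurable_EFinP; apply: measurable_funTS.
exact: measurableT_comp (measurable_kern_fun F_ge0 mF) (measurable_pair1 x).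
Qed.

Let inner_fin (B : set RR) x : measurable B -> B `<=` D ->
  (\int[mu]_(y in B) (kern (F x) (F y))%:E < +oo)%E.
Proof.
move=> mB BD; apply: (@le_lt_trans _ _ (\int[mu]_(y in D) ((F x)%:E * (F y)%:E))%E).
  apply: (@le_trans _ _ (\int[mu]_(y in D) (kern (F x) (F y))%:E)%E).
    apply: ge0_subset_integral => //; first exact: kern_slice.
    by move=> y _; rewrite lee_fin kern_ge0.
  apply: ge0_le_integral => //.
  - by move=> y _; rewrite lee_fin kern_ge0.
  - exact: kern_slice.
  - by apply: measurable_funeM; apply/measurable_EFinP; exact: measurable_funTS mF.
  - by move=> y _; rewrite -EFinM lee_fin kern_leM.
rewrite ge0_integralZl_EFin//.
- by apply: lte_mul_pinfty => //; rewrite lee_fin.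
- by move=> y _; rewrite lee_fin.
- by apply/measurable_EFinP; exact: measurable_funTS mF.
Qed.

Let sub_le (h : RR * RR -> R) (A B : set RR) :
  measurable_fun setT h -> (forall z, 0 <= h z) ->
  measurable A -> measurable B -> A `<=` D -> B `<=` D ->
  (\int[mu]_(x in A) \int[mu]_(y in B) (h (x, y))%:E <=
   \int[mu]_(x in D) \int[mu]_(y in D) (h (x, y))%:E)%E.
Proof.
move=> mh h0 mA mB AD BD.
have h0' z : (0 <= (EFin \o h) z)%E by rewrite lee_fin.
have mh' : measurable_fun setT (EFin \o h) by exact/measurable_EFinP.
have mi (C : set RR) : measurable C ->
    measurable_fun setT (fun x : RR => \int[mu]_(y in C) (h (x, y))%:E)%E.
  by move=> mC; exact: (measurable_inner_integral mC mh').
apply: (@le_trans _ _ (\int[mu]_(x in A) \int[mu]_(y in D) (h (x, y))%:E)%E).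
  apply: ge0_le_integral => //.
  - by move=> x _; apply: integral_ge0 => y _; rewrite lee_fin.
  - exact: measurable_funTS (mi _ mB).
  - exact: measurable_funTS (mi _ D_measurable).
  - move=> x _; apply: ge0_subset_integral => //.
      by apply: measurable_funTS; exact: measurableT_comp mh' (measurable_pair1 x).
    by move=> y _; rewrite lee_fin.
apply: ge0_subset_integral => //; first exact: measurable_funTS (mi _ D_measurable).
by move=> x _; apply: integral_ge0 => y _; rewrite lee_fin.
Qed.

Let sub_fin (A B : set RR) : measurable A -> measurable B -> A `<=` D -> B `<=` D ->
  (\int[mu]_(x in A) \int[mu]_(y in B) (kern (F x) (F y))%:E < +oo)%E.
Proof.
move=> mA mB AD BD; apply: le_lt_trans kF_fin.
apply: (sub_le (h := fun z => kern (F z.1) (F z.2))) => //.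
  exact: measurable_kern_fun.
by move=> z; exact: kern_ge0.
Qed.

(** Both terms are pulled back to Lebesgue measure and separated. The diagonal, where
[W2] vanishes by convention, is negligible. Integrability of the second term
over each vertical line comes from [F_fin], that of its integral from
[kF_fin]. *)
Lemma coupling_integral (U V : set (RR * RR)) : measurable U -> measurable V ->
  U `<=` D `*` D -> V `<=` D `*` D ->
  (\int[gamma]_(p in U) \int[gamma]_(q in V)
     (step_graphon s a p.1 q.1 - W2 p.2 q.2)%:E =
   \int[mu]_(x in phi @^-1` U) \int[mu]_(y in phi @^-1` V)
     (step_graphon s (fun i j => a (sg i) (sg j)) x y)%:E -
   \int[mu]_(x in phi @^-1` U) \int[mu]_(y in phi @^-1` V) (kern (F x) (F y))%:E)%E.
Proof.
move=> mU mV UD VD; have mphi := measurable_block_graph s sg.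
have mpre A : measurable A -> measurable (phi @^-1` A : set RR).
  by move=> mA; rewrite -[X in measurable X]setTI; exact: mphi.
set U' := phi @^-1` U; set V' := phi @^-1` V.
have mU' : measurable U' by exact: mpre.
have mV' : measurable V' by exact: mpre.
have pre0 A x : A `<=` D `*` D -> (phi @^-1` A) x -> 0 <= x.
  by move=> AD /AD[_]; rewrite /nneg_reals/= in_itv/= andbT.
have U'D : U' `<=` D by move=> x /(pre0 _ _ UD) x0; rewrite /nneg_reals/= in_itv/= x0.
have V'D : V' `<=` D by move=> x /(pre0 _ _ VD) x0; rewrite /nneg_reals/= in_itv/= x0.
have mW2 : measurable_fun setT (fun z : RR * RR => W2 z.1 z.2).
  exact: measurable_kern_offdiag.
have inner p : (\int[gamma]_(q in V) (step_graphon s a p.1 q.1 - W2 p.2 q.2)%:E =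
    \int[mu]_(y in V') (step_graphon s a p.1 (block_perm s sg y) - W2 p.2 y)%:E)%E.
  rewrite /gamma /block_coupling integral_image_measure//.
  apply/measurable_EFinP; apply: measurable_funTS; apply: measurable_funB.
    apply: (measurable_funX_fst (f := fun y => step_graphon s a p.1 y)).
    exact: measurableT_comp (measurable_step_graphon s a) (measurable_pair1 p.1).
  apply: (measurable_funX_snd (f := fun y => W2 p.2 y)).
  exact: measurableT_comp mW2 (measurable_pair1 p.2).
have mH : measurable_fun setT (fun p : RR * RR =>
   \int[mu]_(y in V') (step_graphon s a p.1 (block_perm s sg y) - W2 p.2 y)%:E)%E.
  pose g (z : (RR * RR) * RR) : \bar R :=
    (step_graphon s a z.1.1 (block_perm s sg z.2) - W2 z.1.2 z.2)%:E.
  have mg : measurable_fun setT g.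
    apply/measurable_EFinP; apply: measurable_funB.
      apply: (measurableT_comp (measurable_step_graphon s a)
        (g := fun z : (RR * RR) * RR => (z.1.1, block_perm s sg z.2))).
      apply: measurable_fun_pair.
        exact: measurableT_comp measurable_fst measurable_fst.
      exact: measurableT_comp (measurable_block_perm s sg) measurable_snd.
    apply: (measurableT_comp mW2 (g := fun z : (RR * RR) * RR => (z.1.2, z.2))).
    apply: measurable_fun_pair => //.
    exact: measurableT_comp measurable_snd measurable_fst.
  rewrite (_ : (fun p => _) = (fun p => \int[mu]_(y in V') g^\+ (p, y) -
      \int[mu]_(y in V') g^\- (p, y))%E); last first.
    apply/funext => p; rewrite integralE.
    by congr (_ - _)%E; apply: eq_integral => y _; rewrite ?funeposE ?funenegE.
  apply: emeasurable_funB.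
    by apply: measurable_inner_integral => //; exact: measurable_funepos.
  by apply: measurable_inner_integral => //; exact: measurable_funeneg.
under eq_integral do rewrite inner.
rewrite /gamma /block_coupling integral_image_measure//; last exact: measurable_funTS mH.
rewrite -/U' /=.
pose a' i j := a (sg i) (sg j).
have a'0 i j : 0 <= a' i j by exact: a_ge0.
have mst := measurable_step_graphon s a'.
have mk := measurable_kern_fun F_ge0 mF.
have k0 x y : 0 <= kern (F x) (F y) by exact: kern_ge0.
have st0 x y : 0 <= step_graphon s a' x y by exact: step_graphon_ge0.
have iV1 x : mu.-integrable V' (EFin \o step_graphon s a' x).
  apply/integrableP; split.
    apply/measurable_EFinP; apply: measurable_funTS.
    exact: measurableT_comp mst (measurable_pair1 x).
  under eq_integral do rewrite /= ger0_norm//.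
  by rewrite integral_step_graphon_snd// ltry.
have mW2x x : measurable_fun setT (fun y : RR => W2 x y).
  exact: measurableT_comp mW2 (measurable_pair1 x).
have W2E x : (\int[mu]_(y in V') (W2 x y)%:E =
    \int[mu]_(y in V') (kern (F x) (F y))%:E)%E.
  rewrite -[RHS](@integral_offdiag _ V' x)//.
  - by apply: eq_integral => y _; rewrite /W2; case: ifP.
  - apply/measurable_EFinP; exact: measurableT_comp mk (measurable_pair1 x).
  - by move=> y; rewrite lee_fin.
have iV2 x : mu.-integrable V' (EFin \o W2 x).
  apply/integrableP; split; first by apply/measurable_EFinP; exact: measurable_funTS.
  rewrite (eq_integral (fun y : RR => (W2 x y)%:E)); last first.
    by move=> y _ /=; rewrite ger0_norm// /W2; case: ifP.
  by rewrite W2E; exact: inner_fin.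
have split_inner x : U' x -> (\int[mu]_(y in V')
     (step_graphon s a (block_perm s sg x) (block_perm s sg y) - W2 x y)%:E =
   \int[mu]_(y in V') (step_graphon s a' x y)%:E -
   \int[mu]_(y in V') (kern (F x) (F y))%:E)%E.
  move=> /(pre0 _ _ UD) x0; rewrite -W2E -integralB_EFin//.
  apply: eq_integral => y /set_mem/(pre0 _ _ VD) y0.
  by rewrite step_graphon_perm// EFinB.
transitivity (\int[mu]_(x in U') (\int[mu]_(y in V') (step_graphon s a' x y)%:E -
   \int[mu]_(y in V') (kern (F x) (F y))%:E))%E.
  by apply: eq_integral => x /set_mem; exact: split_inner.
have ge0I (B : set RR) h : (forall y, 0 <= h y) -> (0 <= \int[mu]_(y in B) (h y)%:E)%E.
  by move=> h0; apply: integral_ge0 => y _; rewrite lee_fin.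
have minst := measurable_inner_integral mV' ((measurable_EFinP _ _).2 mst).
have mink := measurable_inner_integral mV' ((measurable_EFinP _ _).2 mk).
rewrite integralB//.
- apply/integrableP; split.
    by apply: measurable_funTS; apply: minst => z; rewrite lee_fin.
  under eq_integral do rewrite gee0_abs ?ge0I//.
  by rewrite integral_step_graphon// ltry.
- apply/integrableP; split.
    by apply: measurable_funTS; apply: mink => z; rewrite lee_fin.
  under eq_integral do rewrite gee0_abs ?ge0I//.
  exact: sub_fin.
Qed.

(** The kernel of the step function [f] is inserted between the two graphons. The
graph and [k(f, f)] are both step graphons, and their difference is a bilinear
form in the traces of the test sets on the blocks ([bilinear_box_le]); the
difference of [k(f, f)] and [k(F, F)] is bounded in [L^1]. *)
Lemma coupling_cut_norm_le (M : R) :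
  (forall S T : {set 'I_n},
    `|\sum_(i in S) \sum_(j in T) (a (sg i) (sg j) - kern (v i) (v j))| <= M) ->
  (coupling_cut_norm gamma (step_graphon s a) W2 <=
    (s ^+ 2 * M)%:E +
    \int[mu]_(x in D) \int[mu]_(y in D) (kern_dist f F (x, y))%:E)%E.
Proof.
move=> BM; apply: ge_ereal_sup => _ [U [V [mU mV UD VD ->]]].
rewrite coupling_integral//.
have mphi := measurable_block_graph s sg.
have mpre A : measurable A -> measurable (phi @^-1` A : set RR).
  by move=> mA; rewrite -[X in measurable X]setTI; exact: mphi.
set U' := phi @^-1` U; set V' := phi @^-1` V.
have mU' : measurable U' by exact: mpre.
have mV' : measurable V' by exact: mpre.
have U'D : U' `<=` D by move=> x /UD[].
have V'D : V' `<=` D by move=> x /VD[].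
have mf : measurable_fun setT f by exact: measurable_block.
have f0 x : 0 <= f x by exact: v_ge0.
have mkd := measurable_kern_dist f0 F_ge0 mf mF.
have mkf := measurable_kern_fun f0 mf.
have mkF := measurable_kern_fun F_ge0 mF.
set I := (\int[mu]_(x in D) \int[mu]_(y in D) _)%E.
have KI : (\int[mu]_(x in U') \int[mu]_(y in V') (kern_dist f F (x, y))%:E <= I)%E.
  apply: sub_le => //; first exact/measurable_EFinP.
  exact: kern_dist_ge0.
have X3E : (\int[mu]_(x in U') \int[mu]_(y in V') (kern (f x) (f y))%:E =
    (\sum_(i < n) \sum_(j < n) block_mass s U' i * kern (v i) (v j) *
       block_mass s V' j)%:E)%E.
  have kv0 (i j : 'I_n) : 0 <= kern (v i) (v j) by exact: kern_ge0.
  rewrite -(integral_step_graphon s_gt0 kv0 mU' mV').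
  apply: eq_integral => x /set_mem/U'D; rewrite /nneg_reals/= in_itv/= andbT => x0.
  apply: eq_integral => y /set_mem/V'D; rewrite /nneg_reals/= in_itv/= andbT => y0.
  by rewrite (step_graphonE s_gt0 x0 y0 v_eq0).
rewrite integral_step_graphon//.
have kd0 z : (0 <= (kern_dist f F z)%:E)%E by rewrite lee_fin kern_dist_ge0.
have kf0 (z : RR * RR) : (0 <= (kern (f z.1) (f z.2))%:E)%E.
  by rewrite lee_fin kern_ge0.
have kF0 (z : RR * RR) : (0 <= (kern (F z.1) (F z.2))%:E)%E.
  by rewrite lee_fin kern_ge0.
have mkf' := (measurable_EFinP _ _).2 mkf.
have mkF' := (measurable_EFinP _ _).2 mkF.
have X2fin := sub_fin mU' mV' U'D V'D.
have X20 : (0 <= \int[mu]_(x in U') \int[mu]_(y in V') (kern (F x) (F y))%:E)%E.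
  by apply: integral_ge0 => x _; apply: integral_ge0 => y _; exact: (kF0 (x, y)).
have fF : (\int[mu]_(x in U') \int[mu]_(y in V') (kern (f x) (f y))%:E <=
    \int[mu]_(x in U') \int[mu]_(y in V') (kern (F x) (F y))%:E + I)%E.
  apply: (le_trans (iterated_integral_le_add mU' mV' mkf' mkF' mkd kf0 kF0 kd0 _)).
    move=> z; rewrite -EFinD lee_fin -lerBlDl.
    by rewrite (le_trans (ler_norm _)).
  exact: leeD2l.
have Ff : (\int[mu]_(x in U') \int[mu]_(y in V') (kern (F x) (F y))%:E <=
    \int[mu]_(x in U') \int[mu]_(y in V') (kern (f x) (f y))%:E + I)%E.
  apply: (le_trans (iterated_integral_le_add mU' mV' mkF' mkf' mkd kF0 kf0 kd0 _)).
    move=> z; rewrite -EFinD lee_fin -lerBlDl.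
    by rewrite (le_trans (ler_norm _))// /kern_dist distrC.
  exact: leeD2l.
move: fF Ff X2fin X20; rewrite X3E.
set x3 := \sum_i _; set x1 := \sum_i _.
have I0 : (0 <= I)%E.
  by apply: integral_ge0 => x _; apply: integral_ge0 => y _; exact: (kd0 (x, y)).
have x13 : `|x1 - x3| <= s ^+ 2 * M.
  have := bilinear_box_le (ltW s_gt0) (fun i : 'I_n => block_mass_bounds s_gt0 i mU')
    (fun i : 'I_n => block_mass_bounds s_gt0 i mV') BM.
  congr (`|_| <= _); rewrite /x1 /x3 -sumrB; apply: eq_bigr => i _.
  by rewrite -sumrB; apply: eq_bigr => j _; rewrite mulrBr mulrBl.
case: (\int[mu]_(x in U') _)%E => [x2| |]//.
clear KI; clearbody I; case: I I0 => [k| |]//; last first.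
  by move=> *; rewrite addey// leey.
rewrite -!EFinD !lee_fin => I0 fF Ff _ _.
have := ler_distD x3 x1 x2.
have : `|x3 - x2| <= k by rewrite ler_norml; apply/andP; split; lra.
lra.
Qed.

End cut_norm.

(** * Almost sure convergence *)

Section weight_permutation.
Context (R : realType) (n : nat) (w : nat -> R).

Definition weight_perm (i : 'I_n) : 'I_n :=
  Ordinal (weight_order_lt w (ltn_ord i)).

Lemma weight_perm_inj : injective weight_perm.
Proof.
move=> i j /(congr1 val)/= /eqP.
by rewrite nth_uniq ?size_weight_order ?weight_order_uniq// => /eqP/val_inj.
Qed.

Hypothesis L_gt0 : 0 < total_weight n w.

Lemma edge_probE (i j : nat) :
  edge_prob n w i j = kern (scaled_weight n w i) (scaled_weight n w j).
Proof.
have q0 : 0 < Num.sqrt (total_weight n w) by rewrite sqrtr_gt0.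
have E : scaled_weight n w i * scaled_weight n w j = w i * w j / total_weight n w.
  by rewrite /scaled_weight mulrACA -invfM -expr2 sqr_sqrtr ?ltW.
rewrite /edge_prob /kern /saturation E.
have := L_gt0; set L := total_weight n w; set u := w i * w j => L0.
have -> : 1 + u / L = (L + u) / L by rewrite mulrDl mulfV ?gt_eqF.
by rewrite invf_div mulrA divfK// gt_eqF.
Qed.

(** Sums over sets of blocks are discrepancies: the sorting permutation turns sets of
ranks into sets of vertices. *)
Lemma discrepancy_weight_perm (g : rel 'I_n) (S T : {set 'I_n}) :
  \sum_(i in S) \sum_(j in T) ((g (weight_perm i) (weight_perm j))%:R -
     kern (sorted_weight n w i) (sorted_weight n w j)) =
  discrepancy w g (weight_perm @: S)%SET (weight_perm @: T)%SET.
Proof.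
rewrite /discrepancy big_imset/=; last by move=> i j _ _; exact: weight_perm_inj.
apply: eq_bigr => i _.
rewrite big_imset/=; last by move=> k j _ _; exact: weight_perm_inj.
by apply: eq_bigr => j _; rewrite edge_probE /sorted_weight !ltn_ord.
Qed.

End weight_permutation.

(** The empty test sets give the value [0] for every coupling. *)
Lemma stretched_cut_distance_ge0 (R : realType) (W1 W2 : R -> R -> R) :
  (0 <= stretched_cut_distance W1 W2)%E.
Proof.
apply: le_ereal_inf_tmp => _ [gamma _ <-].
apply: ereal_sup_ubound; exists set0, set0; split => //.
by rewrite integral_set0 abse0.
Qed.

Section pathwise_convergence.
Context (R : realType) (w : nat -> nat -> R)
  (rho : {measure set (measurableTypeR R) -> \bar R}) (c : R)
  (g : forall n : nat, rel 'I_n).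
Arguments g n _ _ : clear implicits.
Local Notation mu := (@lebesgue_measure R).
Local Notation D := (nneg_reals R).
Hypothesis w_ge0 : forall n i : nat, (i < n)%N -> 0 <= w n i.
Hypothesis L_gt0 : \forall n \near \oo, 0 < total_weight n (w n).
Hypothesis rho_cvg : vague_cvg (fun n => weight_measure n (w n)) rho.
Hypothesis small_mass : forall eta : R, 0 < eta ->
  exists2 eps : R, 0 < eps & \forall n \near \oo,
    (Num.sqrt (total_weight n (w n)))^-1 *
      \sum_(i < n | scaled_weight n (w n) i <= eps) scaled_weight n (w n) i <= eta.
Hypothesis int_c : (Num.sqrt (total_weight n (w n)))^-1 ^+ 2 *
    \sum_(i < n) \sum_(j < n)
      kern (scaled_weight n (w n) i) (scaled_weight n (w n) j)
   @[n --> \oo] --> c.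
Hypothesis c_gt0 : 0 < c.
Hypothesis small_discrepancy : forall eta : R, 0 < eta -> \forall n \near \oo,
  forall S T : {set 'I_n},
    `|discrepancy (w n) (g n) S T| <= eta * total_weight n (w n).

Definition edge_count (n : nat) : R := \sum_(i < n) \sum_(j < n) (g n i j)%:R.

(** The discrepancy of the set of all vertices with itself: the expected number of
ordered adjacent pairs is asymptotic to [c L]. *)
Lemma edge_count_cvg : edge_count n / total_weight n (w n) @[n --> \oo] --> c.
Proof.
apply/cvgrPdist_le => e e0.
have e2 : 0 < e / 2 by rewrite divr_gt0.
near=> n.
have Ln : 0 < total_weight n (w n) by near: n.
have : `|discrepancy (w n) (g n) [set: 'I_n]%SET [set: 'I_n]%SET| <=
    e / 2 * total_weight n (w n).
  by move: [set: 'I_n]%SET; near: n; have := small_discrepancy e2; apply: filterS => n hn S; exact: hn.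
have -> : discrepancy (w n) (g n) [set: 'I_n]%SET [set: 'I_n]%SET = edge_count n -
    \sum_(i < n) \sum_(j < n)
      kern (scaled_weight n (w n) i) (scaled_weight n (w n) j).
  rewrite /discrepancy /edge_count -sumrB; apply: eq_big => [i|i _]; first by rewrite inE.
  rewrite -sumrB; apply: eq_big => [j|j _]; first by rewrite inE.
  by rewrite edge_probE.
set K := \sum_(i < n) _; set L := total_weight n (w n).
rewrite -ler_pdivrMr// -[X in _ / X](gtr0_norm Ln) -normfV -normrM mulrBl => h1.
have : `|c - K / L| <= e / 2.
  have -> : K / L = (Num.sqrt L)^-1 ^+ 2 * K.
    by rewrite exprVn sqr_sqrtr ?ltW// mulrC.
  rewrite /K /L; near: n.
  by move/cvgrPdist_le : int_c; exact.
have := ler_distD (K / L) c (edge_count n / L).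
by rewrite distrC in h1; lra.
Unshelve. all: by end_near. Qed.

Lemma edge_count_gt0 : \forall n \near \oo, 0 < edge_count n.
Proof.
have h : \forall n \near \oo, 0 < edge_count n / total_weight n (w n).
  exact: (cvgr_gt c edge_count_cvg).
near=> n; have Ln : 0 < total_weight n (w n) by near: n.
have : 0 < edge_count n / total_weight n (w n) by near: n.
by rewrite pmulr_lgt0// invr_gt0.
Unshelve. all: by end_near. Qed.

(** The width of the blocks of the stretched graph, with an arbitrary positive value
for the graphs without edges. *)
Definition graph_step (n : nat) : R :=
  if 0 < edge_count n then (Num.sqrt (edge_count n))^-1 else 1.

Lemma graph_step_gt0 n : 0 < graph_step n.
Proof. by rewrite /graph_step; case: ifP => // E0; rewrite invr_gt0 sqrtr_gt0. Qed.

Lemma graph_step_cvg :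
  graph_step n * Num.sqrt (total_weight n (w n)) @[n --> \oo] --> (Num.sqrt c)^-1.
Proof.
have : (Num.sqrt (edge_count n / total_weight n (w n)))^-1 @[n --> \oo] -->
    (Num.sqrt c)^-1.
  apply: cvgV; first by rewrite gt_eqF// sqrtr_gt0.
  by apply: continuous_cvg; [exact: sqrt_continuous|exact: edge_count_cvg].
apply: cvg_trans; apply: near_eq_cvg; near=> n.
have Ln : 0 < total_weight n (w n) by near: n.
have En : 0 < edge_count n by near: n; exact: edge_count_gt0.
by rewrite /graph_step En sqrtrM ?ltW// sqrtrV ?ltW// invfM invrK.
Unshelve. all: by end_near. Qed.

(** The pathwise part of the theorem, where small discrepancy stands for the
randomness of the graphs. The bound of [coupling_cut_norm_le] tends to [0], as [s ^ 2 L]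
tends to [1 / c]. *)
Lemma stretched_graph_cvg : stretched_cut_cvg g (GRG_graphon rho c).
Proof.
have sq := graph_step_cvg; have s0 := graph_step_gt0.
have K0 := sorted_kern_cvg w_ge0 L_gt0 rho_cvg small_mass c_gt0 s0 sq.
apply: cvge0_le => [n|e e0]; first exact: stretched_cut_distance_ge0.
have e2 : (0 < (e / 2)%:E :> \bar R)%E by rewrite lte_fin divr_gt0.
have eta0 : 0 < e * c / 4 by rewrite divr_gt0// mulr_gt0.
have sq2 : \forall n \near \oo, (graph_step n) ^+ 2 * total_weight n (w n) <= 2 / c.
  have h : (graph_step n * Num.sqrt (total_weight n (w n))) ^+ 2
      @[n --> \oo] --> (Num.sqrt c)^-1 ^+ 2.
    by rewrite expr2; under eq_fun do rewrite expr2; exact: cvgM.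
  have : \forall n \near \oo,
      (graph_step n * Num.sqrt (total_weight n (w n))) ^+ 2 <= 2 / c.
    apply: (cvgr_le _ h); rewrite exprVn sqr_sqrtr ?(ltW c_gt0)//.
    by rewrite ltr_pMl ?invr_gt0// ltr1n.
  move=> h2; near=> n; have Ln : 0 < total_weight n (w n) by near: n.
  rewrite -[X in _ * X]sqr_sqrtr ?(ltW Ln)// -exprMn.
  by near: n.
near=> n.
have Ln : 0 < total_weight n (w n) by near: n.
have n0 : (0 < n)%N by near: n; exact: nbhs_infty_gt.
have En : 0 < edge_count n by near: n; exact: edge_count_gt0.
rewrite /stretched_cut_distance stretch_canonical_graphon//.
rewrite (stretch_GRG_graphon w_ge0 L_gt0 rho_cvg small_mass int_c c_gt0).
have -> : (Num.sqrt (\sum_(i < n) \sum_(j < n) (g n i j)%:R))^-1 = graph_step n.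
  by rewrite /graph_step En.
pose gamma := block_coupling (graph_step n) (@weight_perm _ n (w n)).
apply: (@le_trans _ _ (coupling_cut_norm gamma
    (step_graphon (graph_step n) (fun i j => (g n i j)%:R)) (GRG_graphon rho c))).
  apply: ereal_inf_lbound; exists gamma => //=.
  by apply: block_coupling_lebesgue; [exact: s0|exact: weight_perm_inj].
have disc (S T : {set 'I_n}) :
    `|discrepancy (w n) (g n) S T| <= e * c / 4 * total_weight n (w n).
  by move: S T; near: n; exact: small_discrepancy.
apply: le_trans.
  apply: (@coupling_cut_norm_le _ n (graph_step n) (weight_perm (w n))
    (fun i j => (g n i j)%:R) (sorted_weight n (w n)) (limit_weight rho c) _ _ _
    _ _ _ _ _ _ (e * c / 4 * total_weight n (w n))) => //.
  - exact: weight_perm_inj.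
  - exact: (sorted_weight_ge0 (w_ge0 (n := n))).
  - exact: sorted_weight_eq0.
  - exact: limit_weight_ge0.
  - exact: (measurable_limit_weight c w_ge0 rho_cvg).
  - exact: (integral_limit_weight_lty w_ge0 L_gt0 rho_cvg c_gt0).
  - rewrite (integral_limit_kern w_ge0 L_gt0 rho_cvg small_mass int_c c_gt0).
    exact: ltry.
  - by move=> S T; rewrite discrepancy_weight_perm.
have -> : e%:E = ((e / 2)%:E + (e / 2)%:E)%E by rewrite -EFinD; congr EFin; lra.
apply: leeD; last by apply: ltW; near: n; exact: (cvge_lt_near K0 e2).
rewrite lee_fin mulrCA; have -> : e / 2 = e * c / 4 * (2 / c).
  set c' := c^-1; have : c * c' = 1 by rewrite mulfV ?gt_eqF.
  by move=> /(congr1 ( *%R (e / 2))); lra.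
rewrite ler_wpM2l ?(ltW eta0)//.
by near: n.
Unshelve. all: by end_near. Qed.

End pathwise_convergence.

Theorem corollary1p9 (R : realType)
    (w : nat -> nat -> R)
    (rho_w : {measure set (measurableTypeR R) -> \bar R}) (a c : R)
    (d : measure_display) (T : measurableType d) (P : probability T R)
    (G : forall n : nat, T -> rel 'I_n)
    (w_ge0 : forall n i : nat, (i < n)%N -> 0 <= w n i)
    (L_omega : total_weight n (w n) / ln (n%:R : R) @[n --> \oo] --> +oo)
    (rho_cvg : vague_cvg (fun n => weight_measure n (w n)) rho_w)
    (limsup_a : limn_esup (fun n =>
        \int[weight_measure n (w n)]_(x in `]0%R, eps]) (x : R)%:E)%E
      @[eps --> (0 : R)^'+] --> a%:E)
    (liminf_a : limn_einf (fun n =>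
        \int[weight_measure n (w n)]_(x in `]0%R, eps]) (x : R)%:E)%E
      @[eps --> (0 : R)^'+] --> a%:E)
    (int_c : (\int[weight_measure n (w n)]_(y in pos_reals R)
                \int[weight_measure n (w n)]_(x in pos_reals R)
                  ((x : R) * (y : R) / (1 + (x : R) * (y : R)))%:E)%E
      @[n --> \oo] --> c%:E)
    (c_gt0 : 0 < c)
    (hG : is_GRG_sequence P w G) :
  a = 0 ->
  {ae P, forall t, stretched_cut_cvg (fun n => G n t) (GRG_graphon rho_w c)}.
Proof.
move=> a0; rewrite a0 in limsup_a.
have small := small_scaled_weights w_ge0 limsup_a.
have L_gt0 : \forall n \near \oo, 0 < total_weight n (w n).
  move/cvgryPgt : L_omega => /(_ 0) h; near=> n.
  have n2 : (1 < n)%N by near: n; exact: nbhs_infty_gt.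
  have ln0 : 0 < ln (n%:R : R) by rewrite ln_gt0// ltr1n.
  have : 0 < total_weight n (w n) / ln n%:R by near: n.
  by rewrite pmulr_lgt0// invr_gt0.
have low (eta : R) : 0 < eta -> exists2 eps : R, 0 < eps & \forall n \near \oo,
    \sum_(i < n | w n i <= eps * Num.sqrt (total_weight n (w n))) w n i <=
      eta * total_weight n (w n).
  move=> eta0; have [eps eps0 epsP] := small eta eta0; exists eps => //; near=> n.
  have Ln : 0 < total_weight n (w n) by near: n.
  have : (Num.sqrt (total_weight n (w n)))^-1 *
      \sum_(i < n | scaled_weight n (w n) i <= eps) scaled_weight n (w n) i <= eta.
    by near: n.
  have -> : eta * total_weight n (w n) = eta *
      Num.sqrt (total_weight n (w n)) * Num.sqrt (total_weight n (w n)).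
    by rewrite -mulrA -expr2 sqr_sqrtr ?ltW.
  have : 0 < Num.sqrt (total_weight n (w n)) by rewrite sqrtr_gt0.
  rewrite /scaled_weight; move: (Num.sqrt _) => q q0.
  rewrite mulrC ler_pdivrMr// -[_ <= eta * q * q]ler_pdivrMr// mulr_suml.
  by apply: le_trans; under [leRHS]eq_bigl do rewrite ler_pdivrMr//.
apply: filterS (discrepancy_ae_small w_ge0 L_omega hG.1 low) => t ht.
exact: (stretched_graph_cvg w_ge0 L_gt0 rho_cvg small (sum_kern_cvg w_ge0 int_c)).
Unshelve. all: by end_near. Qed.
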